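(* Let $S(z)=\begin{pmatrix} a(z) & b(z)\\ \overline{b(z)} & c(z)\end{pmatrix}$, $z\in\mathbb{T}$, be a $2\times 2$ positive definite matrix-function on the unit circle with $a,b,c\in L_1(\mathbb{T})$, with $a(z)\ge 0$ and $\Delta(z):=a(z)c(z)-|b(z)|^2\ge 0$ for a.a. $z\in\mathbb{T}$, and with $\log\Delta\in L_1(\mathbb{T})$. Assume also that $S^{-1}\in L_1(\mathbb{T})$. Let $g^+,f^+\in H_2$ be the outer functions with $|g^+|^2=a$ and $|f^+|^2=\Delta/a$ a.e. on $\mathbb{T}$, $g^+(0)>0$, $f^+(0)>0$, and let $\varphi=\overline{b}/\overline{g^+}\in L_2(\mathbb{T})$. For $n=1,2,\ldots$ let $\varphi_n(z)=\sum_{k=-n}^{\infty}c_k(\varphi)z^k$ and $$S_n(z)=\begin{pmatrix} g^+(z) & 0\\ \varphi_n(z) & f^+(z)\end{pmatrix}\begin{pmatrix} \overline{g^+(z)} & \overline{\varphi_n(z)}\\ 0 & \overline{f^+(z)}\end{pmatrix}.$$ Let $\chi^+$ and $\chi_n^+$ be the canonical spectral factors of $S$ and $S_n$, respectively (normalized to be lower triangular with positive diagonal entries at $z=0$). Then, for every $n=1,2,\ldots$, $$\|\chi_n^+-\chi^+\|_{L_1}\le \sqrt{2}\,\|S\|_{L_1}^{1/2}\,\|S^{-1}\|_{L_1}^{1/4}\,\|\varphi_n-\varphi\|_{L_2}^{1/2}+\|\varphi_n-\varphi\|_{L_1}.$$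
   Context: Notation. $D=\{z\in\mathbb{C}:|z|<1\}$, $\mathbb{T}=\{z\in\mathbb{C}:|z|=1\}$. For $p\ge 1$, $L_p(\mathbb{T})$ is the usual Lebesgue space with norm $\|f\|_{L_p}=\left(\int_0^{2\pi}|f(e^{it})|^p\,dt\right)^{1/p}$, and $c_k(f)$ is the $k$-th Fourier coefficient of $f$. $H_p$ is the Hardy space of analytic functions on $D$, identified via boundary values with $L_p^+(\mathbb{T})=\{f\in L_p(\mathbb{T}): c_k(f)=0\text{ for }k<0\}$. A function $f\in H_p$ is outer if $f(z)=c\exp\left(\frac{1}{2\pi}\int_0^{2\pi}\frac{e^{it}+z}{e^{it}-z}\log|f(e^{it})|\,dt\right)$ for $z\in D$, with $|c|=1$. For a matrix-function $M$, $M\in L_p$ (or $H_p$) means that all entries belong to that space, and $\|M\|_{L_p}=\max_{i,j}\|M_{ij}\|_{L_p}$. $M^*=\overline{M}^T$ is the adjoint. Standing facts about the setting: $\log a\in L_1(\mathbb{T})$, so $g^+,f^+$ exist, and $S(z)=\begin{pmatrix} g^+ & 0\\ \varphi & f^+\end{pmatrix}\begin{pmatrix} \overline{g^+} & \overline{\varphi}\\ 0 & \overline{f^+}\end{pmatrix}$ a.e. on $\mathbb{T}$. Canonical spectral factor. For a positive definite integrable $2\times2$ matrix-function $R$ on $\mathbb{T}$ with $\log\det R\in L_1(\mathbb{T})$, the canonical spectral factor of $R$ is the unique analytic matrix-function $\chi$ on $D$ with entries in $H_2$ whose determinant is an outer function, such that $R(z)=\chi(z)\chi(z)^*$ for a.a.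 $z\in\mathbb{T}$, normalized by $[\chi(0)]_{12}=0$, $[\chi(0)]_{11}>0$, $[\chi(0)]_{22}>0$. Here $\chi^+$ is that of $S$ and $\chi_n^+$ is that of $S_n$ (note $\det S_n=|g^+f^+|^2=\Delta$). In the Janashia–Lagvilava algorithm, $\chi_n^+$ is obtained in the form $$\chi_n^+(z)=\begin{pmatrix} g^+(z) & 0\\ \varphi_n(z) & f^+(z)\end{pmatrix}\begin{pmatrix}\alpha_n^+(z) & \beta_n^+(z)\\ -\overline{\beta_n^+(z)} & \overline{\alpha_n^+(z)}\end{pmatrix},\quad z\in\mathbb{T},$$ where $\alpha_n^+,\beta_n^+$ are polynomials in $z$ of order $n$ with $|\alpha_n^+(z)|^2+|\beta_n^+(z)|^2=1$ for $|z|=1$, and it is known that $\|\chi_n^+-\chi^+\|_{H_2}\to 0$ as $n\to\infty$. *)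

(* Defs.v *)
From mathcomp Require Import all_boot all_order all_algebra.
From mathcomp Require Import all_classical all_reals all_analysis.
From mathcomp Require Import sesquilinear complex.

Set Implicit Arguments.
Unset Strict Implicit.
Unset Printing Implicit Defensive.

Import Order.TTheory GRing.Theory Num.Theory.
Import numFieldNormedType.Exports.

Local Open Scope classical_set_scope.
Local Open Scope ring_scope.

(* A function on the unit circle T is a map F : R[i] -> R[i] of which only the
   values F (cis t), t in [0, 2pi], are used.  A function of a Hardy space is
   a map on the closed disc: it is analytic inside, and its values on T are its
   boundary values.  Other values of F are irrelevant. *)

Section Circle.
Variable R : realType.
Implicit Types (F : R[i] -> R[i]) (p : R).

Definition cis (t : R) : R[i] := Complex (cos t) (sin t).

Definition cexp (z : R[i]) : R[i] :=
  (expR (complex.Re z))%:C%C * cis (complex.Im z).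

Definition cabs (z : R[i]) : R := complex.Re `|z|.

Definition period : set R := `[0, 2 * pi]%classic.

Definition ae_circle (P : R[i] -> Prop) : Prop :=
  {ae (@lebesgue_measure R), forall t, period t -> P (cis t)}.

(* The norm is not normalized: the circle has total mass 2 pi. *)
Definition Lpnorm p F : \bar R :=
  ((\int[@lebesgue_measure R]_(t in period) (cabs (F (cis t)) `^ p)%:E)
     `^ p^-1)%E.

(* Measurability is with respect to the Borel sets: every class of Lebesgue
   measurable functions modulo null sets has a Borel representative. *)
Definition Lp p F : Prop :=
  [/\ measurable_fun period (fun t => complex.Re (F (cis t))),
      measurable_fun period (fun t => complex.Im (F (cis t)))
    & (Lpnorm p F < +oo)%E].

Definition cintegral (h : R -> R[i]) : R[i] :=
  Complex (\int[@lebesgue_measure R]_(t in period) complex.Re (h t))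
          (\int[@lebesgue_measure R]_(t in period) complex.Im (h t)).

Definition fourier (k : int) F : R[i] :=
  ((2 * pi)^-1)%:C%C * cintegral (fun t => F (cis t) * cis t ^ (- k)).

(* psi is the sum in L_2(T) of the series \sum_(k >= -n) c_k(F) z^k;
   the summation index is j = k + n. *)
Definition fourier_tail_sum (n : nat) F (psi : R[i] -> R[i]) : Prop :=
  Lp 2 psi /\
  Lpnorm 2 (fun z => psi z - \sum_(0 <= j < N)
    fourier (j%:Z - n%:Z) F * z ^ (j%:Z - n%:Z)) @[N --> \oo] --> 0%E.

(* Derivability over the field R[i] is complex differentiability. *)
Definition analytic_disc F : Prop :=
  forall z : R[i], `|z| < 1 -> derivable (F : R[i]^o -> R[i]^o) z 1.

Definition hardy p F : Prop :=
  [/\ analytic_disc F,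
      exists M : R, forall r : R, 0 <= r < 1 ->
        (Lpnorm p (fun z => F (r%:C%C * z)%R) <= M%:E)%E,
      Lp p F
    & ae_circle (fun z =>
        (F (r%:C%C * z) : R[i]^o) @[r --> (1 : R)^'-] --> (F z : R[i]^o))].

(* As ln 0 = 0 in the library, integrability of log |F| is stated with the
   extended logarithm, for which lne 0 = -oo; this makes F nonzero almost
   everywhere, so that ln is the true logarithm in the integral. *)
Definition outer F : Prop :=
  (@lebesgue_measure R).-integrable period
    (fun t => lne (cabs (F (cis t)))%:E) /\
  exists2 c : R[i], `|c| = 1 & forall z : R[i], `|z| < 1 ->
    F z = c * cexp (((2 * pi)^-1)%:C%C *
      cintegral (fun t => (cis t + z) / (cis t - z) *
                          (ln (cabs (F (cis t))))%:C%C)).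

End Circle.

Section Matrices.
Variable R : realType.
Implicit Types (M chi : R[i] -> 'M[R[i]]_2).

Definition mx2 (x y z w : R[i]) : 'M[R[i]]_2 :=
  \matrix_(i, j) if i == 0 then (if j == 0 then x else y)
                 else (if j == 0 then z else w).

Definition posdefmx (A : 'M[R[i]]_2) : Prop :=
  (A ^t*)%sesqui = A /\
  forall x : 'cV[R[i]]_2, x != 0 -> 0 < ((x ^t*)%sesqui *m A *m x) 0 0.

Definition mxLp (p : R) M : Prop := forall i j, Lp p (fun z => M z i j).

Definition mxLpnorm (p : R) M : \bar R :=
  \big[maxe/0%E]_(i < 2) \big[maxe/0%E]_(j < 2) Lpnorm p (fun z => M z i j).

Definition canonical_spectral_factor M chi : Prop :=
  [/\ forall i j, hardy 2 (fun z => chi z i j),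
      outer (fun z => \det (chi z)),
      ae_circle (fun z => M z = chi z *m ((chi z) ^t*)%sesqui)
    & [/\ chi 0 0 1 = 0, 0 < chi 0 0 0 & 0 < chi 0 1 1]].

End Matrices.

(* Main.v *)
(* Write the triangular factors as L = (g, 0; phi, f) and L_n = (g, 0; phi_n, f).
   Since S = L L^* and S_n = L_n L_n^*, the matrices U = L^-1 chi and
   U_n = L_n^-1 chi_n are unitary.  Only the modulus of f matters, so f may be
   replaced by det chi / g; then U and U_n have determinant 1, because
   det chi = det chi_n (outer functions of equal modulus, positive at 0).  As
   chi_n - chi = (L_n - L) U_n + L (U_n - U), by Cauchy-Schwarz it is enough to
   bound the integral of D^2, half the squared Frobenius norm of U_n - U.  On the
   circle, D^2 = 2 - Re tr (U^-1 U_n), and with T = tr (chi^-1 chi_n)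
   this gives D^2 <= 2 - Re T + |phi_n - phi| / |f|, where 1 / |f|^2 is the last
   diagonal entry of S^-1.  The mean of T over the circle is T(0) = x + 1 / x >= 2,
   chi(0) and chi_n(0) being triangular with positive diagonals and equal
   determinants, so the integral of D^2 is at most that of |phi_n - phi| / |f|.

   The mean value property of T = P / h, with P a sum of products of H_2
   functions and h = det chi outer, is Smirnov's theorem.  It is proved with the
   outer functions q_k of boundary modulus min (1 / |h|, e^k): P q_k is in H_1,
   |q_k h| <= 1, and q_k h -> 1 in L_2 on all circles uniformly, since
   the mean of |q_k h - 1|^2 is at most 2 - 2 (q_k h)(0). *)

Require Import Defs.
From mathcomp Require Import all_boot all_order all_algebra.
From mathcomp Require Import all_classical all_reals all_analysis.
From mathcomp Require Import measurable_realfun complex.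
From mathcomp Require Import ring lra.

Set Implicit Arguments.
Unset Strict Implicit.
Unset Printing Implicit Defensive.

Import Order.TTheory GRing.Theory Num.Theory.
Import numFieldNormedType.Exports.
Local Open Scope classical_set_scope.
Local Open Scope ring_scope.

Local Notation Re := complex.Re.
Local Notation Im := complex.Im.
Local Notation "x %:C" := (x%:C)%C : ring_scope.

(** * Complex numbers *)

Section Modulus.
Variable R : realType.
Implicit Types (z w : R[i]) (x y : R).

(** The analytic facts come from one device. In the coordinate [w = ln r + i t] a circle becomes a
    vertical segment of length [2 pi], and [F o cexp] is analytic and periodic, so the Goursat
    theorem on a rectangle makes its integral over a period independent of [r]. For [F] itself this
    is the mean value property. For the product of [F] with a reflected conjugate it shows that the
    inner product of two dilates of [F] depends only on the product of the radii; this replaces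
    Taylor series in the proof that functions of [H_2] converge in [L_2] to their boundary values.

    The delicate point is the mean of [T]: it is integrable on the circle, but as a quotient by [h]
    it is not known to lie in a Hardy space, hence the truncations.

    The exponents come from two uses of Cauchy-Schwarz: the integral of [D^2] is at most
    [||phi_n - phi||_2 ||S^-1||_1^(1/2)], and its square root is multiplied by the [L_2] norm of a
    row of [L]. The rows of [L] have squared lengths [a] and [c], whence [||S||_1^(1/2)]. *)

Lemma complex_ext z w : Re z = Re w -> Im z = Im w -> z = w.
Proof. by case: z w => [a b] [c d] /= -> ->. Qed.

Lemma cReD z w : Re (z + w) = Re z + Re w. Proof. by case: z; case: w. Qed.
Lemma cImD z w : Im (z + w) = Im z + Im w. Proof. by case: z; case: w. Qed.
Lemma cReN z : Re (- z) = - Re z. Proof. by case: z. Qed.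
Lemma cImN z : Im (- z) = - Im z. Proof. by case: z. Qed.
Lemma cReM z w : Re (z * w) = Re z * Re w - Im z * Im w.
Proof. by case: z; case: w. Qed.
Lemma cImM z w : Im (z * w) = Re z * Im w + Im z * Re w.
Proof. by case: z; case: w. Qed.
Lemma cRe_conj z : Re (Num.conj z) = Re z. Proof. by case: z. Qed.
Lemma cIm_conj z : Im (Num.conj z) = - Im z. Proof. by case: z. Qed.

Lemma normC_cabs z : `|z| = (cabs z)%:C. Proof. by []. Qed.

Lemma cabs_sqrt z : cabs z = Num.sqrt (Re z ^+ 2 + Im z ^+ 2).
Proof. by case: z. Qed.

Lemma cabs_ge0 z : 0 <= cabs z. Proof. by rewrite cabs_sqrt sqrtr_ge0. Qed.

Lemma cabs_sqr z : cabs z ^+ 2 = Re z ^+ 2 + Im z ^+ 2.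
Proof. by rewrite cabs_sqrt sqr_sqrtr ?addr_ge0 ?sqr_ge0. Qed.

Lemma cabsM z w : cabs (z * w) = cabs z * cabs w.
Proof. by rewrite /cabs normrM !normC_cabs -rmorphM. Qed.

Lemma cabsN z : cabs (- z) = cabs z.
Proof. by rewrite /cabs normrN. Qed.

Lemma cabsB z w : cabs (z - w) = cabs (w - z).
Proof. by rewrite /cabs distrC. Qed.

Lemma cabsV z : cabs z^-1 = (cabs z)^-1.
Proof. by apply: (@complexI R); rewrite -normC_cabs normfV fmorphV. Qed.

Lemma cabs_conj z : cabs (Num.conj z) = cabs z.
Proof. by rewrite /cabs norm_conjC. Qed.

Lemma cabs_real x : cabs x%:C = `|x|.
Proof. by rewrite cabs_sqrt /= expr0n addr0 sqrtr_sqr. Qed.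

Lemma cabs0 : cabs (0 : R[i]) = 0. Proof. by rewrite /cabs normr0. Qed.
Lemma cabs1 : cabs (1 : R[i]) = 1. Proof. by rewrite /cabs normr1. Qed.

Lemma cabs_eq0 z : (cabs z == 0) = (z == 0).
Proof. by rewrite -(inj_eq (@complexI R)) -normC_cabs normr_eq0. Qed.

Lemma cabs_gt0 z : (0 < cabs z) = (z != 0).
Proof. by rewrite lt_def cabs_eq0 cabs_ge0 andbT. Qed.

Lemma cabsD_le z w : cabs (z + w) <= cabs z + cabs w.
Proof. by rewrite -lecR rmorphD /= -!normC_cabs ler_normD. Qed.

Lemma cabsB_le z w : cabs (z - w) <= cabs z + cabs w.
Proof. by rewrite -(cabsN w) cabsD_le. Qed.

Lemma cabs_ge_Re z : `|Re z| <= cabs z.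
Proof.
by rewrite cabs_sqrt -sqrtr_sqr ler_sqrt ?lerDl ?addr_ge0 ?sqr_ge0.
Qed.

Lemma cabs_ge_Im z : `|Im z| <= cabs z.
Proof.
by rewrite cabs_sqrt -sqrtr_sqr ler_sqrt ?lerDr ?addr_ge0 ?sqr_ge0.
Qed.

Lemma Re_le_cabs z : Re z <= cabs z.
Proof. exact: le_trans (ler_norm _) (cabs_ge_Re z). Qed.

Lemma cabs_le_ReIm z : cabs z <= `|Re z| + `|Im z|.
Proof.
rewrite -(ler_pXn2r (ltn0Sn 1)) ?nnegrE ?cabs_ge0 ?addr_ge0//.
by rewrite cabs_sqr sqrrD !real_normK ?num_real// lerD2r lerDl mulrn_wge0 ?mulr_ge0.
Qed.

Lemma mulC_conj z : z * Num.conj z = (cabs z ^+ 2)%:C.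
Proof. by rewrite -normCK normC_cabs -rmorphXn. Qed.

Lemma normC_lt z x : (`|z| < x%:C) = (cabs z < x).
Proof. by rewrite normC_cabs ltcR. Qed.

Lemma normC_lt1 z : (`|z| < 1) = (cabs z < 1).
Proof. exact: normC_lt. Qed.

End Modulus.

Section Trigonometric.
Variable R : realType.
Implicit Types (z w : R[i]) (s t : R).

Lemma cabs_cis t : cabs (cis t) = 1.
Proof. by rewrite cabs_sqrt /= cos2Dsin2 sqrtr1. Qed.

Lemma cis_neq0 t : cis t != 0.
Proof. by rewrite -cabs_eq0 cabs_cis oner_eq0. Qed.

Lemma cisD s t : cis (s + t) = cis s * cis t.
Proof.
by apply: complex_ext; rewrite ?cReM ?cImM /= ?cosD ?sinD// addrC mulrC [X in _ + X]mulrC.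
Qed.

Lemma cis0 : cis (0 : R) = 1.
Proof. by rewrite /cis cos0 sin0. Qed.

Lemma cis_2pi : cis (2 * pi : R) = 1.
Proof.
have -> : 2 * pi = pi + pi :> R by ring.
by rewrite cisD /cis cospi sinpi; apply: complex_ext => /=; ring.
Qed.

Lemma cexpD z w : cexp (z + w) = cexp z * cexp w.
Proof.
rewrite /cexp cReD cImD expRD cisD rmorphM /=; ring.
Qed.

Lemma cabs_cexp z : cabs (cexp z) = expR (Re z).
Proof. by rewrite /cexp cabsM cabs_cis mulr1 cabs_real ger0_norm ?expR_ge0. Qed.

Lemma cexp0 : cexp (0 : R[i]) = 1.
Proof. by rewrite /cexp /= expR0 cis0 mulr1. Qed.

Lemma cexp_neq0 z : cexp z != 0.
Proof. by rewrite -cabs_eq0 cabs_cexp gt_eqF ?expR_gt0. Qed.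

Lemma cexp_polar s t : cexp (Complex s t) = (expR s)%:C * cis t.
Proof. by []. Qed.

End Trigonometric.

(** * Integration *)

Section RealIntegral.
Context d (T : measurableType d) (R : realType).
Variable mu : {measure set T -> \bar R}.
Variables (D : set T) (mD : measurable D) (muD : (mu D < +oo)%E).
Implicit Types u v w : T -> R.

Local Notation ig u := (mu.-integrable D (EFin \o u)).
Local Notation "\Int u" := (Rintegral mu D u) (at level 10).

Lemma integrable_EFin_measurable u : ig u -> measurable_fun D u.
Proof. by move=> /measurable_int/measurable_EFinP. Qed.

Lemma integrable_EFinD u v : ig u -> ig v -> ig (fun t => u t + v t).
Proof. by move=> iu iv; have := integrableD mD iu iv; apply: eq_integrable. Qed.

Lemma integrable_EFinB u v : ig u -> ig v -> ig (fun t => u t - v t).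
Proof. by move=> iu iv; have := integrableB mD iu iv; apply: eq_integrable. Qed.

Lemma integrable_EFinZ k u : ig u -> ig (fun t => k * u t).
Proof. by move=> iu; have := integrableZl mD k iu; apply: eq_integrable. Qed.

Lemma integrable_EFin_norm u : ig u -> ig (fun t => `|u t|).
Proof. exact: integrable_norm. Qed.

Lemma integrable_EFin_bounded u M : measurable_fun D u ->
  (forall t, D t -> `|u t| <= M) -> ig u.
Proof.
move=> mu_ uM; apply: measurable_bounded_integrable => //.
exists M; split; first exact: num_real.
by move=> x Mx t Dt /=; exact: le_trans (uM _ Dt) (ltW Mx).
Qed.

Lemma integrable_EFin_cst k : ig (fun=> k).
Proof. by apply: (@integrable_EFin_bounded _ `|k|). Qed.

Lemma integrable_EFin_le u v : measurable_fun D u -> ig v ->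
  (forall t, D t -> `|u t| <= v t) -> ig u.
Proof.
move=> mu_ iv uv; apply: (le_integrable mD _ _ iv).
  exact/measurable_EFinP.
by move=> t Dt /=; rewrite lee_fin (le_trans (uv _ Dt))// ler_norm.
Qed.

Lemma Rintegral_ae_eq u v : measurable_fun D u -> measurable_fun D v ->
  {ae mu, forall t, D t -> u t = v t} -> \Int u = \Int v.
Proof.
move=> mu_ mv uv; rewrite /Rintegral; congr fine.
apply: ae_eq_integral => //; try exact/measurable_EFinP.
by apply: filterS uv => t uv Dt; rewrite uv.
Qed.

Lemma integrable_EFin_ae_eq u v : measurable_fun D v -> {ae mu, forall t, D t -> u t = v t} ->
  ig u -> ig v.
Proof.
move=> mv uv iu; apply/integrableP; split; first exact/measurable_EFinP.
have /integrableP[_] := iu; apply: le_lt_trans.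
rewrite le_eqVlt; apply/orP; left; apply/eqP; apply: ae_eq_integral => //.
- by apply/measurableT_comp => //; exact/measurable_EFinP.
- by apply/measurableT_comp => //; exact: measurable_int iu.
- by apply: filterS uv => t uv Dt /=; rewrite uv.
Qed.

(** Almost everywhere [v] equals [max u v], which dominates [u] at every point, so the pointwise
    comparison applies to [u] and [max u v]. *)
Lemma le_Rintegral_ae u v : ig u -> ig v ->
  {ae mu, forall t, D t -> u t <= v t} -> \Int u <= \Int v.
Proof.
move=> iu iv uv.
have mm : measurable_fun D (fun t => Order.max (u t) (v t)).
  by apply: measurable_maxr; exact: integrable_EFin_measurable.
have ae : {ae mu, forall t, D t -> v t = Order.max (u t) (v t)}.
  by apply: filterS uv => t uv Dt; rewrite max_r// uv.
rewrite (Rintegral_ae_eq (integrable_EFin_measurable iv) mm ae).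
apply: le_Rintegral => //; first exact: integrable_EFin_ae_eq ae iv.
by move=> t _; rewrite le_max lexx.
Qed.

(** Clamping [u] between [- v] and [v] changes it only on a null set and makes the bound by [|v|]
    valid everywhere. *)
Lemma integrable_EFin_ae_le u v : measurable_fun D u -> ig v ->
  {ae mu, forall t, D t -> `|u t| <= v t} -> ig u.
Proof.
move=> mu_ iv uv.
have mv := integrable_EFin_measurable iv.
have mm : measurable_fun D (fun t => Order.max (Order.min (u t) (v t)) (- v t)).
  by apply: measurable_maxr; [exact: measurable_minr|exact: measurable_funN].
apply: (@integrable_EFin_ae_eq (fun t => Order.max (Order.min (u t) (v t)) (- v t))) => //.
  apply: filterS uv => t uv Dt; have := uv Dt; rewrite ler_norml => /andP[h1 h2].
  by rewrite min_l// max_l.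
apply: (integrable_EFin_le mm (integrable_EFin_norm iv)) => t Dt.
have v1 := ler_norm (v t); have v2 : - v t <= `|v t| by rewrite -normrN ler_norm.
rewrite ler_norml le_max ge_max lerN2 v1 orbT v2 andbT /=.
by apply: le_trans v1; rewrite ge_min lexx orbT.
Qed.

Lemma dominated0 (f : nat -> T -> R) v : (forall n, measurable_fun D (f n)) ->
  ig v -> {ae mu, forall t, D t -> forall n, `|f n t| <= v t} ->
  {ae mu, forall t, D t -> f n t @[n --> \oo] --> 0} ->
  \Int (fun t => `|f n t|) @[n --> \oo] --> 0.
Proof.
move=> mf iv fv f0.
have h1 : {ae mu, forall t, D t -> (f n t)%:E @[n --> \oo] --> cst 0%E t}.
  by apply: filterS f0 => t + Dt => /(_ Dt) h; apply/cvg_EFin => //; exact: nearW.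
have h2 : {ae mu, forall t n, D t -> (`|(f n t)%:E| <= (v t)%:E)%E}.
  by apply: filterS fv => t fv n Dt; rewrite /= lee_fin; exact: fv.
have [_ h _] := @dominated_convergence _ T R mu D mD (fun n t => (f n t)%:E) (cst 0%E)
  (EFin \o v) (fun n => (measurable_EFinP _ _).2 (mf n)) (measurable_cst _) h1 iv h2.
apply: fine_cvg; apply: cvg_trans h.
apply: near_eq_cvg; apply: nearW => n /=.
by apply: eq_integral => t _; rewrite /cst /= subr0.
Qed.

(** This carries integral bounds on circles of radius less than 1 over to the boundary, where the
    limit is known only almost everywhere. The null set on which convergence may fail is removed
    before Fatou's lemma is applied, and the limit inferior is then a limit at every remaining
    point. *)
Lemma fatou_bound (f : nat -> T -> R) u c : (forall n, ig (f n)) ->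
  (forall n t, D t -> 0 <= f n t) -> (forall n, \Int (f n) <= c) ->
  measurable_fun D u -> (forall t, D t -> 0 <= u t) ->
  {ae mu, forall t, D t -> f n t @[n --> \oo] --> u t} ->
  ig u /\ \Int u <= c.
Proof.
move=> fi f0 fc mu_ u0 fu.
have h : (\int[mu]_(t in D) (u t)%:E <= c%:E)%E.
  have [N [mN N0 subN]] := fu.
  have mDN : measurable (D `\` N) by exact: measurableD.
  have DN : D `\` N `<=` D by move=> t [].
  have mf n : measurable_fun D (fun t => (f n t)%:E).
    exact: measurable_int (fi n).
  rewrite (ge0_negligible_integral mN)//; last first.
    exact: ((measurable_EFinP _ _).2 mu_).
  have F := @fatou _ T R mu (D `\` N) mDN (fun n t => (f n t)%:E) _ _.
  apply: le_trans (le_trans (F _ _) _).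
  - rewrite le_eqVlt; apply/orP; left; apply/eqP.
    apply: eq_integral => t; rewrite inE => -[Dt Nt].
    have fut : f n t @[n --> \oo] --> u t.
      by apply: contrapT => h; apply: Nt; apply: subN => /= /(_ Dt).
    have fut' : (f n t)%:E @[n --> \oo] --> (u t)%:E.
      by apply/cvg_EFin => //; exact: nearW.
    by rewrite (cvg_limn_einf_sup fut').1.
  - by move=> n; apply: measurable_funS (mf n).
  - by move=> n t [Dt _]; rewrite lee_fin f0.
  - rewrite limn_einf_lim; apply: lime_le; first exact: is_cvg_einfs.
    apply: nearW => n; rewrite /einfs /=.
    have h1 : (\int[mu]_(t in D `\` N) (f n t)%:E <= c%:E)%E.
      apply: (@le_trans _ _ (\int[mu]_(t in D) (f n t)%:E)%E).
        apply: ge0_subset_integral => //.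
        by move=> t Dt; rewrite lee_fin f0.
      have := fc n; rewrite -lee_fin /Rintegral fineK//.
      exact: integrable_fin_num (fi n).
    by apply: le_trans h1; apply: ereal_inf_lbound; exists n => /=.
split; last first.
  rewrite -lee_fin /Rintegral fineK// ge0_fin_numE ?(le_lt_trans h) ?ltry//.
  by apply: integral_ge0 => t Dt; rewrite lee_fin u0.
apply/integrableP; split; first exact/measurable_EFinP.
apply: le_lt_trans (ltry c); apply: le_trans h.
rewrite le_eqVlt; apply/orP; left; apply/eqP; apply: eq_integral => t.
by rewrite inE => Dt /=; rewrite ger0_norm ?u0.
Qed.

End RealIntegral.

(** * The Cauchy-Schwarz inequality and integrals of complex functions *)

Section ComplexIntegral.
Context d (T : measurableType d) (R : realType).
Variable mu : {measure set T -> \bar R}.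
Variables (D : set T) (mD : measurable D) (muD : (mu D < +oo)%E).
Implicit Types (u v w : T -> R) (f g h : T -> R[i]).

Local Notation ig u := (mu.-integrable D (EFin \o u)).
Local Notation "\Int u" := (Rintegral mu D u) (at level 10).

Lemma integrable_EFin_mul_sqr u v : measurable_fun D u -> measurable_fun D v ->
  ig (fun t => u t ^+ 2) -> ig (fun t => v t ^+ 2) -> ig (fun t => u t * v t).
Proof.
move=> mu_ mv iu iv; apply: (@integrable_EFin_le _ _ _ _ _ _ _
  (fun t => u t ^+ 2 + v t ^+ 2)) => //.
- exact: measurable_funM.
- exact: integrable_EFinD.
- move=> t _; rewrite normrM -(real_normK (num_real (u t))) -(real_normK (num_real (v t))).
  have := sqr_ge0 (`|u t| - `|v t|); have := mulr_ge0 (normr_ge0 (u t)) (normr_ge0 (v t)); nra.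
Qed.

(** The integral of [(x u - y v)^2] is a nonnegative quadratic form in [x] and [y]; its value at
    [x = B], [y = C] is [B (A B - C^2)]. *)
Lemma Cauchy_Schwarz u v : measurable_fun D u -> measurable_fun D v ->
  ig (fun t => u t ^+ 2) -> ig (fun t => v t ^+ 2) ->
  (\Int (fun t => u t * v t)) ^+ 2 <=
  \Int (fun t => u t ^+ 2) * \Int (fun t => v t ^+ 2).
Proof.
move=> mu_ mv iu iv; have iuv := integrable_EFin_mul_sqr mu_ mv iu iv.
set A := \Int (fun t => u t ^+ 2); set B := \Int (fun t => v t ^+ 2).
set C := \Int (fun t => u t * v t).
have q x y : 0 <= x ^+ 2 * A - 2 * x * y * C + y ^+ 2 * B.
  have -> : x ^+ 2 * A - 2 * x * y * C + y ^+ 2 * B =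
            \Int (fun t => (x * u t - y * v t) ^+ 2).
    have i1 := integrable_EFinZ mD (x ^+ 2) iu; have i2 := integrable_EFinZ mD (2 * x * y) iuv.
    have i3 := integrable_EFinZ mD (y ^+ 2) iv.
    rewrite -!RintegralZl// -RintegralB// -RintegralD//; last exact: integrable_EFinB.
    by apply: eq_Rintegral => t _; ring.
  by apply: Rintegral_ge0 => t _; exact: sqr_ge0.
have A0 : 0 <= A by apply: Rintegral_ge0 => t _; exact: sqr_ge0.
have B0 : 0 <= B by apply: Rintegral_ge0 => t _; exact: sqr_ge0.
have [B1|B1] := eqVneq B 0.
  have [->|C0] := eqVneq C 0; first by rewrite expr0n mulr_ge0.
  (* For [B = 0] and [C != 0] the form is affine in [y]; this value of [y] makes it equal to
     [-1]. *)
  have := q 1 ((A + 1) / (2 * C)); rewrite B1 mulr0 addr0 expr1n mul1r mulr1.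
  have -> : 2 * ((A + 1) / (2 * C)) * C = A + 1 by field.
  lra.
have := q B C; have {B1}B0 : 0 < B by rewrite lt_def B1.
have -> : B ^+ 2 * A - 2 * B * C * C + C ^+ 2 * B = B * (A * B - C ^+ 2) by ring.
by rewrite pmulr_rge0// subr_ge0.
Qed.

Lemma Cauchy_Schwarz_sqrt u v : measurable_fun D u -> measurable_fun D v ->
  ig (fun t => u t ^+ 2) -> ig (fun t => v t ^+ 2) ->
  \Int (fun t => u t * v t) <=
  Num.sqrt (\Int (fun t => u t ^+ 2)) * Num.sqrt (\Int (fun t => v t ^+ 2)).
Proof.
move=> mu_ mv iu iv.
have A0 : 0 <= \Int (fun t => u t ^+ 2) by apply: Rintegral_ge0 => t _; exact: sqr_ge0.
rewrite -sqrtrM// (le_trans (ler_norm _))// -sqrtr_sqr ler_sqrt ?Cauchy_Schwarz//.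
by rewrite mulr_ge0// Rintegral_ge0// => t _; exact: sqr_ge0.
Qed.

(** Writing [u^-1] as [u (u^2)^-1] keeps the base of the real power nonnegative; where [u = 0] both
    sides vanish, by the convention [0^-1 = 0]. *)
Lemma measurable_inv u : measurable_fun D u -> measurable_fun D (fun t => (u t)^-1).
Proof.
move=> mu_.
have -> : (fun t => (u t)^-1) = (fun t => u t * ((u t ^+ 2) `^ (-1))).
  apply/funext => t; have [->|u0] := eqVneq (u t) 0; first by rewrite invr0 mul0r.
  rewrite powR_inv1 ?sqr_ge0// expr2 invfM mulrA divff// mul1r //.
apply: measurable_funM => //.
by apply: (measurableT_comp (measurable_powR (-1))); exact: measurable_funX.
Qed.

Definition cmeasurable f : Prop :=
  measurable_fun D (fun t => Re (f t)) /\ measurable_fun D (fun t => Im (f t)).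

Lemma cmeasurable_cst (z : R[i]) : cmeasurable (fun=> z).
Proof. by split; exact: measurable_cst. Qed.

Lemma cmeasurable_real u : measurable_fun D u -> cmeasurable (fun t => (u t)%:C).
Proof. by move=> mu_; split => //; exact: measurable_cst. Qed.

Lemma cmeasurableD f g : cmeasurable f -> cmeasurable g ->
  cmeasurable (fun t => f t + g t).
Proof.
move=> [f1 f2] [g1 g2]; split.
  by under eq_fun do rewrite cReD; exact: measurable_funD.
by under eq_fun do rewrite cImD; exact: measurable_funD.
Qed.

Lemma cmeasurableN f : cmeasurable f -> cmeasurable (fun t => - f t).
Proof.
move=> [f1 f2]; split.
  by under eq_fun do rewrite cReN; exact: measurable_funN.
by under eq_fun do rewrite cImN; exact: measurable_funN.
Qed.

Lemma cmeasurableB f g : cmeasurable f -> cmeasurable g ->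
  cmeasurable (fun t => f t - g t).
Proof. by move=> mf mg; apply: cmeasurableD => //; exact: cmeasurableN. Qed.

Lemma cmeasurableM f g : cmeasurable f -> cmeasurable g ->
  cmeasurable (fun t => f t * g t).
Proof.
move=> [f1 f2] [g1 g2]; split.
  under eq_fun do rewrite cReM.
  by apply: measurable_funB; exact: measurable_funM.
under eq_fun do rewrite cImM.
by apply: measurable_funD; exact: measurable_funM.
Qed.

Lemma cmeasurable_conj f : cmeasurable f -> cmeasurable (fun t => Num.conj (f t)).
Proof.
move=> [f1 f2]; split.
  by under eq_fun do rewrite cRe_conj.
by under eq_fun do rewrite cIm_conj; exact: measurable_funN.
Qed.

Lemma measurable_cabs f : cmeasurable f -> measurable_fun D (fun t => cabs (f t)).
Proof.
move=> [f1 f2].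
have -> : (fun t => cabs (f t)) = (fun t => (Re (f t) ^+ 2 + Im (f t) ^+ 2) `^ 2^-1).
  by apply/funext => t; rewrite cabs_sqrt powR12_sqrt// addr_ge0 ?sqr_ge0.
apply: (measurableT_comp (measurable_powR 2^-1)).
by apply: measurable_funD; exact: measurable_funX.
Qed.

Lemma cmeasurableV f : cmeasurable f -> cmeasurable (fun t => (f t)^-1).
Proof.
move=> mf; have mc := measurable_cabs mf.
have -> : (fun t => (f t)^-1) = (fun t => (((cabs (f t)) ^+ 2)^-1)%:C * Num.conj (f t)).
  apply/funext => t; have [->|f0] := eqVneq (f t) 0.
    by rewrite invr0 conjC0 mulr0.
  by rewrite fmorphV /= -mulC_conj invfM mulrVK// unitfE conjC_eq0.
apply: cmeasurableM; last exact: cmeasurable_conj.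
by apply/cmeasurable_real/measurable_inv; exact: measurable_funX.
Qed.

Definition cintegrable f : Prop :=
  ig (fun t => Re (f t)) /\ ig (fun t => Im (f t)).

Definition cint f : R[i] :=
  Complex (\Int (fun t => Re (f t))) (\Int (fun t => Im (f t))).

Lemma cintegrable_cmeasurable f : cintegrable f -> cmeasurable f.
Proof.
move=> [f1 f2].
by split; [exact: integrable_EFin_measurable f1|exact: integrable_EFin_measurable f2].
Qed.

Lemma cintegrable_cabs f : cintegrable f -> ig (fun t => cabs (f t)).
Proof.
move=> fi; have [f1 f2] := fi.
apply: (integrable_EFin_le mD _
  (integrable_EFinD mD (integrable_EFin_norm f1) (integrable_EFin_norm f2))).
  exact/measurable_cabs/cintegrable_cmeasurable.
by move=> t _; rewrite ger0_norm ?cabs_ge0// cabs_le_ReIm.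
Qed.

Lemma cintegrable_ae_le f v : cmeasurable f -> ig v ->
  {ae mu, forall t, D t -> cabs (f t) <= v t} -> cintegrable f.
Proof.
move=> [f1 f2] iv fv; split.
  apply: (integrable_EFin_ae_le mD f1 iv); apply: filterS fv => t + Dt => /(_ Dt).
  exact: le_trans (cabs_ge_Re _).
apply: (integrable_EFin_ae_le mD f2 iv); apply: filterS fv => t + Dt => /(_ Dt).
exact: le_trans (cabs_ge_Im _).
Qed.

Lemma cintegrable_le f v : cmeasurable f -> ig v ->
  (forall t, D t -> cabs (f t) <= v t) -> cintegrable f.
Proof. by move=> mf iv fv; apply: cintegrable_ae_le iv _ => //; exact: aeW. Qed.

Lemma cintegrableD f g : cintegrable f -> cintegrable g ->
  cintegrable (fun t => f t + g t).
Proof.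
move=> [f1 f2] [g1 g2]; split.
  by under eq_fun do rewrite cReD; exact: integrable_EFinD.
by under eq_fun do rewrite cImD; exact: integrable_EFinD.
Qed.

Lemma cintegrableZ (z : R[i]) f : cintegrable f -> cintegrable (fun t => z * f t).
Proof.
move=> [f1 f2]; split.
  by under eq_fun do rewrite cReM; apply: integrable_EFinB => //; exact: integrable_EFinZ.
by under eq_fun do rewrite cImM; apply: integrable_EFinD => //; exact: integrable_EFinZ.
Qed.

Lemma cintegrableN f : cintegrable f -> cintegrable (fun t => - f t).
Proof.
by move=> /(cintegrableZ (-1)); under eq_fun do rewrite mulN1r.
Qed.

Lemma cintegrableB f g : cintegrable f -> cintegrable g ->
  cintegrable (fun t => f t - g t).
Proof. by move=> fi gi; apply: cintegrableD => //; exact: cintegrableN. Qed.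

Lemma cintD f g : cintegrable f -> cintegrable g ->
  cint (fun t => f t + g t) = cint f + cint g.
Proof.
move=> [f1 f2] [g1 g2]; apply: complex_ext => /=.
  by under eq_Rintegral do rewrite cReD; exact: RintegralD.
by under eq_Rintegral do rewrite cImD; exact: RintegralD.
Qed.

Lemma cintZ (z : R[i]) f : cintegrable f -> cint (fun t => z * f t) = z * cint f.
Proof.
move=> [f1 f2]; apply: complex_ext; rewrite ?cReM ?cImM /= -!RintegralZl//.
  rewrite -RintegralB//; try exact: integrable_EFinZ.
  by under eq_Rintegral do rewrite cReM.
rewrite -RintegralD//; try exact: integrable_EFinZ.
by under eq_Rintegral do rewrite cImM.
Qed.

Lemma cintB f g : cintegrable f -> cintegrable g ->
  cint (fun t => f t - g t) = cint f - cint g.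
Proof.
move=> fi gi; have := cintZ (-1) gi; rewrite mulN1r => <-.
rewrite -cintD//; last exact: cintegrableZ.
by congr cint; apply/funext => t; rewrite mulN1r.
Qed.

Lemma cint_cst (z : R[i]) : cint (fun=> z) = z * (fine (mu D))%:C.
Proof.
by apply: complex_ext; rewrite ?cReM ?cImM /= Rintegral_cst// mulr0 ?subr0 ?add0r.
Qed.

(** Real and imaginary parts are bounded separately, hence the factor 2. It is harmless: the bound
    serves only to make quantities arbitrarily small. *)
Lemma cabs_cint_le f : cintegrable f -> cabs (cint f) <= 2 * \Int (fun t => cabs (f t)).
Proof.
move=> fi; have [f1 f2] := fi; have ci := cintegrable_cabs fi.
apply: (le_trans (cabs_le_ReIm _)); rewrite mulr_natl mulr2n.
apply: lerD; apply: (le_trans (le_normr_Rintegral _ _)) => //; apply: le_Rintegral => //.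
- exact: integrable_EFin_norm.
- by move=> t _; exact: cabs_ge_Re.
- exact: integrable_EFin_norm.
- by move=> t _; exact: cabs_ge_Im.
Qed.

Lemma cint_ae_eq f g : cmeasurable f -> cmeasurable g ->
  {ae mu, forall t, D t -> f t = g t} -> cint f = cint g.
Proof.
move=> [f1 f2] [g1 g2] fg; apply: complex_ext => /=; apply: Rintegral_ae_eq => //;
  by apply: filterS fg => t fg Dt; rewrite fg.
Qed.

Lemma eq_cint f g : (forall t, D t -> f t = g t) -> cint f = cint g.
Proof.
move=> fg; apply: complex_ext => /=; apply: eq_Rintegral => t;
  by rewrite inE => Dt; rewrite fg.
Qed.

End ComplexIntegral.

(** * Complex derivatives and the Goursat theorem *)

Section ComplexDerivative.
Variable R : realType.
Implicit Types (F G : R[i] -> R[i]) (z w L : R[i]).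

(** Complex differentiability with real radii and without a quotient, so that [w = z] needs no
    separate treatment. *)
Definition cderiv F z L : Prop := forall e : R, 0 < e -> exists2 d : R, 0 < d &
  forall w, cabs (w - z) < d -> cabs (F w - F z - L * (w - z)) <= e * cabs (w - z).

Lemma posC_real (e : R[i]) : 0 < e -> exists2 r : R, 0 < r & e = r%:C.
Proof. by case: e => a b; rewrite ltcE /= => /andP[/eqP -> a0]; exists a. Qed.

Lemma cderiv_derivable F z L : cderiv F z L -> derivable (F : R[i]^o -> R[i]^o) z 1.
Proof.
move=> FL; apply/cvg_ex; exists L; apply/cvgrPdist_le => _ /posC_real[e e0 ->].
have [d d0 Fd] := FL _ e0.
rewrite /prop_near1 /nbhs /= /dnbhs /within /=.
exists (d%:C); first by rewrite /= ltcR.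
move=> h /=; rewrite sub0r normrN normC_lt => hd h0.
rewrite normC_cabs lecR.
have hpos : 0 < cabs h by rewrite cabs_gt0.
rewrite -(ler_pM2r hpos) -cabsM [h *: 1]mulr1.
have := Fd (h + z); rewrite addrK => /(_ hd).
have -> : (L - h^-1 * (F (h + z) - F z)) * h = - (F (h + z) - F z - L * h) by field.
by rewrite cabsN.
Qed.

Lemma derivable_cderiv F z : derivable (F : R[i]^o -> R[i]^o) z 1 ->
  exists L, cderiv F z L.
Proof.
move=> /cvg_ex[/= L FL]; exists L => e e0.
have /cvgrPdist_le/(_ e%:C) := FL; rewrite ltcR => /(_ e0).
rewrite /prop_near1 /nbhs /= /dnbhs /within /= => -[_ /= /posC_real[d d0 ->] H].
exists d => // w wd.
have [->|wz] := eqVneq w z; first by rewrite !subrr mulr0 subr0 cabs0 mulr0.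
have wz0 : w - z != 0 by rewrite subr_eq0.
have := H (w - z) _ wz0; rewrite /= sub0r normrN normC_lt => /(_ wd).
rewrite [_ *: 1]mulr1 subrK normC_cabs lecR.
have hpos : 0 < cabs (w - z) by rewrite cabs_gt0.
rewrite -(ler_pM2r hpos) -cabsM.
set A := F w - F z.
have -> : (L - (w - z)^-1 *: A) * (w - z) = - (A - L * (w - z)).
  by rewrite /GRing.scale /=; field.
by rewrite cabsN.
Qed.

Definition ccont F z : Prop := forall e : R, 0 < e -> exists2 d : R, 0 < d &
  forall w, cabs (w - z) < d -> cabs (F w - F z) <= e.

Lemma cderiv_ccont F z L : cderiv F z L -> ccont F z.
Proof.
move=> FL e e0; have [d d0 Fd] := FL 1 ltr01.
have k0 : 0 < 1 + cabs L by rewrite ltr_pwDl ?cabs_ge0.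
exists (Num.min d (e / (1 + cabs L))); first by rewrite lt_min d0 divr_gt0.
move=> w; rewrite lt_min => /andP[wd we].
have -> : F w - F z = (F w - F z - L * (w - z)) + L * (w - z) by ring.
apply: (le_trans (cabsD_le _ _)); rewrite cabsM.
apply: (@le_trans _ _ ((1 + cabs L) * cabs (w - z))).
  by rewrite mulrDl; apply: lerD => //; exact: Fd.
by rewrite mulrC -ler_pdivlMr// ltW.
Qed.

Lemma derivableM_C F G z : derivable (F : R[i]^o -> R[i]^o) z 1 ->
  derivable (G : R[i]^o -> R[i]^o) z 1 ->
  derivable ((fun w => F w * G w) : R[i]^o -> R[i]^o) z 1.
Proof. exact: (@derivableM R[i] R[i]^o). Qed.

Lemma derivable_compC F G z : derivable (F : R[i]^o -> R[i]^o) z 1 ->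
  derivable (G : R[i]^o -> R[i]^o) (F z) 1 ->
  derivable ((fun w => G (F w)) : R[i]^o -> R[i]^o) z 1.
Proof.
move=> /derivable1_diffP dF /derivable1_diffP dG.
by apply/derivable1_diffP; exact: (@differentiable_comp R[i] R[i]^o R[i]^o R[i]^o F G z dF dG).
Qed.

(** Schwarz reflection: conjugating both the argument and the value restores analyticity, the
    derivative becoming the conjugate of [L]. *)
Lemma derivable_conjC F z : derivable (F : R[i]^o -> R[i]^o) (Num.conj z) 1 ->
  derivable ((fun w => Num.conj (F (Num.conj w))) : R[i]^o -> R[i]^o) z 1.
Proof.
move=> /derivable_cderiv[L FL]; apply: (@cderiv_derivable _ _ (Num.conj L)) => e e0.
have [d d0 Fd] := FL _ e0; exists d => // w wd.
have := Fd (Num.conj w); rewrite -rmorphB cabs_conj => /(_ wd).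
by rewrite -[in X in X -> _]cabs_conj !(rmorphB, rmorphM) /= !conjCK.
Qed.

Lemma is_derive_littleo (f : R -> R) (x l : R) : is_derive x 1 f l ->
  forall e : R, 0 < e -> exists2 d : R, 0 < d &
  forall h, `|h| < d -> `|f (x + h) - f x - l * h| <= e * `|h|.
Proof.
move=> [df fl] e e0; move: (df) => /cvg_ex[/= l' FL].
have l'l : l' = l by rewrite -fl; apply/esym/cvg_lim.
subst l'.
have /cvgrPdist_le/(_ e e0) := FL.
rewrite /prop_near1 /nbhs /= /dnbhs /within /= => -[d /= d0 H].
exists d => // h hd; have [->|h0] := eqVneq h 0.
  by rewrite addr0 subrr mulr0 subr0 normr0 mulr0.
have := H h _ h0; rewrite /= sub0r normrN => /(_ hd).
have hpos : 0 < `|h| by rewrite normr_gt0.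
rewrite -(ler_pM2r hpos) -normrM [h *: 1]mulr1.
have -> : (l - h^-1 *: (f (h + x) - f x)) * h = - (f (x + h) - f x - l * h).
  by rewrite /GRing.scale /= [h + x]addrC; field.
by rewrite normrN.
Qed.

Lemma cexp_cderiv0 : cderiv (@cexp R) 0 1.
Proof.
(* The remainder splits into [(e^x - 1 - x) cis y], [(1 + x) (cis y - 1 - i y)] and [i x y], of
   moduli at most [k |h|], [3 k |h|] and [k |h|], which explains the 5. The minimum with 1 gives
   [|1 + x| <= 3 / 2]. *)
move=> e e0; pose k := Num.min 1 (e / 5); have k0 : 0 < k by rewrite lt_min ltr01 divr_gt0.
have [d1 d10 H1] := is_derive_littleo (is_derive_expR (0 : R)) k0.
have [d2 d20 H2] := is_derive_littleo (is_derive_cos (0 : R)) k0.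
have [d3 d30 H3] := is_derive_littleo (is_derive_sin (0 : R)) k0.
exists (Num.min (Num.min d1 d2) (Num.min d3 (k / 2))).
  by rewrite !lt_min d10 d20 d30 divr_gt0.
move=> h; rewrite !subr0 !lt_min => /andP[/andP[h1 h2] /andP[h3 h4]].
have xh := cabs_ge_Re h; have yh := cabs_ge_Im h.
set x := Re h in xh *; set y := Im h in yh *.
have {H1} := H1 x (le_lt_trans xh h1); have {H2} := H2 y (le_lt_trans yh h2).
have {H3} := H3 y (le_lt_trans yh h3).
rewrite !add0r expR0 sin0 cos0 oppr0 mul0r !(subr0, addr0) !mul1r => H3 H2 H1.
have -> : cexp h - cexp 0 - h =
  (expR x - 1 - x)%:C * cis y + (1 + x)%:C * (Complex (cos y - 1) (sin y - y))
   + Complex 0 (x * y).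
  rewrite cexp0; apply: complex_ext; rewrite /cexp -/x -/y.
    by rewrite !(cReD, cReM, cReN, cImN, cImD) /= -/x -/y; ring.
  by rewrite !(cReD, cReM, cReN, cImN, cImD, cImM) /= -/x -/y; ring.
have K : k <= 1 /\ k <= e / 5 by rewrite /k !ge_min !lexx orbT.
have [kl1 ke] := K.
have H : 0 <= cabs h by exact: cabs_ge0.
have x0 := normr_ge0 x; have y0 := normr_ge0 y.
apply: (le_trans (cabsD_le _ _)).
apply: (le_trans (lerD (cabsD_le _ _) (cabs_le_ReIm _))) => /=.
rewrite !cabsM cabs_cis mulr1 !cabs_real normr0 add0r normrM.
have B : cabs (Complex (cos y - 1) (sin y - y)) <= 2 * k * cabs h.
  apply: (le_trans (cabs_le_ReIm _)) => /=.
  have : k * `|y| <= k * cabs h by rewrite ler_pM2l.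
  lra.
have A : `|expR x - 1 - x| <= k * cabs h.
  by apply: (le_trans H1); rewrite ler_pM2l.
have C : `|1 + x| <= 3 / 2.
  apply: (le_trans (ler_normD _ _)); rewrite normr1.
  have : cabs h < 1 / 2 by lra.
  lra.
have E : `|x| * `|y| <= k * cabs h.
  by apply: ler_pM => //; apply: (le_trans xh); lra.
have F : `|1 + x| * cabs (Complex (cos y - 1) (sin y - y)) <= 3 / 2 * (2 * k * cabs h).
  by apply: ler_pM; rewrite ?cabs_ge0.
have : 5 * k * cabs h <= e * cabs h by apply: ler_wpM2r => //; lra.
lra.
Qed.

Lemma cexp_derivable z : derivable (@cexp R : R[i]^o -> R[i]^o) z 1.
Proof.
apply: (@cderiv_derivable _ _ (cexp z)) => e e0.
have k0 : 0 < e / expR (Re z) by rewrite divr_gt0 ?expR_gt0.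
have [d d0 H] := cexp_cderiv0 k0; exists d => // w wd.
have := H (w - z); rewrite subr0 => /(_ wd).
have -> : cexp w - cexp z - cexp z * (w - z) =
          cexp z * (cexp (w - z) - cexp 0 - 1 * (w - z)).
  have -> : cexp w = cexp z * cexp (w - z) by rewrite -cexpD addrC subrK.
  by rewrite cexp0; ring.
rewrite cabsM cabs_cexp mulrAC ler_pdivlMr ?expR_gt0//.
by rewrite mulrC.
Qed.

End ComplexDerivative.

(** * Nested rectangles *)

Section Bisection.
Variable R : realType.
Implicit Types (a b c e : R).

Definition quarters (bad : R -> R -> R -> R -> Prop) a b c e :=
  let m := (a + b) / 2 in let n := (c + e) / 2 in
  [\/ bad a m c n, bad m b c n, bad a m n e | bad m b n e].

(** Otherwise repeated quartering yields nested bad rectangles whose sides tend to 0; they shrink to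
    a point [(p, q)], near which the last hypothesis excludes bad rectangles. A rectangle of stage
    [n] is determined by [n] and its lower left corner, so dependent choice only has to produce
    triples [(n, (a, c))]. *)
Lemma rectangle_bisection (bad : R -> R -> R -> R -> Prop) a0 b0 c0 e0 :
  a0 <= b0 -> c0 <= e0 ->
  (forall a b c e, a0 <= a -> a <= b -> b <= b0 -> c0 <= c -> c <= e -> e <= e0 ->
     bad a b c e -> quarters bad a b c e) ->
  (forall p q, a0 <= p <= b0 -> c0 <= q <= e0 -> exists2 d, 0 < d &
     forall a b c e, a0 <= a -> b <= b0 -> c0 <= c -> e <= e0 ->
       a <= p <= b -> c <= q <= e -> b - a < d -> e - c < d -> ~ bad a b c e) ->
  ~ bad a0 b0 c0 e0.
Proof.
move=> ab0 ce0 split_bad loc bad0.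
pose w n : R := (b0 - a0) / 2 ^+ n; pose h n : R := (e0 - c0) / 2 ^+ n.
have w0 n : 0 <= w n by rewrite divr_ge0 ?subr_ge0 ?exprn_ge0.
have h0 n : 0 <= h n by rewrite divr_ge0 ?subr_ge0 ?exprn_ge0.
have wS n : w n = w n.+1 + w n.+1.
  have : (2 : R) ^+ n != 0 by rewrite expf_neq0.
  by rewrite /w exprS => ?; field.
have hS n : h n = h n.+1 + h n.+1.
  have : (2 : R) ^+ n != 0 by rewrite expf_neq0.
  by rewrite /h exprS => ?; field.
pose inv (x : nat * (R * R)) := [/\ a0 <= x.2.1 /\ x.2.1 + w x.1 <= b0,
   c0 <= x.2.2 /\ x.2.2 + h x.1 <= e0
   & bad x.2.1 (x.2.1 + w x.1) x.2.2 (x.2.2 + h x.1)].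
pose rel (x y : {x : nat * (R * R) | `[< inv x >]}) := [/\ (sval y).1 = (sval x).1.+1,
  (sval x).2.1 <= (sval y).2.1 <= (sval x).2.1 + w (sval x).1.+1 &
  (sval x).2.2 <= (sval y).2.2 <= (sval x).2.2 + h (sval x).1.+1].
have step x : exists y, rel x y.
  case: x => [[n [a c]] /= ix]; have /asboolP[/= [a1 a2] [c1 c2] bad1] := ix.
  have mid u v : (u + (u + v)) / 2 = u + v / 2 :> R by field.
  have w2 : w n / 2 = w n.+1 by rewrite wS; field.
  have h2 : h n / 2 = h n.+1 by rewrite hS; field.
  have wp := w0 n.+1; have hp := h0 n.+1.
  have := split_bad _ _ _ _ a1 _ a2 c1 _ c2 bad1.
  rewrite !lerDl /quarters !mid w2 h2 => /(_ (w0 _) (h0 _)) H.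
  have mk a' c' : a <= a' -> a' <= a + w n.+1 -> c <= c' -> c' <= c + h n.+1 ->
      bad a' (a' + w n.+1) c' (c' + h n.+1) -> exists y, rel (exist _ (n, (a, c)) ix) y.
    move=> u1 u2 u3 u4 u5.
    have iy : `[< inv (n.+1, (a', c')) >].
      apply/asboolP; split => //=; split; rewrite ?(wS n) ?(hS n) in a2 c2 *; lra.
    by exists (exist _ (n.+1, (a', c')) iy); split => //=; rewrite ?u1 ?u2 ?u3 ?u4.
  rewrite (wS n) (hS n) !addrA in H.
  by case: H => H; [apply: (mk a c)|apply: (mk (a + w n.+1) c)
    |apply: (mk a (c + h n.+1))|apply: (mk (a + w n.+1) (c + h n.+1))]; rewrite ?lerDl.
have bad_inv0 : `[< inv (0%N, (a0, c0)) >].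
  have e1 : a0 + w 0%N = b0 by rewrite /w expr0 divr1 addrC subrK.
  have e2 : c0 + h 0%N = e0 by rewrite /h expr0 divr1 addrC subrK.
  by apply/asboolP; split; rewrite /= ?e1 ?e2.
have [f [f0 fS]] := @dependent_choice _ rel (fun x => cid (step x))
  (exist _ (0%N, (a0, c0)) bad_inv0).
pose A n := (sval (f n)).2.1; pose C n := (sval (f n)).2.2.
have fn n : (sval (f n)).1 = n.
  by elim: n => [|n IH]; [rewrite f0|case: (fS n) => -> _ _; rewrite IH].
have Inv n : [/\ a0 <= A n /\ A n + w n <= b0, c0 <= C n /\ C n + h n <= e0
   & bad (A n) (A n + w n) (C n) (C n + h n)].
  by have /asboolP := svalP (f n); rewrite /inv fn.
have Astep n : A n <= A n.+1 <= A n + w n.+1.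
  by have [_ H _] := fS n; rewrite fn in H.
have Cstep n : C n <= C n.+1 <= C n + h n.+1.
  by have [_ _ H] := fS n; rewrite fn in H.
(* The left ends increase and the right ends [B n + v n] decrease, so the supremum of the left ends
   lies in every interval. *)
have nested (B v : nat -> R) : (forall n, B n <= B n.+1 <= B n + v n.+1) ->
    (forall n, 0 <= v n) -> (forall n, v n = v n.+1 + v n.+1) ->
    forall n, B n <= sup (range B) <= B n + v n.
  move=> Bs v0 vS.
  have mono m n : (m <= n)%N -> B m <= B n.
    elim: n => [|n IH]; first by rewrite leqn0 => /eqP ->.
    rewrite leq_eqVlt => /predU1P[->//|]; rewrite ltnS => /IH.
    by move/le_trans; apply; have /andP[] := Bs n.
  have anti m n : (m <= n)%N -> B n + v n <= B m + v m.
    elim: n => [|n IH]; first by rewrite leqn0 => /eqP ->.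
    rewrite leq_eqVlt => /predU1P[->//|]; rewrite ltnS => /IH.
    by apply: le_trans; have /andP[_] := Bs n; rewrite (vS n); lra.
  have ub n : ubound (range B) (B n + v n).
    move=> _ [m _ <-]; have /orP[mn|nm] := leq_total m n.
      by apply: (le_trans (mono _ _ mn)); rewrite lerDl.
    by apply: le_trans (anti _ _ nm); rewrite lerDl.
  move=> n; apply/andP; split.
    by apply: ub_le_sup; [exists (B 0%N + v 0%N); exact: ub|exists n].
  by apply: ge_sup; [exists (B 0%N); exists 0%N|exact: ub].
have pA := nested A w Astep w0 wS; have qC := nested C h Cstep h0 hS.
set p := sup _ in pA; set q := sup _ in qC.
have w_0 : w 0%N = b0 - a0 by rewrite /w expr0 divr1.
have h_0 : h 0%N = e0 - c0 by rewrite /h expr0 divr1.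
have [d d0 Hd] : exists2 d, 0 < d &
     forall a b c e, a0 <= a -> b <= b0 -> c0 <= c -> e <= e0 ->
       a <= p <= b -> c <= q <= e -> b - a < d -> e - c < d -> ~ bad a b c e.
  have [[A1 A2] [C1 C2] _] := Inv 0%N.
  apply: loc.
    by have /andP[u1 u2] := pA 0%N; apply/andP; split; lra.
  by have /andP[u1 u2] := qC 0%N; apply/andP; split; lra.
have [n [wn hn]] : exists n, w n < d /\ h n < d.
  have [n nP] : exists n : nat, (b0 - a0 + (e0 - c0)) / d < 2 ^+ n.
    exists (Num.bound ((b0 - a0 + (e0 - c0)) / d)).
    have x0 : 0 <= (b0 - a0 + (e0 - c0)) / d by apply: divr_ge0; lra.
    apply: (lt_trans (archi_boundP x0)).
    by rewrite -natrX ltr_nat ltn_expl.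
  exists n; rewrite /w /h !ltr_pdivrMr ?exprn_gt0//.
  by move: nP; rewrite ltr_pdivrMr// mulrC; split; lra.
have [[A1 A2] [C1 C2] badn] := Inv n.
by apply: (Hd _ _ _ _ A1 A2 C1 C2 (pA n) (qC n) _ _ badn); rewrite addrC addKr.
Qed.

End Bisection.

(** * Integrals along boundaries of rectangles *)

Section Goursat.
Variable R : realType.
Local Notation mu := (@lebesgue_measure R).
Implicit Types (a b c e s t : R) (F : R -> R[i]) (K : R[i] -> R[i]).

Definition rcont F t : Prop := forall e : R, 0 < e -> exists2 d : R, 0 < d &
  forall s, `|s - t| < d -> cabs (F s - F t) <= e.

Lemma rcont_continuous F t : rcont F t ->
  {for t, continuous (fun s => Re (F s) : R)} /\
  {for t, continuous (fun s => Im (F s) : R)}.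
Proof.
move=> Ft; split; apply/cvgrPdist_le => e e0; have [d d0 H] := Ft _ e0;
  exists d => //= s hs; have {}H := H s; rewrite distrC in H; have {H}H := H hs;
  apply: le_trans H; rewrite cabsB.
  by rewrite -cReN -cReD cabs_ge_Re.
by rewrite -cImN -cImD cabs_ge_Im.
Qed.

Lemma mu_segment a b : a <= b -> mu `[a, b] = (b - a)%:E.
Proof.
move=> ab; rewrite lebesgue_measure_itv /= lte_fin.
case: ltP => [//|ba]; have -> : b = a by apply/eqP; rewrite eq_le ab ba.
by rewrite subrr.
Qed.

Lemma mu_segment_lty a b : (mu `[a, b] < +oo)%E.
Proof. by rewrite lebesgue_measure_itv; case: ifP => _; rewrite ltry. Qed.

Lemma rcont_cintegrable F a b : (forall t, a <= t <= b -> rcont F t) ->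
  cintegrable mu `[a, b] F.
Proof.
move=> FC; split; apply: continuous_compact_integrable;
  try exact: segment_compact;
  apply: continuous_in_subspaceT => t; rewrite inE /= in_itv /= => tab;
  by have [] := rcont_continuous (FC t tab).
Qed.

Lemma cintegrable_segment_cst a b (z : R[i]) : cintegrable mu `[a, b] (fun=> z).
Proof.
by apply: rcont_cintegrable => t _ e e0; exists 1 => // s _; rewrite subrr cabs0 ltW.
Qed.

Lemma cint_segment_cst a b (z : R[i]) : a <= b ->
  cint mu `[a, b] (fun=> z) = z * (b - a)%:C.
Proof.
move=> ab; rewrite cint_cst; last exact: measurable_itv.
by have /(congr1 fine) /= -> := mu_segment ab.
Qed.

Lemma cint_split F a m b : a <= m -> m <= b -> cintegrable mu `[a, b] F ->
  cint mu `[a, b] F = cint mu `[a, m] F + cint mu `[m, b] F.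
Proof.
move=> am mb [F1 F2].
have H (u : R -> R) : mu.-integrable `[a, b] (EFin \o u) ->
    Rintegral mu `[a, b] u = Rintegral mu `[a, m] u + Rintegral mu `[m, b] u.
  move=> iu; apply/eqP; rewrite addrC -subr_eq; apply/eqP.
  rewrite (Rintegral_itvB iu) ?bnd_simp// Rintegral_itv_obnd_cbnd//.
  apply: integrableS iu => //.
  by apply: subset_itvr; rewrite bnd_simp.
by apply: complex_ext; rewrite ?cReD ?cImD /=; exact: H.
Qed.

Lemma cabs_cint_bound F a b M : a <= b -> cintegrable mu `[a, b] F ->
  (forall t, a <= t <= b -> cabs (F t) <= M) ->
  cabs (cint mu `[a, b] F) <= 2 * M * (b - a).
Proof.
move=> ab Fi FM.
have mab : measurable (`[a, b] : set R) by exact: measurable_itv.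
apply: (le_trans (cabs_cint_le _ Fi)) => //.
rewrite -mulrA ler_pM2l//.
apply: (@le_trans _ _ (Rintegral mu `[a, b] (fun=> M))).
  apply: le_Rintegral => //.
  - exact: cintegrable_cabs.
  - by apply: integrable_EFin_cst => //; exact: mu_segment_lty.
by rewrite Rintegral_cst//; have /(congr1 fine) /= -> := mu_segment ab.
Qed.

Lemma ccont_horizontal K s t : ccont K (Complex s t) ->
  rcont (fun x => K (Complex x t)) s.
Proof.
move=> KC e e0; have [d d0 H] := KC _ e0; exists d => // x xs; apply: H.
have -> : Complex x t - Complex s t = (x - s)%:C by apply: complex_ext => //=; rewrite subrr.
by rewrite cabs_real.
Qed.

Lemma ccont_vertical K s t : ccont K (Complex s t) ->
  rcont (fun y => K (Complex s y)) t.
Proof.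
move=> KC e e0; have [d d0 H] := KC _ e0; exists d => // y yt; apply: H.
apply: le_lt_trans yt; apply: (le_trans (cabs_le_ReIm _)) => /=.
by rewrite subrr normr0 add0r.
Qed.

(* Opposite sides are subtracted before integrating, so that an affine [K]
   contributes only integrals of constants. *)
Definition boundary_integral K a b c e : R[i] :=
  cint mu `[a, b] (fun s => K (Complex s c) - K (Complex s e)) +
  'i%C * cint mu `[c, e] (fun t => K (Complex b t) - K (Complex a t)).

Section Rectangle.
Variables (K : R[i] -> R[i]) (a0 b0 c0 e0 : R).
Hypothesis dK : forall s t, a0 <= s <= b0 -> c0 <= t <= e0 ->
  derivable (K : R[i]^o -> R[i]^o) (Complex s t) 1.

Let hi s t : a0 <= s <= b0 -> c0 <= t <= e0 -> ccont K (Complex s t).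
Proof. by move=> s0 t0; have [L /cderiv_ccont] := derivable_cderiv (dK s0 t0). Qed.

Let horizontal a b t : a0 <= a -> b <= b0 -> c0 <= t <= e0 ->
  cintegrable mu `[a, b] (fun s => K (Complex s t)).
Proof.
move=> ha hb ht; apply: rcont_cintegrable => s /andP[s1 s2].
by apply: ccont_horizontal; apply: hi => //; apply/andP; split; lra.
Qed.

Let vertical c e s : c0 <= c -> e <= e0 -> a0 <= s <= b0 ->
  cintegrable mu `[c, e] (fun t => K (Complex s t)).
Proof.
move=> ha hb ht; apply: rcont_cintegrable => t /andP[s1 s2].
by apply: ccont_vertical; apply: hi => //; apply/andP; split; lra.
Qed.

Local Notation J := (boundary_integral K).

Lemma boundary_integral_split_h a m b c e : a0 <= a -> a <= m -> m <= b -> b <= b0 ->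
  c0 <= c -> c <= e -> e <= e0 -> J a b c e = J a m c e + J m b c e.
Proof.
move=> h1 h2 h3 h4 h5 h6 h7; rewrite /boundary_integral.
have mce : measurable (`[c, e] : set R) by exact: measurable_itv.
have mab : measurable (`[a, b] : set R) by exact: measurable_itv.
have Ha x : a <= x <= b -> cintegrable mu `[c, e] (fun t => K (Complex x t)).
  by move=> /andP[x1 x2]; apply: vertical => //; apply/andP; split; lra.
rewrite (cint_split h2 h3); last first.
  by apply: cintegrableB => //; apply: horizontal => //; apply/andP; split; lra.
rewrite !(@cintB _ _ _ mu _ mce); try by apply: Ha; apply/andP; split; lra.
by ring.
Qed.

Lemma boundary_integral_split_v a b c m e : a0 <= a -> a <= b -> b <= b0 ->
  c0 <= c -> c <= m -> m <= e -> e <= e0 -> J a b c e = J a b c m + J a b m e.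
Proof.
move=> h1 h2 h3 h4 h5 h6 h7; rewrite /boundary_integral.
have mce : measurable (`[c, e] : set R) by exact: measurable_itv.
have mab : measurable (`[a, b] : set R) by exact: measurable_itv.
have Ha x : c <= x <= e -> cintegrable mu `[a, b] (fun t => K (Complex t x)).
  by move=> /andP[x1 x2]; apply: horizontal => //; apply/andP; split; lra.
rewrite (cint_split h5 h6); last first.
  by apply: cintegrableB => //; apply: vertical => //; apply/andP; split; lra.
rewrite !(@cintB _ _ _ mu _ mab); try by apply: Ha; apply/andP; split; lra.
by ring.
Qed.

(** The affine part of [K] at [p + i q] has boundary integral 0, so only the remainder [E] counts.
    On the rectangle [E] is at most [eta / 4] times the half perimeter [S]: one factor 2 is spent on
    the difference of opposite sides, another in [cabs_cint_bound], and the side lengths add up to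
    [S]. *)
Lemma boundary_integral_local p q eta : a0 <= p <= b0 -> c0 <= q <= e0 -> 0 < eta ->
  exists2 d, 0 < d & forall a b c e, a0 <= a -> b <= b0 -> c0 <= c -> e <= e0 ->
  a <= p <= b -> c <= q <= e -> b - a < d -> e - c < d ->
  cabs (J a b c e) <= eta * (b - a + (e - c)) ^+ 2.
Proof.
move=> pP qP eta0; have [L KL] := derivable_cderiv (dK pP qP).
have k0 : 0 < eta / 4 by rewrite divr_gt0.
have [d d0 H] := KL _ k0; exists (d / 2); first by rewrite divr_gt0.
move=> a b c e h1 h2 h3 h4 /andP[h5 h6] /andP[h7 h8] wd hd.
pose E w := K w - K (Complex p q) - L * (w - Complex p q).
set S := b - a + (e - c).
have EB s t : a <= s <= b -> c <= t <= e -> cabs (E (Complex s t)) <= eta / 4 * S.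
  move=> /andP[s1 s2] /andP[t1 t2].
  have B : cabs (Complex s t - Complex p q) <= S.
    apply: (le_trans (cabs_le_ReIm _)); rewrite /S /=.
    by apply: lerD; rewrite ler_norml; apply/andP; split; lra.
  apply: (le_trans (H _ _)); first by apply: (le_lt_trans B); rewrite /S; lra.
  by rewrite ler_pM2l.
have S0 : 0 <= S by rewrite /S; lra.
have ab : a <= b by lra.
have ce : c <= e by lra.
have mce : measurable (`[c, e] : set R) by exact: measurable_itv.
have mab : measurable (`[a, b] : set R) by exact: measurable_itv.
have mu1 := mu_segment_lty a b; have mu2 := mu_segment_lty c e.
(* The two subtracted constants, integrated over their segments and weighted as in
   [boundary_integral], contribute opposite numbers. *)
have -> : J a b c e =
    cint mu `[a, b] (fun s => K (Complex s c) - K (Complex s e) - L * 'i%C * (c - e)%:C)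
  + 'i%C * cint mu `[c, e] (fun t => K (Complex b t) - K (Complex a t) - L * (b - a)%:C).
  have i1 : cintegrable mu `[a, b] (fun s => K (Complex s c) - K (Complex s e)).
    by apply: cintegrableB => //; apply: horizontal => //; apply/andP; split; lra.
  have i2 : cintegrable mu `[c, e] (fun t => K (Complex b t) - K (Complex a t)).
    by apply: cintegrableB => //; apply: vertical => //; apply/andP; split; lra.
  rewrite (@cintB _ _ _ mu _ mab _ _ i1) ?(@cintB _ _ _ mu _ mce _ _ i2);
    try exact: cintegrable_segment_cst.
  by rewrite !cint_segment_cst// !rmorphB /= /boundary_integral; ring.
have I1 : cintegrable mu `[a, b] (fun s => K (Complex s c) - K (Complex s e) - L * 'i%C * (c - e)%:C).
  apply: cintegrableB => //; last exact: cintegrable_segment_cst.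
  by apply: cintegrableB => //; apply: horizontal => //; apply/andP; split; lra.
have I2 : cintegrable mu `[c, e] (fun t => K (Complex b t) - K (Complex a t) - L * (b - a)%:C).
  apply: cintegrableB => //; last exact: cintegrable_segment_cst.
  by apply: cintegrableB => //; apply: vertical => //; apply/andP; split; lra.
have B1 : cabs (cint mu `[a, b] (fun s => K (Complex s c) - K (Complex s e) - L * 'i%C * (c - e)%:C))
    <= 2 * (eta / 2 * S) * (b - a).
  apply: cabs_cint_bound => // s sP.
  have -> : K (Complex s c) - K (Complex s e) - L * 'i%C * (c - e)%:C =
      E (Complex s c) - E (Complex s e).
    rewrite /E; have -> : Complex s c = Complex s e + 'i%C * (c - e)%:C.
      by apply: complex_ext; rewrite ?cReD ?cImD ?cReM ?cImM /=; ring.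
    ring.
  apply: (le_trans (cabsB_le _ _)).
  have -> : eta / 2 * S = eta / 4 * S + eta / 4 * S by field.
  by apply: lerD; apply: EB => //; rewrite ?lexx ?ce.
have B2 : cabs (cint mu `[c, e] (fun t => K (Complex b t) - K (Complex a t) - L * (b - a)%:C))
    <= 2 * (eta / 2 * S) * (e - c).
  apply: cabs_cint_bound => // s sP.
  have -> : K (Complex b s) - K (Complex a s) - L * (b - a)%:C =
      E (Complex b s) - E (Complex a s).
    rewrite /E; have -> : Complex b s = Complex a s + (b - a)%:C.
      by apply: complex_ext; rewrite ?cReD ?cImD ?cReM ?cImM /=; ring.
    ring.
  apply: (le_trans (cabsB_le _ _)).
  have -> : eta / 2 * S = eta / 4 * S + eta / 4 * S by field.
  by apply: lerD; apply: EB => //; rewrite ?lexx ?ab.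
apply: (le_trans (cabsD_le _ _)).
have -> : cabs ('i%C * cint mu `[c, e] (fun t => K (Complex b t) - K (Complex a t) - L * (b - a)%:C)) =
  cabs (cint mu `[c, e] (fun t => K (Complex b t) - K (Complex a t) - L * (b - a)%:C)).
  by rewrite cabsM [cabs 'i%C]cabs_sqrt /= expr0n expr1n add0r sqrtr1 mul1r.
apply: (le_trans (lerD B1 B2)).
rewrite /S; lra.
Qed.

(** A rectangle is bad when its integral exceeds [eta] times the square of its half perimeter.
    Halving both sides divides this square by 4, so some quarter of a bad rectangle is bad, while
    [boundary_integral_local] excludes small bad rectangles around any given point. *)
Lemma boundary_integral_eq0 : a0 <= b0 -> c0 <= e0 -> J a0 b0 c0 e0 = 0.
Proof.
move=> ab0 ce0; apply/eqP; rewrite -cabs_eq0 eq_le cabs_ge0 andbT.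
have key eta : 0 < eta -> cabs (J a0 b0 c0 e0) <= eta * (b0 - a0 + (e0 - c0)) ^+ 2.
  move=> eta0; rewrite leNgt; apply/negP.
  pose bad a b c e : Prop := eta * (b - a + (e - c)) ^+ 2 < cabs (J a b c e).
  apply: (@rectangle_bisection R bad) => //.
  - move=> a b c e h1 h2 h3 h4 h5 h6; rewrite /quarters /bad.
    set m := (a + b) / 2; set n := (c + e) / 2.
    have m1 : a <= m by rewrite /m; lra.
    have m2 : m <= b by rewrite /m; lra.
    have n1 : c <= n by rewrite /n; lra.
    have n2 : n <= e by rewrite /n; lra.
    have -> : J a b c e = J a m c n + J m b c n + (J a m n e + J m b n e).
      rewrite (boundary_integral_split_v h1 h2 h3 h4 n1 n2 h6).
      by rewrite !(@boundary_integral_split_h a m b)//; lra.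
    move=> B.
    have [h|h] := ltP (eta * (m - a + (n - c)) ^+ 2) (cabs (J a m c n)).
      by apply: Or41.
    have [h'|h'] := ltP (eta * (b - m + (n - c)) ^+ 2) (cabs (J m b c n)).
      by apply: Or42.
    have [h''|h''] := ltP (eta * (m - a + (e - n)) ^+ 2) (cabs (J a m n e)).
      by apply: Or43.
    apply: Or44; rewrite ltNge; apply/negP => h'''.
    have := cabsD_le (J a m c n + J m b c n) (J a m n e + J m b n e).
    have := cabsD_le (J a m c n) (J m b c n).
    have := cabsD_le (J a m n e) (J m b n e).
    have [e1 e2] : b - m = m - a /\ e - n = n - c by rewrite /m /n; split; field.
    have [e3 e4] : b - a = 2 * (m - a) /\ e - c = 2 * (n - c) by rewrite /m /n; split; field.
    move: B h h' h'' h'''; rewrite e1 e2 e3 e4.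
    have -> : (2 * (m - a) + 2 * (n - c)) ^+ 2 = 4 * (m - a + (n - c)) ^+ 2 by ring.
    lra.
  - move=> p q pP qP; have [d d0 H] := boundary_integral_local pP qP eta0.
    exists d => // a b c e *; rewrite /bad; apply/negP; rewrite -leNgt.
    exact: H.
have S0 : 0 < (b0 - a0 + (e0 - c0)) ^+ 2 + 1 by have := sqr_ge0 (b0 - a0 + (e0 - c0)); lra.
rewrite leNgt; apply/negP => c0J.
set X := (b0 - a0 + (e0 - c0)) ^+ 2 in key S0.
(* For this [eta] the bound is [|J| X / (X + 1)], which is less than [|J|]. *)
have := key (cabs (J a0 b0 c0 e0) / (X + 1)); rewrite divr_gt0// => /(_ isT).
rewrite mulrAC ler_pdivlMr// ler_pM2l//.
by rewrite gerDl ler10.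
Qed.

End Rectangle.

(** By periodicity the two horizontal sides of the rectangle carry the same values and cancel. For a
    function composed with [cexp] this compares integrals over two concentric circles. *)
Lemma periodic_vertical_integral K a b P : 0 <= P -> a <= b ->
  (forall s t, a <= s <= b -> derivable (K : R[i]^o -> R[i]^o) (Complex s t) 1) ->
  (forall s t, K (Complex s (t + P)) = K (Complex s t)) ->
  cint mu `[0, P] (fun t => K (Complex a t)) = cint mu `[0, P] (fun t => K (Complex b t)).
Proof.
move=> P0 ab dK per.
have := @boundary_integral_eq0 K a b 0 P (fun s t sab _ => dK s t sab) ab P0.
have mP : measurable (`[0, P] : set R) by exact: measurable_itv.
have iK x : a <= x <= b -> cintegrable mu `[0, P] (fun t => K (Complex x t)).
  move=> xab; apply: rcont_cintegrable => t _; apply: ccont_vertical.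
  by have [L /cderiv_ccont] := derivable_cderiv (dK x t xab).
rewrite /boundary_integral (eq_cint _ (g := fun=> 0)); last first.
  by move=> s _; rewrite -[P]add0r per subrr.
rewrite cint_segment_cst// mul0r add0r cintB//; try by apply: iK; rewrite lexx ab.
move/eqP; rewrite mulf_eq0 subr_eq0 => /orP[|/eqP->//].
by rewrite eq_complex /= oner_eq0 andbF.
Qed.

End Goursat.

(** * Means over circles *)

Section CircleMeans.
Variable R : realType.
Local Notation mu := (@lebesgue_measure R).
Implicit Types (F G : R[i] -> R[i]) (r s t : R).

Lemma ler_gt0P (x y : R) : (forall e : R, 0 < e -> x <= y + e) -> x <= y.
Proof. by move=> H; apply/ler_addgt0Pr. Qed.

Lemma ae_sub (P Q : R -> Prop) : (forall t, P t -> Q t) ->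
  {ae mu, forall t, P t} -> {ae mu, forall t, Q t}.
Proof. by move=> PQ aeP; exact: (@filterS _ _ (ae_filter_ringOfSetsType mu) _ _ PQ aeP). Qed.

Lemma ae_sub2 (P P' Q : R -> Prop) : (forall t, P t -> P' t -> Q t) ->
  {ae mu, forall t, P t} -> {ae mu, forall t, P' t} -> {ae mu, forall t, Q t}.
Proof.
move=> PQ aeP aeP'.
exact: (@filterS2 _ _ (ae_filter_ringOfSetsType mu) _ _ _ PQ aeP aeP').
Qed.

Lemma two_pi_gt0 : 0 < 2 * pi :> R. Proof. by rewrite mulr_gt0 ?pi_gt0. Qed.

Lemma measurable_period : measurable (@period R : set (measurableTypeR R)).
Proof. exact: measurable_itv. Qed.

Lemma mu_period : mu (@period R) = (2 * pi)%:E.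
Proof. by rewrite (mu_segment (ltW two_pi_gt0)) subr0. Qed.

Lemma mu_period_lty : (mu (@period R) < +oo)%E.
Proof. by rewrite mu_period ltry. Qed.

Lemma analyticP F z : analytic_disc F -> cabs z < 1 ->
  derivable (F : R[i]^o -> R[i]^o) z 1.
Proof. by move=> FA z1; apply: FA; rewrite normC_lt1. Qed.

Lemma cis_period t : cis (t + 2 * pi : R) = cis t.
Proof. by rewrite cisD cis_2pi mulr1. Qed.

Lemma cabs_rcis r t : 0 <= r -> cabs (r%:C * cis t) = r.
Proof. by move=> r0; rewrite cabsM cabs_cis mulr1 cabs_real ger0_norm. Qed.

Lemma cexp_ln r t : 0 < r -> cexp (Complex (ln r) t) = r%:C * cis t.
Proof. by move=> r0; rewrite cexp_polar lnK. Qed.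

Lemma circle_rcont F r t : 0 <= r < 1 -> analytic_disc F ->
  rcont (fun x => F (r%:C * cis x)) t.
Proof.
move=> /andP[r0 r1] FA.
have [->|rn0] := eqVneq r 0.
  by move=> e e0; exists 1 => // x _; rewrite !mul0r subrr cabs0 ltW.
have rp : 0 < r by rewrite lt_def rn0.
have -> : (fun x => F (r%:C * cis x)) = (fun x => F (cexp (Complex (ln r) x))).
  by apply/funext => x; rewrite cexp_ln.
apply: (@ccont_vertical _ (fun w => F (cexp w))).
have [L] : exists L, cderiv (fun w => F (cexp w)) (Complex (ln r) t) L.
  apply: derivable_cderiv; apply: derivable_compC; first exact: cexp_derivable.
  by apply: analyticP => //; rewrite cexp_ln// cabs_rcis.
exact: cderiv_ccont.
Qed.

Lemma circle_cintegrable F r : 0 <= r < 1 -> analytic_disc F ->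
  cintegrable mu (@period R) (fun t => F (r%:C * cis t)).
Proof. by move=> r01 FA; apply: rcont_cintegrable => t _; exact: circle_rcont. Qed.

(** For [r > 0] the integral does not depend on [r], by periodicity of [F o cexp]; as [r] tends to 0
    it tends to the integral of the constant [F 0]. The radius 0 has no logarithm and is reached by
    continuity only. *)
Lemma circle_mean F r : analytic_disc F -> 0 <= r < 1 ->
  cintegral (fun t => F (r%:C * cis t)) = (2 * pi)%:C * F 0.
Proof.
move=> FA /andP[r0 r1].
have E0 : cintegral (fun t => F ((0 : R)%:C * cis t)) = (2 * pi)%:C * F 0.
  transitivity (cint mu (@period R) (fun=> F 0)).
    by apply: eq_cint => t _; rewrite mul0r.
  by rewrite /period (cint_segment_cst _ (ltW two_pi_gt0)) subr0 mulrC.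
move: r0; rewrite le_eqVlt => /predU1P[<-//|r0].
have cst r' : 0 < r' -> r' <= r ->
    cintegral (fun t => F (r'%:C * cis t)) = cintegral (fun t => F (r%:C * cis t)).
  move=> r'0 r'r.
  have := @periodic_vertical_integral R (fun w => F (cexp w)) (ln r') (ln r) (2 * pi).
  move=> H; transitivity (cint mu (@period R) (fun t => F (cexp (Complex (ln r') t)))).
    by apply: eq_cint => t _; rewrite cexp_ln.
  rewrite {}H; [|exact: ltW two_pi_gt0|by rewrite ler_ln| |].
  - by apply: eq_cint => t _; rewrite cexp_ln.
  - move=> s t /andP[_ sr]; apply: derivable_compC; first exact: cexp_derivable.
    apply: analyticP => //; rewrite cabs_cexp /=.
    by apply: le_lt_trans r1; rewrite -[leRHS]lnK// ler_expR.
  - by move=> s t; rewrite !cexp_polar cis_period.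
apply/eqP; rewrite -subr_eq0 -cabs_eq0 eq_le cabs_ge0 andbT.
apply: ler_gt0P => e e0; rewrite add0r.
have [L /cderiv_ccont FC] : exists L, cderiv F 0 L.
  by apply: derivable_cderiv; apply: analyticP => //; rewrite cabs0.
(* The divisor compensates the factor 2 of [cabs_cint_bound] and the length [2 pi]. *)
have k0 : 0 < e / (2 * (2 * pi)) by rewrite divr_gt0// mulr_gt0// two_pi_gt0.
have [d d0 H] := FC _ k0.
have m0 : 0 < Num.min (d / 2) r by rewrite lt_min r0 divr_gt0.
rewrite -(cst (Num.min (d / 2) r)) ?ge_min ?lexx ?orbT//.
set r' := Num.min _ _ in m0 *.
have r'1 : 0 <= r' < 1 by rewrite ltW//= /r' gt_min r1 orbT.
rewrite -E0 -cintB; [|exact: measurable_period|exact: circle_cintegrable|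
  by apply: circle_cintegrable; rewrite ?lexx ?ltr01].
have := @cabs_cint_bound R (fun t => F (r'%:C * cis t) - F ((0 : R)%:C * cis t)) 0
  (2 * pi) (e / (2 * (2 * pi))).
rewrite subr0 => B; have {B} := B (ltW two_pi_gt0).
have pn : pi != 0 :> R by rewrite gt_eqF ?pi_gt0.
have -> : 2 * (e / (2 * (2 * pi))) * (2 * pi) = e by move: pn; generalize (pi : R) => x x0; field.
apply.
  apply: cintegrableB; [exact: measurable_period|exact: circle_cintegrable|].
  by apply: circle_cintegrable; rewrite ?lexx ?ltr01.
move=> t _; rewrite mul0r; apply: H; rewrite subr0 cabs_rcis ?(ltW m0)//.
by rewrite /r' gt_min ltr_pdivrMr// mulr_natr mulr2n ltrDl d0.
Qed.

(** In terms of Taylor coefficients of [F] this is [2 pi] times the sum of the [|a_k|^2 (r s)^k],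
    which is why only [r s] matters. *)
Definition circle_inner F r s : R[i] :=
  cintegral (fun t => F (r%:C * cis t) * Num.conj (F (s%:C * cis t))).

(* For [r s] fixed and [w = ln r + i t], [conj (F (s cis t))] is the value at [w] of
   the analytic function [w |-> conj (F (r s cexp (- conj w)))]. *)
Lemma circle_inner_prod F r1 s1 r2 s2 : analytic_disc F ->
  0 < r1 -> r1 <= r2 -> r2 < 1 -> 0 < s1 -> s1 < 1 -> r1 * s1 = r2 * s2 ->
  circle_inner F r1 s1 = circle_inner F r2 s2.
Proof.
move=> FA r10 r12 r21 s10 s11 rs.
have r20 : 0 < r2 by apply: lt_le_trans r12.
pose K (w : R[i]) := F (cexp w) *
  Num.conj (F ((r1 * s1)%:C * cexp (- Num.conj w))).
have KE r s t : 0 < r -> r1 * s1 = r * s ->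
    K (Complex (ln r) t) = F (r%:C * cis t) * Num.conj (F (s%:C * cis t)).
  move=> r0 rsE; rewrite /K cexp_ln//; congr (_ * Num.conj (F _)).
  have -> : - Num.conj (Complex (ln r) t) = Complex (- ln r) t.
    by apply: complex_ext; rewrite ?cReN ?cImN ?cRe_conj ?cIm_conj /= ?opprK.
  rewrite cexp_polar mulrA -rmorphM /= rsE expRN lnK// [r * s]mulrC mulfK//.
  by rewrite gt_eqF.
have := @periodic_vertical_integral R K (ln r1) (ln r2) (2 * pi).
move=> H; transitivity (cint mu (@period R) (fun t => K (Complex (ln r1) t))).
  by apply: eq_cint => t _; rewrite (@KE _ s1).
rewrite {}H; [|exact: ltW two_pi_gt0|by rewrite ler_ln| |].
- by apply: eq_cint => t _; rewrite (@KE _ s2).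
- move=> s t /andP[sr1 sr2]; apply: derivableM_C.
    apply: derivable_compC; first exact: cexp_derivable.
    apply: analyticP => //; rewrite cabs_cexp /=.
    by apply: le_lt_trans r21; rewrite -[leRHS]lnK// ler_expR.
  apply: (@derivable_conjC _ (fun v => F ((r1 * s1)%:C * cexp (- v)))).
  apply: (@derivable_compC _ (fun v => (r1 * s1)%:C * cexp (- v))).
    apply: derivableM_C; first exact: derivable_cst.
    apply: (@derivable_compC _ (fun v => - v) (@cexp R)); last exact: cexp_derivable.
    by apply: (@derivableN R[i] R[i]^o); exact: derivable_id.
  apply: analyticP => //.
  rewrite cabsM cabs_cexp cReN cRe_conj /= expRN.
  rewrite cabs_real ger0_norm ?mulr_ge0 ?ltW// ltr_pdivrMr ?expR_gt0// mul1r.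
  apply: (@lt_le_trans _ _ r1); first by rewrite gtr_pMr.
  by rewrite -[leLHS]lnK// ler_expR.
- move=> s t; rewrite /K.
  have -> : - Num.conj (Complex s (t + 2 * pi)) = Complex (- s) (t + 2 * pi).
    by apply: complex_ext; rewrite ?cReN ?cImN ?cRe_conj ?cIm_conj /= ?opprK.
  have -> : - Num.conj (Complex s t) = Complex (- s) t.
    by apply: complex_ext; rewrite ?cReN ?cImN ?cRe_conj ?cIm_conj /= ?opprK.
  by rewrite !cexp_polar cis_period.
Qed.

End CircleMeans.

Arguments measurable_period {R}.
Arguments mu_period_lty {R}.
#[global] Hint Extern 0 (measurable _) => solve [exact: measurable_period] : core.
#[global] Hint Resolve mu_period_lty : core.

(** * Boundary values of Hardy functions *)

Section HardyConvergence.
Variable R : realType.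
Local Notation mu := (@lebesgue_measure R).
Local Notation period := (@period R).
Local Notation ig u := (mu.-integrable period (EFin \o u)).
Local Notation "\Int u" := (Rintegral mu period u) (at level 10).
Local Notation cmeas F := (cmeasurable period (fun t => F (cis t))).
Implicit Types (F G : R[i] -> R[i]) (r s t : R).

Lemma Lp_cmeasurable p F : Lp p F -> cmeas F.
Proof. by case. Qed.

Lemma Lpnorm1_integrable F : cmeas F -> (Lpnorm 1 F < +oo)%E ->
  ig (fun t => cabs (F (cis t))).
Proof.
move=> mF; rewrite /Lpnorm invr1 poweRe1 => [FL|]; last first.
  by apply: integral_ge0 => t _; rewrite lee_fin powR_ge0.
apply/integrableP; split; first exact/measurable_EFinP/measurable_cabs.
apply: le_lt_trans FL; rewrite le_eqVlt; apply/orP; left; apply/eqP.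
by apply: eq_integral => t _ /=; rewrite powRr1 ?ger0_norm ?cabs_ge0.
Qed.

Lemma Lpnorm1E F : ig (fun t => cabs (F (cis t))) ->
  Lpnorm 1 F = (\Int (fun t => cabs (F (cis t))))%:E.
Proof.
move=> iF; rewrite /Lpnorm invr1 poweRe1; last first.
  by apply: integral_ge0 => t _; rewrite lee_fin powR_ge0.
rewrite /Rintegral fineK; last exact: integrable_fin_num iF.
by apply: eq_integral => t _ /=; rewrite powRr1 ?cabs_ge0.
Qed.

Lemma Lpnorm2_integrable F : cmeas F -> (Lpnorm 2 F < +oo)%E ->
  ig (fun t => cabs (F (cis t)) ^+ 2).
Proof.
move=> mF; rewrite /Lpnorm => FL.
apply/integrableP; split.
  by apply/measurable_EFinP/measurable_funX; exact: measurable_cabs.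
have : (\int[mu]_(t in period) (cabs (F (cis t)) `^ 2)%:E < +oo)%E.
  by apply: lty_poweRy FL; rewrite invr_neq0.
apply: le_lt_trans; rewrite le_eqVlt; apply/orP; left; apply/eqP.
by apply: eq_integral => t _ /=; rewrite powR_mulrn ?cabs_ge0// ger0_norm ?sqr_ge0.
Qed.

Lemma Lpnorm2E F : ig (fun t => cabs (F (cis t)) ^+ 2) ->
  Lpnorm 2 F = (Num.sqrt (\Int (fun t => cabs (F (cis t)) ^+ 2)))%:E.
Proof.
move=> iF; rewrite /Lpnorm.
have -> : (\int[mu]_(t in period) (cabs (F (cis t)) `^ 2)%:E)%E =
    (\Int (fun t => cabs (F (cis t)) ^+ 2))%:E.
  rewrite /Rintegral fineK; last exact: integrable_fin_num iF.
  by apply: eq_integral => t _ /=; rewrite powR_mulrn ?cabs_ge0.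
rewrite poweR_EFin powR12_sqrt// Rintegral_ge0// => t _; exact: sqr_ge0.
Qed.

Definition radial_limit (G : R -> R[i]) (l : R[i]) : Prop :=
  forall e : R, 0 < e -> exists2 d : R, 0 < d &
    forall r, 1 - d < r -> r < 1 -> cabs (G r - l) <= e.

Lemma at_left_radial_limit (G : R -> R[i]) l :
  ((G r : R[i]^o) @[r --> (1 : R)^'-] --> (l : R[i]^o)) -> radial_limit G l.
Proof.
move=> /cvgrPdist_le Gl e e0.
have := Gl e%:C; rewrite ltcR => /(_ e0).
rewrite /prop_near1 /at_left /nbhs /= /within /= => -[d /= d0 H].
exists d => // r r1 r2; have := H r; rewrite /ball_ /= => /(_ _ r2).
rewrite normC_cabs lecR cabsB; apply.
by rewrite ger0_norm ?subr_ge0 ?ltW//; lra.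
Qed.

Lemma radial_limit_seq (G : R -> R[i]) l (s : nat -> R) : radial_limit G l ->
  (forall n, s n < 1) -> s n @[n --> \oo] --> (1 : R) ->
  cabs (G (s n) - l) @[n --> \oo] --> (0 : R).
Proof.
move=> Gl s1 /cvgrPdist_lt scvg; apply/cvgr0Pnorm_le => e e0.
have [d d0 H] := Gl _ e0; near=> n; rewrite ger0_norm ?cabs_ge0//; apply: H => //.
have : `|1 - s n| < d by near: n; exact: scvg.
by rewrite ltr_norml => /andP[_]; lra.
Unshelve. all: by end_near. Qed.


Definition circle_energy F r : R := \Int (fun t => cabs (F (r%:C * cis t)) ^+ 2).

Lemma complex_mul_continuous (a b : R[i]) (e : R) : 0 < e -> exists2 k : R, 0 < k &
  forall a' b', cabs (a' - a) <= k -> cabs (b' - b) <= k -> cabs (a' * b' - a * b) <= e.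
Proof.
move=> e0; have a0 := cabs_ge0 a; have b0 := cabs_ge0 b.
(* Expanding around [(a, b)] leaves at most [k (k + |a| + |b|)], and [k <= 1]. *)
pose k := Num.min 1 (e / (cabs a + cabs b + 1)).
have ab : 0 < cabs a + cabs b + 1 by lra.
have k0 : 0 < k by rewrite lt_min ltr01 divr_gt0.
have k1 : k <= 1 by rewrite ge_min lexx.
have ke : k * (cabs a + cabs b + 1) <= e by rewrite -ler_pdivlMr// ge_min lexx orbT.
exists k => // a' b' ha hb.
have -> : a' * b' - a * b = (a' - a) * (b' - b) + (a' - a) * b + a * (b' - b) by ring.
apply: (le_trans (cabsD_le _ _)); apply: (le_trans (lerD (cabsD_le _ _) (lexx _))).
rewrite !cabsM.
have c1 := cabs_ge0 (a' - a); have c2 := cabs_ge0 (b' - b).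
move: ha hb c1 c2 a0 b0 ke; move: (cabs (a' - a)) (cabs (b' - b)) (cabs a) (cabs b) => u v p q.
nra.
Qed.

Lemma rcontM (A B : R -> R[i]) t : rcont A t -> rcont B t ->
  rcont (fun x => A x * B x) t.
Proof.
move=> At Bt e e0; have [k k0 K] := complex_mul_continuous (A t) (B t) e0.
have [d1 d10 H1] := At _ k0; have [d2 d20 H2] := Bt _ k0.
exists (Num.min d1 d2); first by rewrite lt_min d10.
by move=> x; rewrite lt_min => /andP[/H1 h1 /H2 h2]; exact: K.
Qed.

Lemma radial_limitM (A B : R -> R[i]) (a b : R[i]) :
  radial_limit A a -> radial_limit B b -> radial_limit (fun r => A r * B r) (a * b).
Proof.
move=> Aa Bb e e0; have [k k0 K] := complex_mul_continuous a b e0.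
have [d1 d10 H1] := Aa _ k0; have [d2 d20 H2] := Bb _ k0.
exists (Num.min d1 d2); first by rewrite lt_min d10.
move=> r rd r1; apply: K.
  by apply: H1 => //; apply: le_lt_trans rd; rewrite lerD2l lerN2 ge_min lexx.
by apply: H2 => //; apply: le_lt_trans rd; rewrite lerD2l lerN2 ge_min lexx orbT.
Qed.

Lemma radial_limitB (A B : R -> R[i]) (a b : R[i]) :
  radial_limit A a -> radial_limit B b -> radial_limit (fun r => A r - B r) (a - b).
Proof.
move=> Aa Bb e e0; have e2 : 0 < e / 2 by rewrite divr_gt0.
have [d1 d10 H1] := Aa _ e2; have [d2 d20 H2] := Bb _ e2.
exists (Num.min d1 d2); first by rewrite lt_min d10.
move=> r rd r1.
have h1 : cabs (A r - a) <= e / 2.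
  by apply: H1 => //; apply: le_lt_trans rd; rewrite lerD2l lerN2 ge_min lexx.
have h2 : cabs (B r - b) <= e / 2.
  by apply: H2 => //; apply: le_lt_trans rd; rewrite lerD2l lerN2 ge_min lexx orbT.
have -> : A r - B r - (a - b) = (A r - a) - (B r - b) by ring.
by apply: (le_trans (cabsB_le _ _)); lra.
Qed.

Lemma radial_limit_unique (A : R -> R[i]) (a b : R[i]) :
  radial_limit A a -> radial_limit A b -> a = b.
Proof.
move=> Aa Ab; apply/eqP; rewrite -subr_eq0 -cabs_eq0 eq_le cabs_ge0 andbT.
apply: ler_gt0P => e e0; rewrite add0r; have e2 : 0 < e / 2 by rewrite divr_gt0.
have [d1 d10 H1] := Aa _ e2; have [d2 d20 H2] := Ab _ e2.
pose m := Num.min d1 d2; pose r := 1 - m / 2.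
have m0 : 0 < m by rewrite lt_min d10.
have m1 : m <= d1 by rewrite ge_min lexx.
have m2 : m <= d2 by rewrite ge_min lexx orbT.
have h1 : cabs (A r - a) <= e / 2 by apply: H1; rewrite /r; lra.
have h2 : cabs (A r - b) <= e / 2 by apply: H2; rewrite /r; lra.
have -> : a - b = (A r - b) - (A r - a) by ring.
by apply: (le_trans (cabsB_le _ _)); lra.
Qed.

Lemma eq_radial_limit (A B : R -> R[i]) (a : R[i]) :
  (forall r, 0 <= r < 1 -> A r = B r) -> radial_limit A a -> radial_limit B a.
Proof.
move=> AB Aa e e0; have [d d0 H] := Aa _ e0.
exists (Num.min d 1); first by rewrite lt_min d0 ltr01.
move=> r rd r1.
have rd1 : 1 - d < r by apply: le_lt_trans rd; rewrite lerD2l lerN2 ge_min lexx.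
have rd2 : 1 - 1 < r by apply: le_lt_trans rd; rewrite lerD2l lerN2 ge_min lexx orbT.
by rewrite -AB; [exact: H|rewrite r1 andbT; lra].
Qed.

Lemma rcont_conj (A : R -> R[i]) t : rcont A t -> rcont (fun x => Num.conj (A x)) t.
Proof.
move=> At e e0; have [d d0 H] := At _ e0; exists d => // x /H.
by rewrite -rmorphB cabs_conj.
Qed.

Section AnalyticEnergy.
Variables (F : R[i] -> R[i]) (C : R).
Hypothesis FA : analytic_disc F.
Hypothesis FC : forall r, 0 <= r < 1 -> circle_energy F r <= C.
Local Notation N := (circle_energy F).

Let iFF r s : 0 <= r < 1 -> 0 <= s < 1 ->
  cintegrable mu period (fun t => F (r%:C * cis t) * Num.conj (F (s%:C * cis t))).
Proof.
move=> r01 s01; apply: rcont_cintegrable => t _.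
by apply: rcontM; [exact: circle_rcont|apply: rcont_conj; exact: circle_rcont].
Qed.

Lemma circle_energy_integrable r : 0 <= r < 1 ->
  ig (fun t => cabs (F (r%:C * cis t)) ^+ 2).
Proof.
by move=> r01; have [+ _] := iFF r01 r01; under eq_fun do rewrite mulC_conj.
Qed.

Lemma circle_energyE r : 0 <= r < 1 -> N r = Re (circle_inner F r r).
Proof.
by move=> r01; rewrite /N /=; apply: eq_Rintegral => t _; rewrite mulC_conj.
Qed.

(** The cross term is the inner product for the radii [r] and [s]; it equals the energy at their
    geometric mean, which gives the same product of radii. *)
Lemma circle_energy_dist r s : 0 < r -> r <= s -> s < 1 ->
  \Int (fun t => cabs (F (r%:C * cis t) - F (s%:C * cis t)) ^+ 2) =
  N r + N s - 2 * N (Num.sqrt (r * s)).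
Proof.
move=> r0 rs s1.
have s0 : 0 < s by apply: lt_le_trans rs.
have r01 : 0 <= r < 1 by rewrite ltW//= (le_lt_trans rs).
have s01 : 0 <= s < 1 by rewrite ltW.
set q := Num.sqrt (r * s).
have rsq : r * s = q * q by rewrite -expr2 sqr_sqrtr// mulr_ge0 ?ltW.
have q0 : 0 < q by rewrite sqrtr_gt0 mulr_gt0.
have rq : r <= q.
  rewrite -(ler_pXn2r (ltn0Sn 1)) ?nnegrE; [|exact: ltW|exact: ltW].
  by rewrite !expr2 -rsq ler_pM2l.
have qs : q <= s.
  rewrite -(ler_pXn2r (ltn0Sn 1)) ?nnegrE; [|exact: ltW|exact: ltW].
  by rewrite !expr2 -rsq ler_pM2r.
have q01 : 0 <= q < 1 by rewrite ltW//= (le_lt_trans qs).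
have ir := circle_energy_integrable r01; have is_ := circle_energy_integrable s01.
have [irs _] := iFF r01 s01.
have -> : N q = \Int (fun t => Re (F (r%:C * cis t) * Num.conj (F (s%:C * cis t)))).
  rewrite circle_energyE// -(circle_inner_prod FA r0 rq _ s0 s1 rsq)//.
  by case/andP: q01.
rewrite -RintegralZl// /N -RintegralD// -RintegralB//; last 2 first.
- exact: integrable_EFinD.
- exact: integrable_EFinZ.
apply: eq_Rintegral => t _.
by rewrite !cabs_sqr cReD cReN cImD cImN cReM cRe_conj cIm_conj; ring.
Qed.

(* The energy is midpoint convex in [ln r]: a decrease would force it to be unbounded
   as [r] tends to 0. *)
Lemma circle_energy_mono r s : 0 < r -> r <= s -> s < 1 -> N r <= N s.
Proof.
move=> r0 rs s1; rewrite leNgt; apply/negP => Nrs.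
have s0 : 0 < s by apply: lt_le_trans rs.
pose q := r / s; pose x n := s * q ^+ n; pose a n := N (x n).
have q0 : 0 < q by rewrite divr_gt0.
have q1 : q <= 1 by rewrite ler_pdivrMr// mul1r.
have x0 n : 0 < x n by rewrite mulr_gt0// exprn_gt0.
have xS n : x n.+1 <= x n.
  by rewrite /x exprS mulrCA mulrA ler_pM2r ?exprn_gt0// ger_pMl.
have x1 n : x n < 1.
  apply: le_lt_trans s1; rewrite /x ger_pMr//.
  by apply: exprn_ile1 => //; exact: ltW.
(* The radii [x n] are in geometric progression, so this is the nonnegativity of the squared
   distance between the circles [x n] and [x n.+2]. Hence the increments of [a] never fall below the
   first one, [d]. *)
have conv n : 2 * a n.+1 <= a n.+2 + a n.
  have xx : x n.+2 <= x n by exact: le_trans (xS _) (xS _).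
  have := circle_energy_dist (x0 n.+2) xx (x1 n).
  have -> : x n.+2 * x n = x n.+1 ^+ 2 by rewrite /x !exprS; ring.
  rewrite sqrtr_sqr gtr0_norm// -/(a n.+2) -/(a n.+1) -/(a n) => E.
  by rewrite -subr_ge0 -E; apply: Rintegral_ge0 => t _; exact: sqr_ge0.
pose d := N r - N s.
have d0 : 0 < d by rewrite subr_gt0.
have a0 : a 0%N = N s by rewrite /a /x expr0 mulr1.
have a1 : a 1%N = N r by rewrite /a /x expr1 mulrC divfK ?gt_eqF.
have inc n : d <= a n.+1 - a n.
  elim: n => [|n IH]; first by rewrite a0 a1.
  by have := conv n; lra.
have grow n : a 0%N + n%:R * d <= a n.
  elim: n => [|n IH]; first by rewrite mul0r addr0.
  by have := inc n; rewrite -natr1 mulrDl mul1r; lra.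
have aC n : a n <= C by apply: FC; rewrite ltW ?x1.
have := archi_boundP (normr_ge0 ((C - a 0%N) / d)).
set k := Num.bound _ => kP.
have := le_lt_trans (ler_norm _) kP; rewrite ltr_pdivrMr//.
have := grow k; have := aC k; lra.
Qed.

End AnalyticEnergy.

Lemma integrable_EFin_sqr_cabsB (A B : R -> R[i]) : cmeasurable period A -> cmeasurable period B ->
  ig (fun t => cabs (A t) ^+ 2) -> ig (fun t => cabs (B t) ^+ 2) ->
  ig (fun t => cabs (A t - B t) ^+ 2).
Proof.
move=> mA mB iA iB.
apply: (integrable_EFin_le measurable_period _
  (integrable_EFinZ measurable_period 2 (integrable_EFinD measurable_period iA iB))).
  by apply: measurable_funX; apply: measurable_cabs; exact: cmeasurableB.
move=> t _; rewrite ger0_norm ?sqr_ge0//.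
have := cabsB_le (A t) (B t); have := cabs_ge0 (A t - B t).
have := cabs_ge0 (A t); have := cabs_ge0 (B t).
move: (cabs _) (cabs _) (cabs _) => u v w w0 v0 u0 H.
apply: (@le_trans _ _ ((v + w) ^+ 2)).
  by rewrite ler_pXn2r ?nnegrE ?addr_ge0.
by have := sqr_ge0 (v - w); nra.
Qed.

Lemma hardy2_energy F : hardy 2 F ->
  exists C, forall r, 0 <= r < 1 -> circle_energy F r <= C.
Proof.
case=> FA [M FM] _ _; exists (M ^+ 2) => r r01; have := FM r r01.
rewrite Lpnorm2E; last exact: circle_energy_integrable.
rewrite lee_fin -/(circle_energy F r) => H.
have N0 : 0 <= circle_energy F r by apply: Rintegral_ge0 => t _; exact: sqr_ge0.
have M0 : 0 <= M by apply: le_trans H.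
by rewrite -(sqr_sqrtr N0) ler_pXn2r// nnegrE.
Qed.

Lemma hardy_radial_ae p F : hardy p F ->
  {ae mu, forall t, period t -> radial_limit (fun r => F (r%:C * cis t)) (F (cis t))}.
Proof.
case=> _ _ _; rewrite /ae_circle => H.
by apply: ae_sub H => t H Dt; apply: at_left_radial_limit; exact: H.
Qed.

(* For [r <= s] the squared distance between [F (r cis t)] and [F (s cis t)] is at most
   the increase of the energy; Fatou's lemma transfers this to the limit [s -> 1]. *)
Lemma hardy2_converges F : hardy 2 F -> forall e, 0 < e -> exists2 d : R, 0 < d < 1 &
  forall r, 1 - d < r -> r < 1 ->
  ig (fun t => cabs (F (r%:C * cis t) - F (cis t)) ^+ 2) /\
  \Int (fun t => cabs (F (r%:C * cis t) - F (cis t)) ^+ 2) <= e.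
Proof.
move=> hF e e0; have [C FC] := hardy2_energy hF.
have [FA _ [FL1 FL2 FL3] _] := hF.
have mF : cmeas F by split.
have iF := Lpnorm2_integrable mF FL3.
have rad := hardy_radial_ae hF.
pose E := [set circle_energy F r | r in [set r | 0 < r < 1]].
have Eub : has_ubound E.
  by exists C => _ [r /andP[r0 r1] <-]; apply: FC; rewrite ltW.
have hsE : has_sup E.
  split=> //; exists (circle_energy F 2^-1), 2^-1 => //=.
  by rewrite invr_gt0 ltr0n/= invf_lt1 ?ltr1n.
have [_ [rho /andP[rho0 rho1] <-] rhoE] := sup_adherent e0 hsE.
exists (1 - rho); first by apply/andP; split; lra.
move=> r; rewrite opprB addrC subrK => rhor r1.
have r0 : 0 < r by exact: lt_trans rhor.
have r01 : 0 <= r < 1 by rewrite ltW.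
pose s n := 1 - (1 - r) * harmonic n.
have hp n : 0 < harmonic n :> R by exact: harmonic_gt0.
have h1 n : harmonic n <= 1 :> R by rewrite /harmonic /= invf_le1 ?ler1n ?ltr0n.
have rs n : r <= s n by rewrite /s; have := h1 n; nra.
have s1 n : s n < 1 by rewrite /s; have := hp n; nra.
have s01 n : 0 <= s n < 1 by rewrite s1 (le_trans _ (rs n))// ltW.
have s0 n : 0 < s n by exact: lt_le_trans (rs n).
have scvg : s n @[n --> \oo] --> (1 : R).
  rewrite -[X in _ --> X]subr0; apply: cvgB; first exact: cvg_cst.
  rewrite -[X in _ --> X](mulr0 (1 - r)); apply: cvgM; first exact: cvg_cst.
  exact: cvg_harmonic.
have mr x : 0 <= x < 1 -> cmeasurable period (fun t => F (x%:C * cis t)).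
  by move=> x01; exact: cintegrable_cmeasurable (circle_cintegrable x01 FA).
apply: (@fatou_bound _ _ _ mu period measurable_period
  (fun n t => cabs (F (r%:C * cis t) - F ((s n)%:C * cis t)) ^+ 2)).
- move=> n; apply: integrable_EFin_sqr_cabsB; try exact: mr.
    exact: circle_energy_integrable.
  exact: circle_energy_integrable.
- by move=> n t _; exact: sqr_ge0.
(* The geometric mean of [r] and [s n] is at least [r], so the squared distance is at most the
   energy at [s n] minus that at [r], hence less than [e]. *)
- move=> n; rewrite circle_energy_dist//.
  have rsn0 : 0 <= r * s n by rewrite ltW// mulr_gt0.
  have u1 : r <= Num.sqrt (r * s n).
    rewrite -(ler_pXn2r (ltn0Sn 1)) ?nnegrE ?sqrtr_ge0; [|exact: ltW|by []].
    by rewrite sqr_sqrtr// expr2 ler_pM2l.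
  have u2 : Num.sqrt (r * s n) < 1.
    rewrite -(ltr_pXn2r (ltn0Sn 1)) ?nnegrE ?sqrtr_ge0//.
    rewrite sqr_sqrtr// expr1n.
    by have := s1 n; nra.
  have m1 := circle_energy_mono FA FC r0 u1 u2.
  have m2 := circle_energy_mono FA FC rho0 (ltW rhor) r1.
  have m3 : circle_energy F (s n) <= sup E.
    by apply: ub_le_sup => //; exists (s n) => //=; rewrite s0 s1.
  lra.
- apply: measurable_funX; apply: measurable_cabs; apply: cmeasurableB => //.
  exact: mr.
- by move=> t _; exact: sqr_ge0.
- apply: ae_sub rad => t rt Dt.
  have c0 := radial_limit_seq (rt Dt) s1 scvg.
  have c1 : cabs (F (r%:C * cis t) - F ((s n)%:C * cis t)) @[n --> \oo] -->
      cabs (F (r%:C * cis t) - F (cis t)).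
    apply/cvgrPdist_le => k k0; move/cvgr0Pnorm_le : c0 => /(_ k k0).
    apply: filterS => n; rewrite ger0_norm ?cabs_ge0//; apply: le_trans.
    set A := F (r%:C * _); set B := F (_%:C * cis t); set D := F _.
    rewrite ler_norml; apply/andP; split.
      have := cabsD_le (A - D) (D - B); rewrite addrA subrK [cabs (D - B)]cabsB; lra.
    by have := cabsD_le (A - B) (B - D); rewrite addrA subrK; lra.
  by under eq_fun do rewrite expr2; rewrite expr2; exact: cvgM.
Qed.

End HardyConvergence.

(** * Outer functions *)

Section Herglotz.
Variable R : realType.
Local Notation mu := (@lebesgue_measure R).
Local Notation period := (@period R).
Local Notation ig u := (mu.-integrable period (EFin \o u)).
Local Notation "\Int u" := (Rintegral mu period u) (at level 10).
Implicit Types (F G : R[i] -> R[i]) (r s t : R) (z w : R[i]) (u v : R -> R).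

Lemma cabs_nat n : cabs (n%:R : R[i]) = n%:R.
Proof. by rewrite -(rmorph_nat (real_complex R)) cabs_real ger0_norm ?ler0n. Qed.

Lemma cis_cmeasurable : cmeasurable period (@cis R).
Proof.
split; apply: (@measurable_funS _ _ _ _ setT) => //;
  apply: continuous_measurable_fun; [exact: continuous_cos|exact: continuous_sin].
Qed.

Definition herglotz_kernel z t : R[i] := (cis t + z) / (cis t - z).

Lemma cis_sub_lb z t : 1 - cabs z <= cabs (cis t - z).
Proof.
have := cabsD_le (cis t - z) z; rewrite subrK cabs_cis; lra.
Qed.

Lemma cis_sub_neq0 z t : cabs z < 1 -> cis t - z != 0.
Proof. by move=> z1; rewrite -cabs_gt0; have := cis_sub_lb z t; lra. Qed.

Lemma herglotz_kernel_bound z t : cabs z < 1 ->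
  cabs (herglotz_kernel z t) <= 2 / (1 - cabs z).
Proof.
move=> z1; have z2 : 0 < 1 - cabs z by lra.
rewrite /herglotz_kernel cabsM cabsV ler_pM//.
- exact: cabs_ge0.
- by rewrite invr_ge0 cabs_ge0.
- by apply: (le_trans (cabsD_le _ _)); rewrite cabs_cis; lra.
- by rewrite lef_pV2 ?cis_sub_lb// posrE// cabs_gt0 cis_sub_neq0.
Qed.

Lemma herglotz_kernel_cmeasurable z : cmeasurable period (herglotz_kernel z).
Proof.
have m1 := cis_cmeasurable; have m2 := cmeasurable_cst period z.
apply: cmeasurableM => //; first exact: cmeasurableD.
by apply: cmeasurableV => //; exact: cmeasurableB.
Qed.

Lemma cintegrable_bounded_mul (k : R -> R[i]) M u : cmeasurable period k ->
  (forall t, cabs (k t) <= M) -> ig u ->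
  cintegrable mu period (fun t => k t * (u t)%:C).
Proof.
move=> mk kM iu.
apply: (@cintegrable_le _ _ _ mu period measurable_period _ (fun t => M * `|u t|)).
- by apply: cmeasurableM => //; apply: cmeasurable_real; exact: integrable_EFin_measurable iu.
- by apply: integrable_EFinZ => //; exact: integrable_EFin_norm.
- by move=> t _; rewrite cabsM cabs_real ler_wpM2r.
Qed.

Lemma herglotz_cintegrable u z : ig u -> cabs z < 1 ->
  cintegrable mu period (fun t => herglotz_kernel z t * (u t)%:C).
Proof.
move=> iu z1; apply: (cintegrable_bounded_mul (herglotz_kernel_cmeasurable z) _ iu).
by move=> t; exact: herglotz_kernel_bound.
Qed.

(** The Schwarz integral of [u]: its real part is the Poisson integral, and an outer function is a
    unimodular constant times [cexp] of this transform of the logarithm of its boundary modulus. *)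
Definition herglotz u z : R[i] :=
  ((2 * pi)^-1)%:C * cintegral (fun t => herglotz_kernel z t * (u t)%:C).

Lemma herglotzD u v z : ig u -> ig v -> cabs z < 1 ->
  herglotz (fun t => u t + v t) z = herglotz u z + herglotz v z.
Proof.
move=> iu iv z1; rewrite /herglotz -mulrDr; congr (_ * _).
rewrite -cintD//; try exact: herglotz_cintegrable.
by apply: eq_cint => t _; rewrite rmorphD mulrDr.
Qed.

Lemma herglotz_ae_eq u v z : measurable_fun period u -> measurable_fun period v ->
  {ae mu, forall t, period t -> u t = v t} -> herglotz u z = herglotz v z.
Proof.
move=> mu_ mv uv; rewrite /herglotz; congr (_ * _).
apply: (@cint_ae_eq _ _ _ mu) => //.
- by apply: cmeasurableM => //; exact: herglotz_kernel_cmeasurable.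
- by apply: cmeasurableM => //; exact: herglotz_kernel_cmeasurable.
- by apply: ae_sub uv => t uv Dt; rewrite uv.
Qed.

Lemma herglotz0 u : herglotz u 0 = ((2 * pi)^-1 * \Int u)%:C.
Proof.
rewrite rmorphM /=; congr (_ * _).
transitivity (cint mu period (fun t => (u t)%:C)).
  apply: eq_cint => t _.
  by rewrite /herglotz_kernel addr0 subr0 divff ?cis_neq0// mul1r.
apply: complex_ext => /=; first by [].
by rewrite (Rintegral_cst _ measurable_period) mul0r.
Qed.

(** Differentiation under the integral sign, with [k'] the derivative of the kernel in [z]: the
    remainder is [(w - z)^2] times a kernel bounded by [4 / d^3] for [w] within [d / 2] of [z],
    where [d] is the distance from [z] to the circle. *)
Lemma herglotz_derivable u z : ig u -> cabs z < 1 ->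
  derivable (herglotz u : R[i]^o -> R[i]^o) z 1.
Proof.
move=> iu z1.
pose k' t := 2 * cis t / (cis t - z) ^+ 2.
pose L := ((2 * pi)^-1)%:C * cintegral (fun t => k' t * (u t)%:C).
pose d := 1 - cabs z; have d0 : 0 < d by rewrite subr_gt0.
have mk' : cmeasurable period k'.
  have m1 := cis_cmeasurable; have m2 := cmeasurable_cst period z.
  rewrite /k'; under eq_fun do rewrite expr2.
  apply: cmeasurableM => //; first exact: cmeasurableM (cmeasurable_cst _ _) m1.
  by apply: cmeasurableV => //; apply: cmeasurableM => //; exact: cmeasurableB.
have k'B t : cabs (k' t) <= 2 / d ^+ 2.
  rewrite /k' !cabsM cabsV expr2 cabsM cabs_cis mulr1.
  rewrite cabs_nat.
  rewrite ler_pM2l// -expr2 lef_pV2 ?posrE ?exprn_gt0 ?cabs_gt0 ?cis_sub_neq0//.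
  by rewrite ler_pXn2r ?nnegrE ?cabs_ge0 ?(ltW d0)// cis_sub_lb.
have ik' := cintegrable_bounded_mul mk' k'B iu.
pose c := 2 * (4 / d ^+ 3 * \Int (fun t => `|u t|)).
apply: (@cderiv_derivable _ _ _ L) => e e0.
have pi0 : 0 < (2 * pi)^-1 :> R by rewrite invr_gt0 two_pi_gt0.
have U0 : 0 <= \Int (fun t => `|u t|) by apply: Rintegral_ge0.
have c0 : 0 <= c by rewrite !mulr_ge0// invr_ge0 exprn_ge0// ltW.
have q0 : 0 < (2 * pi)^-1 * c + 1 by have := mulr_ge0 (ltW pi0) c0; lra.
exists (Num.min (d / 2) (e / ((2 * pi)^-1 * c + 1))).
  by rewrite lt_min !divr_gt0.
move=> w; rewrite lt_min => /andP[wd we].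
have w1 : cabs w < 1.
  by have := cabsD_le (w - z) z; rewrite subrK; move: wd; rewrite /d; lra.
have -> : herglotz u w - herglotz u z - L * (w - z) =
    ((2 * pi)^-1)%:C * cintegral (fun t =>
      ((w - z) ^+ 2 * (2 * cis t / ((cis t - w) * (cis t - z) ^+ 2))) * (u t)%:C).
  rewrite /herglotz /L -mulrBr -mulrA -mulrBr; congr (_ * _).
  rewrite [_ * (w - z)]mulrC -cintZ// -cintB//; try exact: herglotz_cintegrable.
  rewrite -cintB//; last 2 first.
  - by apply: cintegrableB => //; exact: herglotz_cintegrable.
  - exact: cintegrableZ.
  apply: eq_cint => t _; rewrite /herglotz_kernel /k'.
  have h1 := cis_sub_neq0 t z1; have h2 := cis_sub_neq0 t w1.
  by field; rewrite h1 h2.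
rewrite cabsM cabs_real (gtr0_norm pi0).
set I := cintegral _.
have IB : cabs I <= c * cabs (w - z) ^+ 2.
  have kB t : cabs ((w - z) ^+ 2 * (2 * cis t / ((cis t - w) * (cis t - z) ^+ 2))) <=
      4 / d ^+ 3 * cabs (w - z) ^+ 2.
    rewrite !cabsM cabsV !expr2 !cabsM cabs_cis mulr1.
    rewrite cabs_nat.
    rewrite -!expr2 mulrC ler_wpM2r ?sqr_ge0//.
    have b1 := cis_sub_lb z t; have b2 : d / 2 <= cabs (cis t - w).
      have := cis_sub_lb w t; have := cabsD_le (w - z) z; rewrite subrK.
      by move: wd; rewrite /d; lra.
    have -> : 4 / d ^+ 3 = 2 / (d / 2 * d ^+ 2) by field; rewrite gt_eqF.
    rewrite ler_pM2l// lef_pV2 ?posrE ?mulr_gt0 ?exprn_gt0 ?cabs_gt0 ?cis_sub_neq0 ?divr_gt0//.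
    apply: ler_pM => //; [by rewrite divr_ge0// ltW|by rewrite sqr_ge0|].
    by rewrite ler_pXn2r ?nnegrE ?cabs_ge0 ?(ltW d0)// cis_sub_lb.
  have mm : cmeasurable period
      (fun t => (w - z) ^+ 2 * (2 * cis t / ((cis t - w) * (cis t - z) ^+ 2))).
    have m1 := cis_cmeasurable; have m2 x := cmeasurable_cst period (x : R[i]).
    under eq_fun do rewrite expr2.
    apply: cmeasurableM => //; apply: cmeasurableM => //; first exact: cmeasurableM.
    apply: cmeasurableV => //; apply: cmeasurableM => //; first exact: cmeasurableB.
    by apply: cmeasurableM; exact: cmeasurableB.
  have ii := cintegrable_bounded_mul mm kB iu.
  apply: (le_trans (cabs_cint_le _ ii)) => //.
  have -> : c * cabs (w - z) ^+ 2 =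
      2 * (4 / d ^+ 3 * cabs (w - z) ^+ 2 * \Int (fun t => `|u t|)) by rewrite /c; ring.
  rewrite ler_pM2l// -RintegralZl//; last exact: integrable_EFin_norm.
  apply: le_Rintegral => //.
  - exact: cintegrable_cabs.
  - by apply: integrable_EFinZ => //; exact: integrable_EFin_norm.
  - by move=> t _; rewrite cabsM cabs_real ler_wpM2r.
apply: (@le_trans _ _ ((2 * pi)^-1 * (c * cabs (w - z) ^+ 2))); first by rewrite ler_pM2l.
clearbody c; rewrite expr2 !mulrA ler_wpM2r ?cabs_ge0//.
apply: (@le_trans _ _ (((2 * pi)^-1 * c + 1) * cabs (w - z))).
  by apply: ler_wpM2r; [exact: cabs_ge0|rewrite lerDl].
by rewrite mulrC -ler_pdivlMr// ltW.
Qed.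

(** Multiplying by the conjugate of the denominator exhibits the Poisson kernel, whose sign is then
    visible. *)
Lemma Re_herglotz_kernel z t : cabs z < 1 ->
  Re (herglotz_kernel z t) = (1 - cabs z ^+ 2) / cabs (cis t - z) ^+ 2.
Proof.
move=> z1; have h := cis_sub_neq0 t z1.
have -> : herglotz_kernel z t =
    ((cis t + z) * Num.conj (cis t - z)) * ((cabs (cis t - z) ^+ 2)^-1)%:C.
  rewrite fmorphV /= -mulC_conj /herglotz_kernel invfM mulrACA divff ?mulr1//.
  by rewrite conjC_eq0.
rewrite cReM /= mulr0 subr0; congr (_ / _).
rewrite -[in RHS](expr1n _ 2) -(cabs_cis t) !cabs_sqr.
by rewrite cReM cRe_conj cIm_conj !(cReD, cReN, cImD, cImN); ring.
Qed.

Lemma Re_herglotz_kernel_ge0 z t : cabs z < 1 -> 0 <= Re (herglotz_kernel z t).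
Proof.
move=> z1; rewrite Re_herglotz_kernel// divr_ge0 ?sqr_ge0// subr_ge0.
by rewrite expr_le1 ?cabs_ge0 ?ltW.
Qed.

(** The conjugate of the kernel is [(1 + conj z cis t) / (1 - conj z cis t)], an analytic function
    of [cis t] whose mean is its value 1 at the centre. The mean value property is available on
    circles of radius less than 1, hence the rescaling [q = conj z / r] with [|z| < r < 1]. *)
Lemma poisson_mean z : cabs z < 1 -> \Int (fun t => Re (herglotz_kernel z t)) = 2 * pi.
Proof.
move=> z1; have z0 := cabs_ge0 z.
pose r := (1 + cabs z) / 2.
have rz : cabs z < r by rewrite /r; lra.
have r01 : 0 <= r < 1 by rewrite /r; lra.
have r0 : 0 < r by rewrite /r; lra.
pose q := Num.conj z / r%:C.
have q1 : cabs q < 1.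
  by rewrite /q cabsM cabsV cabs_conj cabs_real gtr0_norm// ltr_pdivrMr// mul1r.
pose F (w : R[i]) := (1 + q * w) * (1 - q * w)^-1.
have nz w : cabs w < 1 -> 1 - q * w != 0.
  move=> w1; rewrite -cabs_gt0.
  have := cabsD_le (1 - q * w) (q * w); rewrite subrK cabs1 cabsM.
  by have := cabs_ge0 w; have := cabs_ge0 q; nra.
have FA : analytic_disc F.
  move=> w; rewrite normC_lt1 => w1.
  have dq : derivable ((fun w => q * w) : R[i]^o -> R[i]^o) w 1.
    by apply: derivableM_C; [exact: derivable_cst|exact: derivable_id].
  apply: derivableM_C.
    by apply: (@derivableD R[i] R[i]^o R[i]^o); [exact: derivable_cst|].
  apply: (@derivableV R[i] R[i]^o); first exact: nz.
  by apply: (@derivableB R[i] R[i]^o R[i]^o); [exact: derivable_cst|].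
have := circle_mean FA r01.
rewrite {2}/F mulr0 addr0 subr0 invr1 !mulr1 => /(congr1 (@complex.Re R)) /= <-.
apply: eq_Rintegral => t _; rewrite -cRe_conj; congr (Re _).
have e1 : q * (r%:C * cis t) = Num.conj z * cis t.
  by rewrite /q mulrA divfK// (inj_eq (@complexI R) _ 0) gt_eqF.
have c1 : cis t * Num.conj (cis t) = 1 :> R[i] by rewrite mulC_conj cabs_cis expr1n.
rewrite /F e1 /herglotz_kernel fmorph_div rmorphD rmorphB /=.
have h1 := cis_neq0 t.
have cc : Num.conj (cis t) = (cis t)^-1 by apply: (mulfI h1); rewrite c1 divff.
have h2 : 1 - Num.conj z * cis t != 0.
  by rewrite -e1; apply: nz; rewrite cabs_rcis ?ltW//; case/andP: r01.
by rewrite cc; field; rewrite h1 h2.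
Qed.

Lemma Re_herglotz u z : ig u -> cabs z < 1 ->
  Re (herglotz u z) = (2 * pi)^-1 * \Int (fun t => Re (herglotz_kernel z t) * u t).
Proof.
move=> iu z1; rewrite /herglotz cReM /= mul0r subr0; congr (_ * _).
by apply: eq_Rintegral => t _; rewrite cReM /= mulr0 subr0.
Qed.

(** Maximum principle: the Poisson kernel is nonnegative with mean 1. *)
Lemma Re_herglotz_le u z c : ig u -> cabs z < 1 -> (forall t, period t -> u t <= c) ->
  Re (herglotz u z) <= c.
Proof.
move=> iu z1 uc; rewrite Re_herglotz// mulrC ler_pdivrMr ?two_pi_gt0//.
have [ik _] := herglotz_cintegrable iu z1.
have ik' : ig (fun t => Re (herglotz_kernel z t) * u t).
  by move: ik; under eq_fun do rewrite cReM /= mulr0 subr0.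
have i1 : ig (fun t => Re (herglotz_kernel z t)).
  have := herglotz_cintegrable (integrable_EFin_cst measurable_period mu_period_lty 1) z1.
  by under eq_fun do rewrite mulr1; case.
rewrite -(poisson_mean z1) -RintegralZl//.
apply: le_Rintegral => //; first exact: integrable_EFinZ.
by move=> t Dt; rewrite mulrC ler_wpM2r ?uc// Re_herglotz_kernel_ge0.
Qed.

End Herglotz.

Section OuterLog.
Variable R : realType.
Local Notation mu := (@lebesgue_measure R).
Local Notation period := (@period R).
Local Notation ig u := (mu.-integrable period (EFin \o u)).
Implicit Types (F : R[i] -> R[i]).

Lemma fine_lne (x : R) : 0 <= x -> fine (lne x%:E) = ln x.
Proof.
move=> x0; rewrite /lne; case: ifP => // xle; have -> : x = 0 by apply/eqP; rewrite eq_le xle.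
by rewrite ln0.
Qed.

Lemma integrable_ln (v : R -> R) : (forall t, 0 <= v t) ->
  mu.-integrable period (fun t => lne (v t)%:E) ->
  ig (fun t => ln (v t)) /\ {ae mu, forall t, period t -> v t != 0}.
Proof.
move=> v0 iv; split; last first.
  have := integrable_ae measurable_period iv; apply: ae_sub => t /[swap] Dt /(_ Dt).
  by apply: contraTN => /eqP ->; rewrite /lne lexx.
have mv := measurable_int _ iv.
apply: (le_integrable measurable_period _ _ iv).
  apply/measurable_EFinP.
  have -> : (fun t => ln (v t)) = fine \o (fun t => lne (v t)%:E).
    by apply/funext => t /=; rewrite fine_lne.
  by apply: measurableT_comp.
by move=> t Dt /=; case: ifP => _ /=; rewrite ?leey.
Qed.

End OuterLog.

(** * Truncated outer functions *)

Section Smirnov.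
Variable R : realType.
Local Notation mu := (@lebesgue_measure R).
Local Notation period := (@period R).
Local Notation ig u := (mu.-integrable period (EFin \o u)).
Local Notation "\Int u" := (Rintegral mu period u) (at level 10).
Local Notation cmeas F := (cmeasurable period (fun t => F (cis t))).
Implicit Types (F G : R[i] -> R[i]) (r s t : R) (z w : R[i]).

Section Truncation.
Variables (l : R -> R) (il : ig l).

Definition log_min (k : R) t : R := Num.min 0 (k + l t).
Definition neg_log_min (k : R) t : R := Num.min (- l t) k.

Lemma neg_log_minD k t : neg_log_min k t + l t = log_min k t.
Proof. by rewrite /neg_log_min /log_min addr_minl addNr. Qed.

Lemma log_min_le_norm (k : R) t : 0 <= k -> `|log_min k t| <= `|l t|.
Proof.
move=> k0; rewrite /log_min; case: (leP 0 (k + l t)) => h; first by rewrite normr0.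
by rewrite ltr0_norm// ler_normr; apply/orP; right; lra.
Qed.

Lemma log_min_integrable k : 0 <= k -> ig (log_min k).
Proof.
move=> k0; apply: (integrable_EFin_le measurable_period _ (integrable_EFin_norm il)).
  apply: measurable_minr; first exact: measurable_cst.
  by apply: measurable_funD; [exact: measurable_cst|exact: integrable_EFin_measurable il].
by move=> t _; exact: log_min_le_norm.
Qed.

Lemma neg_log_min_integrable k : 0 <= k -> ig (neg_log_min k).
Proof.
move=> k0; have := integrable_EFinB measurable_period (log_min_integrable k0) il.
by apply: eq_integrable => // t _ /=; rewrite -neg_log_minD addrK.
Qed.

(* If [l] is the logarithm of [|h|] on the circle, these are outer functions of
   boundary moduli [min (1, e^k |h|)] and [min (1 / |h|, e^k)]. *)
Definition outer_min (k : R) z := cexp (herglotz (log_min k) z).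
Definition outer_inv_min (k : R) z := cexp (herglotz (neg_log_min k) z).

Lemma outer_inv_minM k z : 0 <= k -> cabs z < 1 ->
  outer_inv_min k z * cexp (herglotz l z) = outer_min k z.
Proof.
move=> k0 z1; rewrite -cexpD -herglotzD//; last exact: neg_log_min_integrable.
by congr (cexp (herglotz _ z)); apply/funext => t; exact: neg_log_minD.
Qed.

Lemma outer_min_le1 k z : 0 <= k -> cabs z < 1 -> cabs (outer_min k z) <= 1.
Proof.
move=> k0 z1; rewrite cabs_cexp -expR0 ler_expR; apply: Re_herglotz_le => //.
  exact: log_min_integrable.
by move=> t _; rewrite ge_min lexx.
Qed.

Lemma outer_inv_min_le k z : 0 <= k -> cabs z < 1 -> cabs (outer_inv_min k z) <= expR k.
Proof.
move=> k0 z1; rewrite cabs_cexp ler_expR; apply: Re_herglotz_le => //.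
  exact: neg_log_min_integrable.
by move=> t _; rewrite ge_min lexx orbT.
Qed.

Lemma outer_min_analytic k : 0 <= k -> analytic_disc (outer_min k).
Proof.
move=> k0 z; rewrite normC_lt1 => z1; apply: derivable_compC.
  by apply: herglotz_derivable => //; exact: log_min_integrable.
exact: cexp_derivable.
Qed.

Lemma outer_inv_min_analytic k : 0 <= k -> analytic_disc (outer_inv_min k).
Proof.
move=> k0 z; rewrite normC_lt1 => z1; apply: derivable_compC.
  by apply: herglotz_derivable => //; exact: neg_log_min_integrable.
exact: cexp_derivable.
Qed.

Definition log_min_mean k : R := (2 * pi)^-1 * \Int (fun t => `|log_min k t|).

Lemma log_min_mean_cvg : log_min_mean n%:R @[n --> \oo] --> (0 : R).
Proof.
rewrite -[X in _ --> X](mulr0 (2 * pi)^-1); apply: cvgM; first exact: cvg_cst.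
apply: (@dominated0 _ _ _ mu period measurable_period _ (fun t => `|l t|)).
- by move=> n; apply: (integrable_EFin_measurable (log_min_integrable _)).
- exact: integrable_EFin_norm.
- by apply: aeW => t _ n; exact: log_min_le_norm.
- apply: aeW => t _.
  apply: cvg_near_cst.
  exists (Num.bound (`|l t|)) => // n /= nl.
  rewrite /log_min min_l//.
  have h1 := archi_boundP (normr_ge0 (l t)).
  have h2 : (Num.bound `|l t|)%:R <= n%:R :> R by rewrite ler_nat.
  have h3 : - l t <= `|l t| by rewrite -normrN ler_norm.
  lra.
Qed.

(** At the centre the kernel is 1, so the value is [e^m] with [m <= 0] the mean of [log_min k], and
    [1 + m <= e^m <= 1]. *)
Lemma outer_min0 k : 0 <= k -> exists2 x : R, outer_min k 0 = x%:C &
  1 - log_min_mean k <= x <= 1.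
Proof.
move=> k0; rewrite /outer_min herglotz0.
set m := _ * _; exists (expR m).
  by apply: complex_ext; rewrite /cexp /= sin0 cos0 ?mul0r ?mulr0 ?mulr1 ?subr0 ?addr0 //.
have il' := log_min_integrable k0.
have -> : log_min_mean k = - m.
  have E : \Int (fun t => `|log_min k t|) = - \Int (log_min k).
    rewrite -mulN1r -RintegralZl//.
    apply: eq_Rintegral => t _; rewrite mulN1r ler0_norm//.
    by rewrite ge_min lexx.
  by rewrite /log_min_mean E mulrN.
have m0 : m <= 0.
  rewrite /m pmulr_rle0 ?invr_gt0 ?two_pi_gt0//.
  rewrite -(mul0r (fine (mu period))) -(Rintegral_cst mu measurable_period).
  apply: le_Rintegral => //; first exact: (integrable_EFin_cst measurable_period mu_period_lty).
  by move=> t _; rewrite ge_min lexx.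
by rewrite opprK expR_ge1Dx -expR0 ler_expR.
Qed.

(** The bound does not depend on [r]: on every circle the real part has the mean
    [x = outer_min k 0], so the integral is at most [4 pi (1 - x)]. *)
Lemma outer_min_near1 k r : 0 <= k -> 0 <= r < 1 ->
  ig (fun t => cabs (outer_min k (r%:C * cis t) - 1) ^+ 2) /\
  \Int (fun t => cabs (outer_min k (r%:C * cis t) - 1) ^+ 2) <= 4 * pi * log_min_mean k.
Proof.
move=> k0 /[dup] r01 /andP[r0 r1].
have iw := circle_cintegrable r01 (outer_min_analytic k0).
have [iw1 iw2] := iw.
have B t : cabs (outer_min k (r%:C * cis t) - 1) ^+ 2 <=
    2 - 2 * Re (outer_min k (r%:C * cis t)).
  have : cabs (outer_min k (r%:C * cis t)) ^+ 2 <= 1.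
    by rewrite expr_le1// ?cabs_ge0// outer_min_le1// cabs_rcis.
  rewrite !cabs_sqr cReD cImD cReN cImN /=; nra.
have i2 : ig (fun t => 2 - 2 * Re (outer_min k (r%:C * cis t))).
  apply: integrable_EFinB => //; last exact: integrable_EFinZ.
  exact: (integrable_EFin_cst measurable_period mu_period_lty).
have i1 : ig (fun t => cabs (outer_min k (r%:C * cis t) - 1) ^+ 2).
  apply: (integrable_EFin_le measurable_period _ i2).
    apply: measurable_funX; apply: measurable_cabs; apply: cmeasurableB => //.
    exact: cintegrable_cmeasurable iw.
  by move=> t _; rewrite ger0_norm ?sqr_ge0.
split=> //.
apply: (@le_trans _ _ (\Int (fun t => 2 - 2 * Re (outer_min k (r%:C * cis t))))).
  by apply: le_Rintegral.
rewrite RintegralB//; 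
  [|exact: (integrable_EFin_cst measurable_period mu_period_lty)|exact: integrable_EFinZ].
rewrite (Rintegral_cst _ measurable_period) RintegralZl//.
have := circle_mean (outer_min_analytic k0) r01 => /(congr1 (@complex.Re R)).
have [x -> /andP[x0 x1]] := outer_min0 k0.
rewrite -rmorphM /= => ->.
have -> : fine (mu period) = 2 * pi by have /(congr1 fine) := mu_period R.
have := pi_gt0 R; move: (pi : R) => p p0; nra.
Qed.

End Truncation.

End Smirnov.

(** * The mean of a quotient with outer denominator *)

Section SmirnovMean.
Variable R : realType.
Local Notation mu := (@lebesgue_measure R).
Local Notation period := (@period R).
Local Notation ig u := (mu.-integrable period (EFin \o u)).
Local Notation "\Int u" := (Rintegral mu period u) (at level 10).
Local Notation cmeas F := (cmeasurable period (fun t => F (cis t))).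
Implicit Types (F G P : R[i] -> R[i]) (r s t : R) (z w : R[i]).

(** This stands in for membership in [H_1]: what the mean value argument needs is convergence of the
    dilates to the boundary values in [L_1], and for products of functions of [H_2] it follows
    directly from Cauchy-Schwarz. *)
Definition hardy1_limit P : Prop :=
  [/\ analytic_disc P, cintegrable mu period (fun t => P (cis t)) &
    forall e : R, 0 < e -> exists2 d : R, 0 < d < 1 & forall r, 1 - d < r -> r < 1 ->
      \Int (fun t => cabs (P (r%:C * cis t) - P (cis t))) <= e].

(** An integrable function is thereby split into a part bounded by some [M] and an excess of small
    integral. *)
Lemma excess_cvg (u : R -> R) : ig u -> (forall t, 0 <= u t) ->
  \Int (fun t => Num.max 0 (u t - n%:R)) @[n --> \oo] --> (0 : R).
Proof.
move=> iu u0.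
have E n t : Num.max 0 (u t - n%:R) = `|Num.max 0 (u t - n%:R)|.
  by rewrite ger0_norm// le_max lexx.
under eq_fun do under eq_Rintegral do rewrite E.
apply: (@dominated0 _ _ _ mu period measurable_period _ u) => //.
- move=> n; apply: measurable_maxr; first exact: measurable_cst.
  by apply: measurable_funB; [exact: integrable_EFin_measurable iu|exact: measurable_cst].
- apply: aeW => t _ n; rewrite -E ge_max u0 /=.
  by rewrite gerBl ler0n.
- apply: aeW => t _; apply: cvg_near_cst.
  exists (Num.bound (`|u t|)) => // n /= nl.
  rewrite max_l//.
  have h1 := archi_boundP (normr_ge0 (u t)).
  have h2 : (Num.bound `|u t|)%:R <= n%:R :> R by rewrite ler_nat.
  have := ler_norm (u t); lra.
Qed.

Section Mean.
Variables (h P : R[i] -> R[i]) (l : R -> R) (c : R[i]).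
Hypotheses (il : ig l) (c1 : cabs c = 1)
  (hE : forall z, cabs z < 1 -> h z = c * cexp (herglotz l z))
  (mh : cmeas h) (h_neq0 : {ae mu, forall t, period t -> h (cis t) != 0})
  (h_lim : {ae mu, forall t, period t ->
     radial_limit (fun r => h (r%:C * cis t)) (h (cis t))})
  (P_lim : hardy1_limit P)
  (iT : cintegrable mu period (fun t => P (cis t) / h (cis t))).
Local Notation T t := (P (cis t) / h (cis t)).

(** Radii starting at [1 / 2] and tending to 1; dominated convergence calls for a sequence. *)
Let s (n : nat) : R := 1 - harmonic n / 2.

Let s01 n : 0 <= s n < 1.
Proof.
have h1 : harmonic n <= 1 :> R by rewrite /harmonic /= invf_le1 ?ler1n ?ltr0n.
have : 0 < harmonic n :> R by exact: harmonic_gt0.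
move: h1; rewrite /s => h1 h2; apply/andP; split; lra.
Qed.

Let s_cvg : s n @[n --> \oo] --> (1 : R).
Proof.
rewrite -[X in _ --> X]subr0; apply: cvgB; first exact: cvg_cst.
rewrite -[X in _ --> X](mul0r 2^-1); apply: cvgM; last exact: cvg_cst.
exact: cvg_harmonic.
Qed.

Let P_seq : \Int (fun t => cabs (P ((s n)%:C * cis t) - P (cis t))) @[n --> \oo] --> (0 : R).
Proof.
case: P_lim => _ _ Pl; apply/cvgr0Pnorm_le => e e0.
have [d /andP[d0 _] H] := Pl _ e0; move/cvgrPdist_lt : s_cvg => /(_ d d0).
apply: filterS => n; rewrite ltr_norml => /andP[_ sn].
rewrite ger0_norm; first by apply: H; [lra|case/andP: (s01 n)].
by apply: Rintegral_ge0 => t _; exact: cabs_ge0.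
Qed.

(** As [conj c = 1 / c], the function [q = conj c outer_inv_min] satisfies [q h = outer_min] in the
    disc; [Pmean0] is the integral of [P q] over every circle of radius less than 1. *)
Let Pmean0 k := (2 * pi)%:C * (P 0 * (Num.conj c * outer_inv_min l k 0)).

(** On the circle of radius [s n] the integral of [P q] is exactly [Pmean0 k]. It is compared with
    the weighted integral of [T] through [T h q], with [q] taken at [s n cis t] and [T h = P] almost
    everywhere: one difference tends to 0 because [P] converges in [L_1] and [q] is bounded by
    [e^k], the other by dominated convergence. *)
Lemma weighted_mean_cvg k : 0 <= k ->
  cabs (cint mu period (fun t => T t * outer_min l k ((s n)%:C * cis t)) - Pmean0 k)
    @[n --> \oo] --> (0 : R).
Proof.
move=> k0; have [PA iP Pl] := P_lim.
pose q z := Num.conj c * outer_inv_min l k z.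
have qA : analytic_disc q.
  move=> z z1; apply: derivableM_C; first exact: derivable_cst.
  exact: outer_inv_min_analytic.
have cc : c * Num.conj c = 1 by rewrite mulC_conj c1 expr1n.
have qh z : cabs z < 1 -> q z * h z = outer_min l k z.
  move=> z1; rewrite /q hE// -(outer_inv_minM il k0 z1).
  by rewrite mulrACA [Num.conj c * c]mulrC cc mul1r.
have qB z : cabs z < 1 -> cabs (q z) <= expR k.
  by move=> z1; rewrite /q cabsM cabs_conj c1 mul1r; exact: outer_inv_min_le.
have sc n t : cabs ((s n)%:C * cis t) < 1.
  by have /andP[s0 s1] := s01 n; rewrite cabs_rcis.
have mq n : cmeasurable period (fun t => q ((s n)%:C * cis t)).
  exact: cintegrable_cmeasurable (circle_cintegrable (s01 n) qA).
have mw n : cmeasurable period (fun t => outer_min l k ((s n)%:C * cis t)).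
  exact: cintegrable_cmeasurable (circle_cintegrable (s01 n) (outer_min_analytic il k0)).
have mT := cintegrable_cmeasurable iT; have mP := cintegrable_cmeasurable iP.
have iPs n : cintegrable mu period (fun t => P ((s n)%:C * cis t)).
  exact: circle_cintegrable.
have iaT := cintegrable_cabs measurable_period iT.
have mean n : cint mu period (fun t => P ((s n)%:C * cis t) * q ((s n)%:C * cis t)) = Pmean0 k.
  have PqA : analytic_disc (fun z => P z * q z).
    by move=> z z1; apply: derivableM_C; [exact: PA|exact: qA].
  exact: circle_mean PqA (s01 n).
have iPsq n : cintegrable mu period (fun t => P ((s n)%:C * cis t) * q ((s n)%:C * cis t)).
  have PqA : analytic_disc (fun z => P z * q z).
    by move=> z z1; apply: derivableM_C; [exact: PA|exact: qA].
  exact: circle_cintegrable (s01 n) PqA.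
have iTw n : cintegrable mu period (fun t => T t * outer_min l k ((s n)%:C * cis t)).
  apply: (cintegrable_le measurable_period _ iaT); first exact: (cmeasurableM mT (mw n)).
  move=> t _; rewrite cabsM ler_piMr ?cabs_ge0//; exact: outer_min_le1.
have iThq n : cintegrable mu period (fun t => T t * h (cis t) * q ((s n)%:C * cis t)).
  apply: (@cintegrable_ae_le _ _ _ mu _ measurable_period _
    (fun t => expR k * cabs (P (cis t)))).
  - exact: (cmeasurableM (cmeasurableM mT mh) (mq n)).
  - by apply: integrable_EFinZ => //; exact: (cintegrable_cabs measurable_period iP).
  - apply: ae_sub h_neq0 => t + Dt => /(_ Dt) ht.
    by rewrite divfK// cabsM mulrC ler_wpM2r ?cabs_ge0// qB.
pose A n := \Int (fun t => cabs (P ((s n)%:C * cis t) - P (cis t))).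
pose B n := \Int (fun t => `|cabs (T t) *
   cabs (outer_min l k ((s n)%:C * cis t) - h (cis t) * q ((s n)%:C * cis t))|).
have Bcvg : B n @[n --> \oo] --> (0 : R).
  apply: (@dominated0 _ _ _ mu period measurable_period _
     (fun t => cabs (T t) + expR k * cabs (P (cis t)))).
  - move=> n; apply: measurable_funM; apply: measurable_cabs; first exact: mT.
    exact: (cmeasurableB (mw n) (cmeasurableM mh (mq n))).
  - apply: integrable_EFinD => //; apply: integrable_EFinZ => //.
    exact: (cintegrable_cabs measurable_period iP).
  - apply: ae_sub h_neq0 => t + Dt n => /(_ Dt) ht.
    rewrite ger0_norm ?mulr_ge0 ?cabs_ge0// -cabsM mulrBr [_ * (h _ * _)]mulrA divfK//.
    apply: (le_trans (cabsB_le _ _)); apply: lerD.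
      by rewrite (cabsM (T t)) ler_piMr ?cabs_ge0//; exact: outer_min_le1.
    by rewrite cabsM mulrC ler_wpM2r ?cabs_ge0// qB.
  - apply: ae_sub h_lim => t + Dt => /(_ Dt) ht.
    have s1 n : s n < 1 by case/andP: (s01 n).
    have := radial_limit_seq ht s1 s_cvg => /cvgr0Pnorm_le hs.
    apply/cvgr0Pnorm_le => e e0.
    have D0 : 0 < cabs (T t) * expR k + 1.
      by rewrite ltr_wpDl// mulr_ge0 ?cabs_ge0 ?expR_ge0.
    have := hs (e / (cabs (T t) * expR k + 1)); rewrite divr_gt0// => /(_ isT).
    apply: filterS => n; rewrite !ger0_norm ?mulr_ge0 ?cabs_ge0// => hn.
    (* On the inner circle [outer_min = q h], so the difference is [q] times the increment of [h]
       along the radius: no boundary values of [q] enter. *)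
    rewrite -qh// [h (cis t) * _]mulrC -mulrBr (cabsM (q _)) mulrA.
    rewrite ler_pdivlMr// in hn; apply: le_trans hn; rewrite mulrC.
    apply: ler_wpM2l; first exact: cabs_ge0.
    apply: (@le_trans _ _ (cabs (T t) * expR k)); last by rewrite lerDl.
    by apply: ler_wpM2l; [exact: cabs_ge0|exact: qB].
have Acvg : A n @[n --> \oo] --> (0 : R) by exact: P_seq.
have bound n : cabs (cint mu period (fun t => T t * outer_min l k ((s n)%:C * cis t)) -
    Pmean0 k) <= 2 * B n + 2 * (expR k * A n).
  rewrite -(mean n).
  have -> : cint mu period (fun t => T t * outer_min l k ((s n)%:C * cis t)) -
      cint mu period (fun t => P ((s n)%:C * cis t) * q ((s n)%:C * cis t)) =
    cint mu period (fun t => T t * outer_min l k ((s n)%:C * cis t) -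
                             T t * h (cis t) * q ((s n)%:C * cis t)) -
    cint mu period (fun t => P ((s n)%:C * cis t) * q ((s n)%:C * cis t) -
                             T t * h (cis t) * q ((s n)%:C * cis t)).
    by rewrite cintB// cintB//; ring.
  apply: (le_trans (cabsB_le _ _)); apply: lerD.
    apply: (le_trans (cabs_cint_le _ _)) => //; first exact: cintegrableB.
    rewrite ler_pM2l// le_eqVlt; apply/orP; left; apply/eqP.
    apply: eq_Rintegral => t _.
    by rewrite ger0_norm ?mulr_ge0 ?cabs_ge0// -cabsM mulrBr [_ * (h _ * _)]mulrA.
  have iB : cintegrable mu period (fun t => P ((s n)%:C * cis t) * q ((s n)%:C * cis t) -
                             T t * h (cis t) * q ((s n)%:C * cis t)).
    exact: cintegrableB.
  apply: (le_trans (cabs_cint_le _ iB)) => //.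
  have iA : cintegrable mu period (fun t => P ((s n)%:C * cis t) - P (cis t)).
    exact: cintegrableB.
  rewrite ler_pM2l// -RintegralZl//; last exact: cintegrable_cabs.
  apply: le_Rintegral_ae => //.
  - exact: cintegrable_cabs.
  - by apply: integrable_EFinZ => //; exact: cintegrable_cabs.
  - apply: ae_sub h_neq0 => t + Dt => /(_ Dt) ht.
    by rewrite divfK// -mulrBl cabsM mulrC ler_wpM2r ?cabs_ge0// qB.
have BA : 2 * B n + 2 * (expR k * A n) @[n --> \oo] --> (0 : R).
  rewrite -[X in _ --> X]addr0; apply: cvgD.
    by rewrite -[X in _ --> X](mulr0 2); apply: cvgM => //; exact: cvg_cst.
  rewrite -[X in _ --> X](mulr0 2); apply: cvgM; first exact: cvg_cst.
  by rewrite -[X in _ --> X](mulr0 (expR k)); apply: cvgM => //; exact: cvg_cst.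
apply: squeeze_cvgr BA; last exact: cvg_cst.
by apply: nearW => n; rewrite cabs_ge0 bound.
Qed.

(* With [w] the truncated outer function,
   [|T| |1 - w| <= 2 (|T| - M)^+ + M (delta + |1 - w|^2 / delta)]. *)
Lemma weighted_mean_dist k r (M : nat) delta : 0 <= k -> 0 <= r < 1 -> 0 < delta ->
  cabs (cint mu period (fun t => T t) -
        cint mu period (fun t => T t * outer_min l k (r%:C * cis t))) <=
  4 * \Int (fun t => Num.max 0 (cabs (T t) - M%:R)) +
  2 * (M%:R * delta * (2 * pi)) + 2 * (M%:R / delta * (4 * pi * log_min_mean l k)).
Proof.
move=> k0 r01 delta0.
have [i1 b1] := outer_min_near1 il k0 r01.
have iaT := cintegrable_cabs measurable_period iT.
have mw : cmeasurable period (fun t => outer_min l k (r%:C * cis t)).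
  exact: cintegrable_cmeasurable (circle_cintegrable r01 (outer_min_analytic il k0)).
have mT := cintegrable_cmeasurable iT.
have w1 t : cabs (outer_min l k (r%:C * cis t)) <= 1.
  by case/andP: r01 => r0 r1; apply: outer_min_le1; rewrite ?cabs_rcis.
have iTw : cintegrable mu period (fun t => T t * outer_min l k (r%:C * cis t)).
  apply: (cintegrable_le measurable_period _ iaT); first exact: (cmeasurableM mT mw).
  by move=> t _; rewrite (cabsM (T t)) ler_piMr ?cabs_ge0.
have iM : ig (fun t => Num.max 0 (cabs (T t) - M%:R)).
  apply: (integrable_EFin_le measurable_period _ iaT).
    apply: measurable_maxr; first exact: measurable_cst.
    by apply: measurable_funB; [exact: integrable_EFin_measurable iaT|exact: measurable_cst].
  move=> t _; rewrite ger0_norm ?le_max ?lexx// ge_max cabs_ge0 /=.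
  by rewrite gerBl ler0n.
rewrite -cintB//; apply: (le_trans (cabs_cint_le _ _)) => //; first exact: cintegrableB.
pose X t := 2 * Num.max 0 (cabs (T t) - M%:R) + M%:R * delta +
  M%:R / delta * cabs (outer_min l k (r%:C * cis t) - 1) ^+ 2.
have iX1 : ig (fun t => 2 * Num.max 0 (cabs (T t) - M%:R)) by exact: integrable_EFinZ.
have iX2 : ig (fun t : R => M%:R * delta : R).
  exact: (integrable_EFin_cst measurable_period mu_period_lty).
have iX3 : ig (fun t => M%:R / delta * cabs (outer_min l k (r%:C * cis t) - 1) ^+ 2).
  exact: integrable_EFinZ.
have iX12 : ig (fun t => 2 * Num.max 0 (cabs (T t) - M%:R) + M%:R * delta) by exact: integrable_EFinD.
have iX : ig X by exact: integrable_EFinD.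
apply: (@le_trans _ _ (2 * \Int X)).
  rewrite ler_pM2l//; apply: le_Rintegral => //.
    by apply: cintegrable_cabs => //; exact: cintegrableB.
  move=> t _.
  have -> : T t - T t * outer_min l k (r%:C * cis t) =
    - (T t * (outer_min l k (r%:C * cis t) - 1)) by ring.
  rewrite cabsN (cabsM (T t)) /X.
  have v0 := cabs_ge0 (outer_min l k (r%:C * cis t) - 1).
  have v2 : cabs (outer_min l k (r%:C * cis t) - 1) <= 2.
    by apply: (le_trans (cabsB_le _ _)); rewrite cabs1; have := w1 t; lra.
  have m1 : 0 <= Num.max 0 (cabs (T t) - M%:R) by rewrite le_max lexx.
  have m2 : cabs (T t) <= Num.max 0 (cabs (T t) - M%:R) + M%:R.
    by rewrite -lerBlDr le_max lexx orbT.
  move: m1 m2 v0 v2; move: (Num.max _ _) (cabs (_ - 1)) => m v m1 m2 v0 v2.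
  apply: (@le_trans _ _ ((m + M%:R) * v)); first exact: ler_wpM2r.
  have vd : v <= delta + v ^+ 2 / delta.
    rewrite -(ler_pM2r delta0) mulrDl divfK ?gt_eqF//.
    by have := sqr_ge0 (v - delta); have := mulr_ge0 v0 (ltW delta0); nra.
  have -> : 2 * m + M%:R * delta + M%:R / delta * v ^+ 2 =
    m * 2 + M%:R * (delta + v ^+ 2 / delta) by ring.
  by rewrite mulrDl; apply: lerD; apply: ler_wpM2l.
have -> : \Int X = 2 * \Int (fun t => Num.max 0 (cabs (T t) - M%:R)) +
    M%:R * delta * (2 * pi) +
    M%:R / delta * \Int (fun t => cabs (outer_min l k (r%:C * cis t) - 1) ^+ 2).
  have c2 : \Int (fun=> M%:R * delta) = M%:R * delta * (2 * pi).
    rewrite (Rintegral_cst _ measurable_period); congr (_ * _).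
    by have /(congr1 fine) := mu_period R.
  rewrite /X RintegralD// RintegralD// c2; congr (_ + _ + _); exact: RintegralZl.
have E3 (x y z : R) : 2 * (2 * x + y + z) = 4 * x + 2 * y + 2 * z by ring.
rewrite E3 lerD2l ler_pM2l//; apply: ler_wpM2l => //.
by rewrite divr_ge0// ltW.
Qed.

(** The order of the choices matters: [M] by integrability of [T], then [delta], then [k], and the
    radius [s n] last. It is possible because the bound of [weighted_mean_dist] does not involve the
    radius. *)
Theorem smirnov_mean : cintegral (fun t => T t) = (2 * pi)%:C * (P 0 / h 0).
Proof.
have z0 : cabs (0 : R[i]) < 1 by rewrite cabs0.
have h0 : h 0 != 0.
  by rewrite hE// mulf_neq0 ?cexp_neq0// -cabs_eq0 c1 oner_eq0.
set V := _ * _.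
have cc : c * Num.conj c = 1 by rewrite mulC_conj c1 expr1n.
(* So [Pmean0 k] tends to the claimed value [V], because [outer_min l k 0] tends to 1 as [k]
   grows. *)
have PV k : 0 <= k -> Pmean0 k = V * outer_min l k 0.
  have cn : c != 0 by rewrite -cabs_eq0 c1 oner_eq0.
  move=> k0; rewrite /Pmean0 /V -(outer_inv_minM il k0 z0) hE//.
  have -> : Num.conj c = c^-1 by apply: (mulfI cn); rewrite cc divff.
  move: (outer_inv_min l k 0) (cexp (herglotz l 0)) (cexp_neq0 (herglotz l 0)) => A B B0.
  by rewrite -[RHS]mulrA; congr (_ * _); field; rewrite B0 cn.
apply/eqP; rewrite -subr_eq0 -cabs_eq0 eq_le cabs_ge0 andbT.
apply: ler_gt0P => e e0; rewrite add0r.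
have iaT := cintegrable_cabs measurable_period iT.
have e5 : 0 < e / 5 by rewrite divr_gt0.
have [M HM] : exists M : nat, 4 * \Int (fun t => Num.max 0 (cabs (T t) - M%:R)) <= e / 5.
  have := excess_cvg iaT (fun t => cabs_ge0 _) => /cvgr0Pnorm_le/(_ (e / 5 / 4)).
  rewrite divr_gt0// => /(_ isT) [M _ /(_ M (leqnn M)) /=].
  rewrite ger0_norm; last by apply: Rintegral_ge0 => t _; rewrite le_max lexx.
  by exists M; lra.
have M0 : 0 <= M%:R :> R by rewrite ler0n.
have p0 := pi_gt0 R.
pose D1 : R := 2 * (M%:R * (2 * pi)) + 1.
have D10 : 0 < D1 by rewrite ltr_wpDl// !mulr_ge0// ltW.
pose delta := e / 5 / D1.
have delta0 : 0 < delta by rewrite divr_gt0.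
have Hd : 2 * (M%:R * delta * (2 * pi)) <= e / 5.
  have -> : 2 * (M%:R * delta * (2 * pi)) = (D1 - 1) * delta by rewrite /D1; ring.
  apply: (@le_trans _ _ (D1 * delta)); first by rewrite ler_pM2r// gerBl.
  by rewrite /delta mulrC divfK// gt_eqF.
(* [log_min_mean] enters twice, through the distance of the weighted means and through
   [|V| (1 - x)]; the final 1 keeps the divisor positive. *)
pose D2 : R := 2 * (M%:R / delta * (4 * pi)) + cabs V + 1.
have q0 : 0 <= M%:R / delta by rewrite divr_ge0// ltW.
have q1 : 0 <= M%:R / delta * (4 * pi) by rewrite mulr_ge0// mulr_ge0// ltW.
have V0 := cabs_ge0 V.
have D20 : 0 < D2 by rewrite /D2; lra.
have [k Hk] : exists k : nat, log_min_mean l k%:R <= e / 5 / D2.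
  have := log_min_mean_cvg il => /cvgr0Pnorm_le/(_ (e / 5 / D2)).
  rewrite divr_gt0// => /(_ isT) [k _ /(_ k (leqnn k)) /=] H.
  by exists k; exact: le_trans (ler_norm _) H.
have k0 : 0 <= k%:R :> R by rewrite ler0n.
have [x xE /andP[x0 x1]] := outer_min0 il k0.
have kap : 0 <= log_min_mean l k%:R by lra.
have Hk2 : D2 * log_min_mean l k%:R <= e / 5 by rewrite mulrC -ler_pdivlMr.
have [n Hn] : exists n : nat, cabs (cint mu period (fun t => T t *
    outer_min l k%:R ((s n)%:C * cis t)) - Pmean0 k%:R) <= e / 5.
  have := weighted_mean_cvg k0 => /cvgr0Pnorm_le/(_ (e / 5)) /(_ e5).
  move=> [n _ /(_ n (leqnn n)) /=] H.
  by exists n; exact: le_trans (ler_norm _) H.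
have := weighted_mean_dist M k0 (s01 n) delta0.
set I := cint mu period (fun t => T t * _) in Hn *.
rewrite PV// xE in Hn; move=> W.
change (cintegral (fun t => T t)) with (cint mu period (fun t => T t)).
have -> : cint mu period (fun t => T t) - V =
  (cint mu period (fun t => T t) - I) + (I - V * x%:C) + V * (x%:C - 1) by ring.
apply: (le_trans (cabsD_le _ _)); apply: (le_trans (lerD (cabsD_le _ _) (lexx _))).
have -> : cabs (V * (x%:C - 1)) = cabs V * (1 - x).
  rewrite cabsM; congr (_ * _); rewrite cabsB.
  have -> : 1 - x%:C = (1 - x)%:C :> R[i] by rewrite rmorphB.
  by rewrite cabs_real ger0_norm// subr_ge0.
have Vx : cabs V * (1 - x) <= cabs V * log_min_mean l k%:R by apply: ler_wpM2l => //; lra.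
have D2E : D2 * log_min_mean l k%:R = 2 * (M%:R / delta * (4 * pi * log_min_mean l k%:R))
  + cabs V * log_min_mean l k%:R + log_min_mean l k%:R by rewrite /D2; ring.
move: W Hn HM Hd Hk2 D2E Vx.
move: (cabs (_ - I)) (cabs (I - _)) (4 * \Int _) (2 * (_ * delta * _)) (2 * (_ / delta * _))
  (D2 * _) (cabs V * (1 - x)) (cabs V * _) => y1 y2 y3 y4 y5 y6 y7 y8.
lra.
Qed.

End Mean.

End SmirnovMean.

(** * Products of Hardy functions and uniqueness of outer functions *)

Section HardyProducts.
Variable R : realType.
Local Notation mu := (@lebesgue_measure R).
Local Notation period := (@period R).
Local Notation ig u := (mu.-integrable period (EFin \o u)).
Local Notation "\Int u" := (Rintegral mu period u) (at level 10).
Local Notation cmeas F := (cmeasurable period (fun t => F (cis t))).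
Implicit Types (F G P : R[i] -> R[i]) (r s t : R) (z w : R[i]).

Lemma hardy_cmeasurable p F : hardy p F -> cmeas F.
Proof. by case=> _ _ [m1 m2 _] _; split. Qed.

Lemma hardy2_integrable F : hardy 2 F -> ig (fun t => cabs (F (cis t)) ^+ 2).
Proof.
move=> hF; have mF := hardy_cmeasurable hF.
by case: hF => _ _ [_ _ FL] _; exact: Lpnorm2_integrable.
Qed.

Lemma cabs_mul_integrable (A B : R -> R[i]) : cmeasurable period A -> cmeasurable period B ->
  ig (fun t => cabs (A t) ^+ 2) -> ig (fun t => cabs (B t) ^+ 2) ->
  ig (fun t => cabs (A t) * cabs (B t)).
Proof.
by move=> mA mB iA iB; apply: integrable_EFin_mul_sqr => //; exact: measurable_cabs.
Qed.

Lemma cabs_mul_Rintegral (A B : R -> R[i]) : cmeasurable period A -> cmeasurable period B ->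
  ig (fun t => cabs (A t) ^+ 2) -> ig (fun t => cabs (B t) ^+ 2) ->
  \Int (fun t => cabs (A t) * cabs (B t)) <=
  Num.sqrt (\Int (fun t => cabs (A t) ^+ 2)) * Num.sqrt (\Int (fun t => cabs (B t) ^+ 2)).
Proof.
by move=> mA mB iA iB; apply: Cauchy_Schwarz_sqrt => //; exact: measurable_cabs.
Qed.

(** With [F_r], [G_r] the dilates, [F_r G_r - F G = (F_r - F) G_r + F (G_r - G)]; Cauchy-Schwarz
    applies to both terms, the energies of [G_r] being bounded uniformly in [r]. *)
Lemma hardy2_mul F G : hardy 2 F -> hardy 2 G -> hardy1_limit (fun z => F z * G z).
Proof.
move=> hF hG.
have [FA _ _ _] := hF; have [GA _ _ _] := hG.
have mF := hardy_cmeasurable hF; have mG := hardy_cmeasurable hG.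
have iF := hardy2_integrable hF; have iG := hardy2_integrable hG.
have FGA : analytic_disc (fun z => F z * G z).
  by move=> z z1; apply: derivableM_C; [exact: FA|exact: GA].
split=> //.
  apply: (@cintegrable_le _ _ _ mu period measurable_period _
     (fun t => cabs (F (cis t)) * cabs (G (cis t)))).
  - exact: (cmeasurableM mF mG).
  - exact: cabs_mul_integrable.
  - by move=> t _; rewrite cabsM.
move=> e e0.
have [C GC] := hardy2_energy hG.
set A := \Int (fun t => cabs (F (cis t)) ^+ 2).
pose k := e / (Num.sqrt `|C| + Num.sqrt A + 1).
have K0 : 0 < Num.sqrt `|C| + Num.sqrt A + 1.
  by have := sqrtr_ge0 `|C|; have := sqrtr_ge0 A; lra.
have k0 : 0 < k by rewrite divr_gt0.
have kk : 0 < k ^+ 2 by rewrite exprn_gt0.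
have [d1 /andP[d10 d11] H1] := hardy2_converges hF kk.
have [d2 /andP[d20 d21] H2] := hardy2_converges hG kk.
exists (Num.min d1 d2); first by rewrite lt_min d10 d20 gt_min d11.
move=> r rd r1.
have rd1 : 1 - d1 < r.
  by apply: le_lt_trans rd; rewrite lerD2l lerN2 ge_min lexx.
have rd2 : 1 - d2 < r.
  by apply: le_lt_trans rd; rewrite lerD2l lerN2 ge_min lexx orbT.
have r01 : 0 <= r < 1 by apply/andP; split; lra.
have [iFr bF] := H1 _ rd1 r1; have [iGr bG] := H2 _ rd2 r1.
have mFr : cmeasurable period (fun t => F (r%:C * cis t)).
  exact: cintegrable_cmeasurable (circle_cintegrable r01 FA).
have mGr : cmeasurable period (fun t => G (r%:C * cis t)).
  exact: cintegrable_cmeasurable (circle_cintegrable r01 GA).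
have mF' : cmeasurable period (fun t => F (r%:C * cis t) - F (cis t)).
  exact: (cmeasurableB mFr mF).
have mG' : cmeasurable period (fun t => G (r%:C * cis t) - G (cis t)).
  exact: (cmeasurableB mGr mG).
have iGG := circle_energy_integrable GA r01.
have i1 := cabs_mul_integrable mF' mGr iFr iGG.
have i2 := cabs_mul_integrable mF mG' iF iGr.
have b1 := cabs_mul_Rintegral mF' mGr iFr iGG.
have b2 := cabs_mul_Rintegral mF mG' iF iGr.
have sk u : u <= k ^+ 2 -> Num.sqrt u <= k.
  by move=> uk; rewrite -(gtr0_norm k0) -sqrtr_sqr ler_sqrt ?sqr_ge0.
apply: (@le_trans _ _ (\Int (fun t =>
    cabs (F (r%:C * cis t) - F (cis t)) * cabs (G (r%:C * cis t)) +
    cabs (F (cis t)) * cabs (G (r%:C * cis t) - G (cis t))))).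
  apply: le_Rintegral => //.
  - apply: cintegrable_cabs => //; apply: cintegrableB => //.
      exact: (circle_cintegrable r01 FGA).
    apply: (@cintegrable_le _ _ _ mu period measurable_period _
       (fun t => cabs (F (cis t)) * cabs (G (cis t)))).
    + exact: (cmeasurableM mF mG).
    + exact: cabs_mul_integrable.
    + by move=> t _; rewrite cabsM.
  - exact: integrable_EFinD.
  - move=> t _; rewrite -!cabsM.
    have -> : F (r%:C * cis t) * G (r%:C * cis t) - F (cis t) * G (cis t) =
      (F (r%:C * cis t) - F (cis t)) * G (r%:C * cis t) +
      F (cis t) * (G (r%:C * cis t) - G (cis t)) by ring.
    exact: cabsD_le.
rewrite RintegralD//; apply: (le_trans (lerD b1 b2)).
have c1 : Num.sqrt (\Int (fun t => cabs (G (r%:C * cis t)) ^+ 2)) <= Num.sqrt `|C|.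
  by rewrite ler_sqrt ?normr_ge0//; apply: (le_trans (GC _ r01)); exact: ler_norm.
have := sk _ bF; have := sk _ bG; move: c1.
have -> : e = k * (Num.sqrt `|C| + Num.sqrt A + 1) by rewrite /k divfK ?gt_eqF.
rewrite -/A.
have := sqrtr_ge0 (\Int (fun t => cabs (G (r%:C * cis t)) ^+ 2)).
have := sqrtr_ge0 A; have := sqrtr_ge0 `|C|.
have := sqrtr_ge0 (\Int (fun t => cabs (F (r%:C * cis t) - F (cis t)) ^+ 2)).
have := sqrtr_ge0 (\Int (fun t => cabs (G (r%:C * cis t) - G (cis t)) ^+ 2)).
move: (Num.sqrt (\Int _)) (Num.sqrt (\Int _)) => y1 y2.
move: (Num.sqrt `|C|) (Num.sqrt A) (Num.sqrt (\Int _)) => y3 y4 y5 *.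
nra.
Qed.

Lemma hardy1_limitD F G : hardy1_limit F -> hardy1_limit G ->
  hardy1_limit (fun z => F z + G z).
Proof.
move=> [FA iF HF] [GA iG HG].
have FGA : analytic_disc (fun z => F z + G z).
  by move=> z z1; apply: (@derivableD R[i] R[i]^o R[i]^o); [exact: FA|exact: GA].
split=> //; first exact: cintegrableD.
move=> e e0; have e2 : 0 < e / 2 by rewrite divr_gt0.
have [d1 /andP[d10 d11] H1] := HF _ e2.
have [d2 /andP[d20 d21] H2] := HG _ e2.
exists (Num.min d1 d2); first by rewrite lt_min d10 d20 gt_min d11.
move=> r rd r1.
have rd1 : 1 - d1 < r.
  by apply: le_lt_trans rd; rewrite lerD2l lerN2 ge_min lexx.
have rd2 : 1 - d2 < r.
  by apply: le_lt_trans rd; rewrite lerD2l lerN2 ge_min lexx orbT.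
have r01 : 0 <= r < 1 by apply/andP; split; lra.
have i1 : cintegrable mu period (fun t => F (r%:C * cis t) - F (cis t)).
  by apply: cintegrableB => //; exact: circle_cintegrable.
have i2 : cintegrable mu period (fun t => G (r%:C * cis t) - G (cis t)).
  by apply: cintegrableB => //; exact: circle_cintegrable.
have j1 := cintegrable_cabs measurable_period i1.
have j2 := cintegrable_cabs measurable_period i2.
apply: (@le_trans _ _ (\Int (fun t => cabs (F (r%:C * cis t) - F (cis t)) +
    cabs (G (r%:C * cis t) - G (cis t))))).
  apply: le_Rintegral => //.
  - apply: cintegrable_cabs => //; apply: cintegrableB => //.
      exact: (circle_cintegrable r01 FGA).
    exact: cintegrableD.
  - exact: integrable_EFinD.
  - move=> t _.
    have -> : F (r%:C * cis t) + G (r%:C * cis t) - (F (cis t) + G (cis t)) =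
      (F (r%:C * cis t) - F (cis t)) + (G (r%:C * cis t) - G (cis t)) by ring.
    exact: cabsD_le.
rewrite RintegralD//; have := H1 _ rd1 r1; have := H2 _ rd2 r1; lra.
Qed.

Lemma hardy1_limitN F : hardy1_limit F -> hardy1_limit (fun z => - F z).
Proof.
move=> [FA iF HF]; split.
- by move=> z z1; apply: (@derivableN R[i] R[i]^o); exact: FA.
- exact: cintegrableN.
- move=> e e0; have [d d01 H] := HF _ e0; exists d => // r rd r1.
  apply: le_trans (H r rd r1).
  rewrite le_eqVlt; apply/orP; left; apply/eqP; apply: eq_Rintegral => t _.
  by rewrite -opprD cabsN.
Qed.

Lemma outer_representation F : outer F ->
  [/\ ig (fun t => ln (cabs (F (cis t)))),
      {ae mu, forall t, period t -> F (cis t) != 0}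
    & exists2 c : R[i], cabs c = 1 & forall z, cabs z < 1 ->
      F z = c * cexp (herglotz (fun t => ln (cabs (F (cis t)))) z)].
Proof.
move=> [iF [c c1 FE]].
have [i1 ae1] := integrable_ln (fun t => cabs_ge0 (F (cis t))) iF.
split=> //; first by apply: ae_sub ae1 => t + Dt => /(_ Dt); rewrite cabs_eq0.
exists c; first by apply: (@complexI R); rewrite -normC_cabs c1.
by move=> z z1; apply: FE; rewrite normC_lt1.
Qed.

(** The boundary modulus determines an outer function up to a unimodular constant, and positivity at
    0 fixes the constant. *)
Lemma outer_unique F G : outer F -> outer G -> cmeas F -> cmeas G ->
  {ae mu, forall t, period t -> cabs (F (cis t)) = cabs (G (cis t))} ->
  0 < F 0 -> 0 < G 0 -> forall z, cabs z < 1 -> F z = G z.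
Proof.
move=> oF oG mF mG FG F0 G0.
have [iF _ [c c1 FE]] := outer_representation oF.
have [iG _ [c' c1' GE]] := outer_representation oG.
have E z : herglotz (fun t => ln (cabs (F (cis t)))) z =
           herglotz (fun t => ln (cabs (G (cis t)))) z.
  apply: herglotz_ae_eq; [exact: integrable_EFin_measurable iF|exact: integrable_EFin_measurable iG|].
  by apply: ae_sub FG => t FG Dt; rewrite FG.
have z0 : cabs (0 : R[i]) < 1 by rewrite cabs0.
have FG0 : F 0 = G 0.
  rewrite -(gtr0_norm F0) -(gtr0_norm G0) !normC_cabs FE// GE// E.
  by rewrite !cabsM c1 c1'.
have cE : c = c'.
  have := FG0; rewrite FE// GE// E => /(mulIf _); apply; exact: cexp_neq0.
by move=> z z1; rewrite FE// GE// E cE.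
Qed.

End HardyProducts.

(** * Spectral factors *)

Section PointwiseEstimate.
Variable R : realType.
Implicit Types z w : R[i].

Lemma cabs_dot2_le (p q u v : R[i]) :
  cabs (p * u + q * v) <=
  Num.sqrt (cabs p ^+ 2 + cabs q ^+ 2) * Num.sqrt (cabs u ^+ 2 + cabs v ^+ 2).
Proof.
apply: (le_trans (cabsD_le _ _)); rewrite !cabsM -sqrtrM ?addr_ge0 ?sqr_ge0//.
have := cabs_ge0 p; have := cabs_ge0 q; have := cabs_ge0 u; have := cabs_ge0 v.
move: (cabs p) (cabs q) (cabs u) (cabs v) => x y a b b0 a0 y0 x0.
have s0 : 0 <= x * a + y * b by rewrite addr_ge0 ?mulr_ge0.
rewrite -[leLHS](ger0_norm s0) -sqrtr_sqr ler_sqrt ?mulr_ge0 ?addr_ge0 ?sqr_ge0//.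
rewrite -subr_ge0.
have -> : (x ^+ 2 + y ^+ 2) * (a ^+ 2 + b ^+ 2) - (x * a + y * b) ^+ 2 =
  (x * b - y * a) ^+ 2 by ring.
exact: sqr_ge0.
Qed.

Lemma sqr_cabsC z : (cabs z ^+ 2)%:C = z * Num.conj z.
Proof. by rewrite mulC_conj. Qed.

(* The matrix with rows [(x, y)], [(z, w)] is the product of the triangular matrix
   with rows [(g, 0)], [(phi, h / g)] and of the unitary matrix with rows [(u, v)],
   [(- conj v, conj u)]. *)
Lemma unitary_rows (g phi x y z w h : R[i]) : g != 0 ->
  x * Num.conj x + y * Num.conj y = g * Num.conj g ->
  z * Num.conj x + w * Num.conj y = phi * Num.conj g ->
  x * w - y * z = h ->
  let u := x / g in let v := y / g in
  [/\ cabs u ^+ 2 + cabs v ^+ 2 = 1, x = g * u /\ y = g * v,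
      z = phi * u - h / g * Num.conj v & w = phi * v + h / g * Num.conj u].
Proof.
move=> g0 n1 n2 n3 u v.
have gc0 : Num.conj g != 0 by rewrite conjC_eq0.
have xE : x = g * u by rewrite mulrC divfK.
have yE : y = g * v by rewrite mulrC divfK.
have m1 : u * Num.conj u + v * Num.conj v = 1.
  rewrite /u /v !fmorph_div /=; apply: (mulfI (mulf_neq0 g0 gc0)).
  rewrite mulr1 -[RHS]n1; move: (Num.conj g) (Num.conj x) (Num.conj y) gc0 => g' x' y' g'0.
  by field; rewrite g0 g'0.
have m2 : z * Num.conj u + w * Num.conj v = phi.
  rewrite /u /v !fmorph_div /=; apply: (mulIf gc0); rewrite -n2.
  by move: (Num.conj g) (Num.conj x) (Num.conj y) gc0 => g' x' y' g'0; field.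
have m3 : u * w - v * z = h / g by rewrite /u /v -n3; field.
split=> //.
- by apply: (@complexI R); rewrite rmorphD /= !sqr_cabsC m1.
- rewrite -m2 -m3.
  have -> : (z * Num.conj u + w * Num.conj v) * u - (u * w - v * z) * Num.conj v =
    z * (u * Num.conj u + v * Num.conj v) by ring.
  by rewrite m1 mulr1.
- rewrite -m2 -m3.
  have -> : (z * Num.conj u + w * Num.conj v) * v + (u * w - v * z) * Num.conj u =
    w * (u * Num.conj u + v * Num.conj v) by ring.
  by rewrite m1 mulr1.
Qed.

Section Factors.
Variables (g phi phi' x y z w x' y' z' w' h : R[i]).
Hypotheses (g0 : g != 0) (h0 : h != 0)
  (n1 : x * Num.conj x + y * Num.conj y = g * Num.conj g)
  (n2 : z * Num.conj x + w * Num.conj y = phi * Num.conj g)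
  (n3 : x * w - y * z = h)
  (n1' : x' * Num.conj x' + y' * Num.conj y' = g * Num.conj g)
  (n2' : z' * Num.conj x' + w' * Num.conj y' = phi' * Num.conj g)
  (n3' : x' * w' - y' * z' = h).

(** The square [D^2] of the overview. The second rows of the unitary matrices are the conjugates of
    the first ones up to order and sign, so the first rows account for exactly half of the squared
    Frobenius distance. *)
Definition unitary_dist2 : R := cabs (x' / g - x / g) ^+ 2 + cabs (y' / g - y / g) ^+ 2.
(** The trace of [chi^-1 chi'], with the inverse written as the adjugate over the determinant
    [h]. *)
Definition factor_trace : R[i] := (w * x' - y * z' - z * y' + x * w') / h.
Local Notation D2 := unitary_dist2.
Local Notation T := factor_trace.
Local Notation u := (x / g). Local Notation v := (y / g).
Local Notation u' := (x' / g). Local Notation v' := (y' / g).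

Let unit_bound (p q : R[i]) : cabs p ^+ 2 + cabs q ^+ 2 = 1 -> cabs p <= 1 /\ cabs q <= 1.
Proof.
move=> pq; split; rewrite -(@expr_le1 _ 2) ?cabs_ge0//.
  by have := sqr_ge0 (cabs q); lra.
by have := sqr_ge0 (cabs p); lra.
Qed.

Lemma unitary_dist2_ge0 : 0 <= D2.
Proof. by rewrite addr_ge0 ?sqr_ge0. Qed.

(** Entries of a unitary matrix have modulus at most 1. This crude bound only serves to obtain
    integrability. *)
Lemma unitary_dist2_le8 : D2 <= 8.
Proof.
have [U _ _ _] := unitary_rows g0 n1 n2 n3; have [U' _ _ _] := unitary_rows g0 n1' n2' n3'.
have [a1 a2] := unit_bound U; have [a3 a4] := unit_bound U'.
have b (p q : R[i]) : cabs p <= 1 -> cabs q <= 1 -> cabs (p - q) ^+ 2 <= 4.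
  move=> p1 q1; have := cabsB_le p q; have := cabs_ge0 (p - q) => c0 c1.
  have : cabs (p - q) <= 2 by lra.
  by move: (cabs (p - q)) c0 => k; nra.
by have := b _ _ a3 a1; have := b _ _ a4 a2; rewrite /unitary_dist2; lra.
Qed.

Lemma first_row_bound :
  cabs (x' - x) <= cabs g * Num.sqrt D2 /\ cabs (y' - y) <= cabs g * Num.sqrt D2.
Proof.
have [_ [xE yE] _ _] := unitary_rows g0 n1 n2 n3.
have [_ [xE' yE'] _ _] := unitary_rows g0 n1' n2' n3'.
have k (p : R[i]) : cabs p ^+ 2 <= D2 -> cabs (g * p) <= cabs g * Num.sqrt D2.
  move=> pD; rewrite cabsM; apply: ler_wpM2l; first exact: cabs_ge0.
  by rewrite -[leLHS](ger0_norm (cabs_ge0 p)) -sqrtr_sqr ler_sqrt ?unitary_dist2_ge0.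
rewrite xE yE xE' yE' -!mulrBr; split; apply: k; rewrite /unitary_dist2.
  by rewrite lerDl sqr_ge0.
by rewrite lerDr sqr_ge0.
Qed.

(** A unitary factor on the right preserves the length of a row, so this is the squared length of
    the row [(phi, h / g)] of the triangular factor. For the spectral factor of [S] it equals
    [c]. *)
Lemma second_row_norm : z * Num.conj z + w * Num.conj w =
  (cabs phi ^+ 2 + cabs (h / g) ^+ 2)%:C.
Proof.
have [U _ zE wE] := unitary_rows g0 n1 n2 n3.
have {}U : u * Num.conj u + v * Num.conj v = 1 by rewrite -!sqr_cabsC -rmorphD U.
rewrite rmorphD /= !sqr_cabsC zE wE.
move: (h / g) u v U => f u v U.
rewrite !(rmorphD, rmorphN, rmorphM) /= !conjCK -[RHS]mulr1 -U.
by move: (Num.conj phi) (Num.conj f) (Num.conj u) (Num.conj v) => a b d e; ring.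
Qed.

(** The triangular factors differ only in the entry [phi], which accounts for the first term since
    [u'] and [v'] have modulus at most 1; the rest is Cauchy-Schwarz in [C^2] for the row
    [(phi, h / g)], of squared length [m]. *)
Lemma second_row_bound (m : R) : z * Num.conj z + w * Num.conj w = m%:C ->
  cabs (z' - z) <= cabs (phi' - phi) + Num.sqrt m * Num.sqrt D2 /\
  cabs (w' - w) <= cabs (phi' - phi) + Num.sqrt m * Num.sqrt D2.
Proof.
rewrite second_row_norm => -[mE].
have [U _ zE wE] := unitary_rows g0 n1 n2 n3.
have [U' _ zE' wE'] := unitary_rows g0 n1' n2' n3'.
have [a3 a4] := unit_bound U'.
have K (k : R[i]) (r : R) : cabs k <= 1 -> cabs (phi' - phi) * cabs k + r <= cabs (phi' - phi) + r.
  by move=> k1; rewrite lerD2r ler_piMr ?cabs_ge0.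
split.
  have -> : z' - z = (phi' - phi) * u' +
      (phi * (u' - u) + (- (h / g)) * Num.conj (v' - v)).
    by rewrite zE zE' rmorphB; ring.
  apply: (le_trans (cabsD_le _ _)); rewrite cabsM.
  apply: le_trans (K u' _ a3); rewrite lerD2l.
  apply: (le_trans (cabs_dot2_le _ _ _ _)).
  by rewrite cabsN mE cabs_conj.
have -> : w' - w = (phi' - phi) * v' +
    (phi * (v' - v) + (h / g) * Num.conj (u' - u)).
  by rewrite wE wE' rmorphB; ring.
apply: (le_trans (cabsD_le _ _)); rewrite cabsM.
apply: le_trans (K v' _ a4); rewrite lerD2l.
apply: (le_trans (cabs_dot2_le _ _ _ _)).
by rewrite mE cabs_conj [X in _ * Num.sqrt X]addrC.
Qed.

(** [L^-1 L'] is the identity plus the entry [(phi' - phi) g / h] below the diagonal. The trace of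
    [U^-1 L^-1 L' U'] is therefore the trace of [U^-1 U'] plus that entry times the upper right
    entry of [U' U^-1]. *)
Lemma factor_traceE : T = (u * Num.conj u' + v * Num.conj v') +
    (Num.conj u * u' + Num.conj v * v') + (phi' - phi) * (u * v' - v * u') * (g / h).
Proof.
have [_ [xE yE] zE wE] := unitary_rows g0 n1 n2 n3.
have [_ [xE' yE'] zE' wE'] := unitary_rows g0 n1' n2' n3'.
have -> : T = ((phi * v + h / g * Num.conj u) * (g * u') -
    (g * v) * (phi' * u' - h / g * Num.conj v') -
    (phi * u - h / g * Num.conj v) * (g * v') +
    (g * u) * (phi' * v' + h / g * Num.conj u')) / h.
  by rewrite /factor_trace -zE -wE -zE' -wE' -xE -yE -xE' -yE'.
move: (Num.conj u) (Num.conj v) (Num.conj u') (Num.conj v') u v u' v'.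
by move=> uc vc uc' vc' p q p' q'; field; rewrite h0 g0.
Qed.

Let cross_le1 : cabs (u * v' - v * u') <= 1.
Proof.
have [U _ _ _] := unitary_rows g0 n1 n2 n3; have [U' _ _ _] := unitary_rows g0 n1' n2' n3'.
have := cabs_dot2_le u (- v) v' u'; rewrite cabsN U addrC [cabs v' ^+ 2 + _]addrC U' sqrtr1 mulr1.
by rewrite mulNr addrC.
Qed.

Let gh_bound : cabs ((phi' - phi) * (u * v' - v * u') * (g / h)) <=
  cabs (phi' - phi) * (cabs g / cabs h).
Proof.
rewrite !cabsM cabsV; apply: ler_wpM2r; first by rewrite mulr_ge0 ?invr_ge0 ?cabs_ge0.
by rewrite ler_piMr ?cabs_ge0.
Qed.

Lemma unitary_dist2_bound : D2 <= 2 - Re T + cabs (phi' - phi) * (cabs g / cabs h).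
Proof.
have [U _ _ _] := unitary_rows g0 n1 n2 n3; have [U' _ _ _] := unitary_rows g0 n1' n2' n3'.
have := le_trans (Re_le_cabs _) gh_bound.
rewrite factor_traceE cReD.
set Z := (phi' - phi) * _ * _ => hZ.
have -> : D2 = 2 - Re (u * Num.conj u' + v * Num.conj v' + (Num.conj u * u' + Num.conj v * v')).
  move: U U'; rewrite /unitary_dist2 !cabs_sqr.
  rewrite !(cReD, cReM, cReN, cImD, cImN, cRe_conj, cIm_conj).
  move: (Re u) (Im u) (Re v) (Im v) (Re u') (Im u') (Re v') (Im v') => a b c d e f k l.
  nra.
have := le_trans (Re_le_cabs (- Z)) _.
move=> /(_ (cabs (phi' - phi) * (cabs g / cabs h))).
rewrite cabsN gh_bound cReN => /(_ isT); lra.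
Qed.

(** The integrability of [T] on the circle, which [smirnov_mean] requires, rests on this bound. *)
Lemma factor_trace_bound : cabs T <= 2 + cabs (phi' - phi) * (cabs g / cabs h).
Proof.
have [U _ _ _] := unitary_rows g0 n1 n2 n3; have [U' _ _ _] := unitary_rows g0 n1' n2' n3'.
rewrite factor_traceE; apply: (le_trans (cabsD_le _ _)); apply: lerD gh_bound.
apply: (le_trans (cabsD_le _ _)).
have -> : 2 = 1 + 1 :> R by ring.
apply: lerD; apply: (le_trans (cabs_dot2_le _ _ _ _)).
  by rewrite !cabs_conj U U' sqrtr1 mulr1.
by rewrite !cabs_conj U U' sqrtr1 mulr1.
Qed.

End Factors.

End PointwiseEstimate.

(** * Matrices of order two and their norms *)

Section Matrix2.
Variable R : realType.
Implicit Types A B : 'M[R[i]]_2.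

Lemma sum_ord2 (V : nmodType) (F : 'I_2 -> V) : \sum_i F i = F 0 + F 1.
Proof.
rewrite big_ord_recl big_ord1; congr (F _ + F _); exact: val_inj.
Qed.

Lemma mulmx2E A B i j : (A *m B) i j = A i 0 * B 0 j + A i 1 * B 1 j.
Proof. by rewrite mxE sum_ord2. Qed.

Lemma det2E A : \det A = A 0 0 * A 1 1 - A 0 1 * A 1 0.
Proof.
rewrite (expand_det_row _ 0) sum_ord2 /cofactor !det_mx11 !mxE /= expr0 mul1r expr1.
have -> : lift 0 0 = 1 :> 'I_2 by exact: val_inj.
have -> : lift 1 0 = 0 :> 'I_2 by exact: val_inj.
by rewrite mulN1r mulrN.
Qed.

Lemma adjmx2E A i j : ((A ^t*)%sesqui) i j = Num.conj (A j i).
Proof. by rewrite !mxE. Qed.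

Lemma det_adjmx2 A : \det (A ^t*)%sesqui = Num.conj (\det A).
Proof. by rewrite !det2E !adjmx2E rmorphB !rmorphM /= [in X in _ - X]mulrC. Qed.

Lemma mx2E (x y z w : R[i]) : [/\ mx2 x y z w 0 0 = x, mx2 x y z w 0 1 = y,
  mx2 x y z w 1 0 = z & mx2 x y z w 1 1 = w].
Proof. by rewrite !mxE. Qed.

Lemma invmx2_11 A : \det A != 0 -> invmx A 1 1 = A 0 0 / \det A.
Proof.
move=> d0; have uA : A \in unitmx by rewrite unitmxE unitfE.
have := mulmxV uA => /matrixP E.
have := E 0 1; have := E 1 1; rewrite !mulmx2E !mxE /= => E1 E2.
apply: (mulIf d0); rewrite divfK// det2E.
have -> : invmx A 1 1 * (A 0 0 * A 1 1 - A 0 1 * A 1 0) =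
  A 0 0 * (A 1 0 * invmx A 0 1 + A 1 1 * invmx A 1 1) -
  A 1 0 * (A 0 0 * invmx A 0 1 + A 0 1 * invmx A 1 1) by ring.
by rewrite E1 E2 mulr0 subr0 mulr1.
Qed.

Lemma ord2_ind (P : 'I_2 -> Prop) : P 0 -> P 1 -> forall i, P i.
Proof.
move=> P0 P1 [[|[|//]] Hi].
  by have -> : Ordinal Hi = 0 by exact: val_inj.
by have -> : Ordinal Hi = 1 by exact: val_inj.
Qed.

End Matrix2.

Section MatrixNorms.
Variable R : realType.
Implicit Types M : R[i] -> 'M[R[i]]_2.

Lemma mxLpnorm_le (p : R) M (B : \bar R) : (0 <= B)%E ->
  (forall i j, Lpnorm p (fun z => M z i j) <= B)%E -> (mxLpnorm p M <= B)%E.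
Proof.
move=> B0 MB; rewrite /mxLpnorm.
elim/big_ind: _ => // [x y xB yB|i _]; first by rewrite ge_max xB.
by elim/big_ind: _ => // x y xB yB; rewrite ge_max xB.
Qed.

Lemma le_mxLpnorm (p : R) M i j : (Lpnorm p (fun z => M z i j) <= mxLpnorm p M)%E.
Proof.
rewrite /mxLpnorm; apply: (@le_trans _ _ (\big[maxe/0%E]_(j < 2) Lpnorm p (fun z => M z i j))).
  exact: (le_bigmax_cond _ (fun j => Lpnorm p (fun z => M z i j))).
exact: (le_bigmax_cond _ (fun i => \big[maxe/0%E]_(j < 2) Lpnorm p (fun z => M z i j))).
Qed.

Lemma mxLpnorm_ge0 (p : R) M : (0 <= mxLpnorm p M)%E.
Proof. by apply: le_trans (le_mxLpnorm p M 0 0); exact: poweR_ge0. Qed.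

Lemma mxLpnorm_lty (p : R) M : (forall i j, Lpnorm p (fun z => M z i j) < +oo)%E ->
  (mxLpnorm p M < +oo)%E.
Proof.
move=> MB; rewrite /mxLpnorm.
elim/big_ind: _ => [|x y xB yB|i _]; [by rewrite ltry|by rewrite gt_max xB|].
by elim/big_ind: _ => [|x y xB yB|j _//]; [by rewrite ltry|by rewrite gt_max xB].
Qed.

Lemma mxLpnorm_fin (p : R) M : (forall i j, Lpnorm p (fun z => M z i j) < +oo)%E ->
  exists2 x : R, mxLpnorm p M = x%:E & 0 <= x.
Proof.
move=> MB; have := mxLpnorm_lty MB; have := mxLpnorm_ge0 p M.
by case: (mxLpnorm p M) => // x; rewrite lee_fin => x0 _; exists x.
Qed.

End MatrixNorms.

(** * The distance between two spectral factors *)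

Section FactorDistance.
Variable R : realType.
Local Notation mu := (@lebesgue_measure R).
Local Notation period := (@period R).
Local Notation ig u := (mu.-integrable period (EFin \o u)).
Local Notation "\Int u" := (Rintegral mu period u) (at level 10).
Local Notation cmeas F := (cmeasurable period (fun t => F (cis t))).

Lemma ae_sub3 (P P' P'' Q : R -> Prop) : (forall t, P t -> P' t -> P'' t -> Q t) ->
  {ae mu, forall t, P t} -> {ae mu, forall t, P' t} -> {ae mu, forall t, P'' t} ->
  {ae mu, forall t, Q t}.
Proof.
move=> PQ aeP aeP' aeP''.
apply: (@ae_sub2 _ (fun t => P t /\ P' t) P'') => //.
- by move=> t [pt pt']; exact: PQ.
- by apply: ae_sub2 aeP aeP' => t pt pt'; split.
Qed.

Section Distance.
Variables (g phi phi' x y z w x' y' z' w' : R[i] -> R[i]).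
Hypotheses (hx : hardy 2 x) (hy : hardy 2 y) (hz : hardy 2 z) (hw : hardy 2 w)
  (hx' : hardy 2 x') (hy' : hardy 2 y') (hz' : hardy 2 z') (hw' : hardy 2 w').
Let h v := x v * w v - y v * z v.
Let h' v := x' v * w' v - y' v * z' v.
Hypotheses (oh : outer h) (oh' : outer h').
Hypotheses (mg : cmeas g) (mphi : cmeas phi) (mphi' : cmeas phi').
Hypothesis g_neq0 : {ae mu, forall t, period t -> g (cis t) != 0}.
(** The first column of [chi chi^* = L L^*]. Beyond it [unitary_rows] takes only the determinant, so
    that [f] does not occur. *)
Definition factor_rows (g phi x y z w : R[i] -> R[i]) (v : R[i]) : Prop :=
  x v * Num.conj (x v) + y v * Num.conj (y v) = g v * Num.conj (g v) /\
  z v * Num.conj (x v) + w v * Num.conj (y v) = phi v * Num.conj (g v).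
Hypotheses
  (rows : {ae mu, forall t, period t -> factor_rows g phi x y z w (cis t)})
  (rows' : {ae mu, forall t, period t -> factor_rows g phi' x' y' z' w' (cis t)})
  (hh' : {ae mu, forall t, period t -> cabs (h (cis t)) = cabs (h' (cis t))})
  (iphi : ig (fun t => cabs (phi' (cis t) - phi (cis t)) ^+ 2))
  (igh : ig (fun t => (cabs (g (cis t)) / cabs (h (cis t))) ^+ 2))
  (y0 : y 0 = 0) (y0' : y' 0 = 0) (x0 : 0 < x 0) (w0 : 0 < w 0)
  (x0' : 0 < x' 0) (w0' : 0 < w' 0).

Let mx : cmeas x. Proof. exact: hardy_cmeasurable hx. Qed.
Let my : cmeas y. Proof. exact: hardy_cmeasurable hy. Qed.
Let mz : cmeas z. Proof. exact: hardy_cmeasurable hz. Qed.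
Let mw : cmeas w. Proof. exact: hardy_cmeasurable hw. Qed.
Let mx' : cmeas x'. Proof. exact: hardy_cmeasurable hx'. Qed.
Let my' : cmeas y'. Proof. exact: hardy_cmeasurable hy'. Qed.
Let mz' : cmeas z'. Proof. exact: hardy_cmeasurable hz'. Qed.
Let mw' : cmeas w'. Proof. exact: hardy_cmeasurable hw'. Qed.
Let mh : cmeas h. Proof. exact: (cmeasurableB (cmeasurableM mx mw) (cmeasurableM my mz)). Qed.
Let mh' : cmeas h'. Proof. exact: (cmeasurableB (cmeasurableM mx' mw') (cmeasurableM my' mz')). Qed.

Let det_limit p q r s : hardy 2 p -> hardy 2 q -> hardy 2 r -> hardy 2 s ->
  {ae mu, forall t, period t -> radial_limit
    (fun k => p (k%:C * cis t) * q (k%:C * cis t) - r (k%:C * cis t) * s (k%:C * cis t))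
    (p (cis t) * q (cis t) - r (cis t) * s (cis t))}.
Proof.
move=> /hardy_radial_ae pl /hardy_radial_ae ql /hardy_radial_ae rl /hardy_radial_ae sl.
have H1 := ae_sub2 (fun t (pt : period t -> _) (qt : period t -> _) =>
  (fun Dt : period t => conj (pt Dt) (qt Dt))) pl ql.
have H2 := ae_sub2 (fun t (pt : period t -> _) (qt : period t -> _) =>
  (fun Dt : period t => conj (pt Dt) (qt Dt))) rl sl.
apply: ae_sub2 H1 H2 => t a b Dt.
have [p1 q1] := a Dt; have [r1 s1] := b Dt.
exact: radial_limitB (radial_limitM p1 q1) (radial_limitM r1 s1).
Qed.

Let h_eq v : cabs v < 1 -> h v = h' v.
Proof.
apply: outer_unique oh oh' mh mh' hh' _ _ v.
  by rewrite /h y0 mul0r subr0 mulr_gt0.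
by rewrite /h' y0' mul0r subr0 mulr_gt0.
Qed.

(** Uniqueness of outer functions gives equality inside the disc only; it passes to the circle
    because both determinants have their boundary values as radial limits almost everywhere. *)
Let h_boundary : {ae mu, forall t, period t -> h' (cis t) = h (cis t)}.
Proof.
have H1 := det_limit hx hw hy hz; have H2 := det_limit hx' hw' hy' hz'.
apply: ae_sub2 H1 H2 => t a b Dt.
apply: radial_limit_unique (b Dt) _; apply: eq_radial_limit (a Dt) => r r01.
by apply: h_eq; case/andP: r01 => r0 r1; rewrite cabs_rcis.
Qed.

Let P v := w v * x' v - y v * z' v - z v * y' v + x v * w' v.

Let P_limit : hardy1_limit P.
Proof.
have H (p q : R[i] -> R[i]) : hardy 2 p -> hardy 2 q -> hardy1_limit (fun v => p v * q v).
  exact: hardy2_mul.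
rewrite /P; apply: hardy1_limitD; last exact: H.
apply: (@hardy1_limitD _ (fun v => w v * x' v - y v * z' v) (fun v => - (z v * y' v)));
  last by apply: hardy1_limitN; exact: H.
apply: (@hardy1_limitD _ (fun v => w v * x' v) (fun v => - (y v * z' v))); first exact: H.
by apply: hardy1_limitN; exact: H.
Qed.

Let h_neq0 : {ae mu, forall t, period t -> h (cis t) != 0}.
Proof. by have [_ +] := outer_representation oh. Qed.

Let D2 t := unitary_dist2 (g (cis t)) (x (cis t)) (y (cis t)) (x' (cis t)) (y' (cis t)).
Let T t := P (cis t) / h (cis t).
Let A t := cabs (g (cis t)) / cabs (h (cis t)).
Let dphi t := cabs (phi' (cis t) - phi (cis t)).

Let pointwise : {ae mu, forall t, period t ->
  [/\ D2 t <= 2 - Re (T t) + dphi t * A t, cabs (T t) <= 2 + dphi t * A t & D2 t <= 8]}.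
Proof.
have H1 := ae_sub2 (fun t (pt : period t -> _) (qt : period t -> _) =>
  (fun Dt : period t => conj (pt Dt) (qt Dt))) rows rows'.
have H2 := ae_sub2 (fun t (pt : period t -> _) (qt : period t -> _) =>
  (fun Dt : period t => conj (pt Dt) (qt Dt))) g_neq0 h_neq0.
apply: ae_sub3 H1 H2 h_boundary => t a b e Dt.
have [[n1 n2] [n1' n2']] := a Dt; have [g0 h0] := b Dt; have hE := e Dt.
split.
- exact: (unitary_dist2_bound g0 h0 n1 n2 (erefl _) n1' n2' hE).
- exact: (factor_trace_bound g0 h0 n1 n2 (erefl _) n1' n2' hE).
- exact: (unitary_dist2_le8 g0 n1 n2 (erefl _) n1' n2' hE).
Qed.

Let mdphi : measurable_fun period dphi.
Proof. by apply: measurable_cabs; exact: (cmeasurableB mphi' mphi). Qed.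

Let mA : measurable_fun period A.
Proof.
apply: measurable_funM; first exact: (measurable_cabs mg).
by apply: measurable_inv; exact: (measurable_cabs mh).
Qed.

Let mP : cmeas P.
Proof.
exact: (cmeasurableD (cmeasurableB (cmeasurableB (cmeasurableM mw mx') (cmeasurableM my mz'))
  (cmeasurableM mz my')) (cmeasurableM mx mw')).
Qed.

Let mT : cmeasurable period T.
Proof. exact: (cmeasurableM mP (cmeasurableV mh)). Qed.

Let idA : ig (fun t => dphi t * A t).
Proof. exact: (integrable_EFin_mul_sqr measurable_period mdphi mA iphi igh). Qed.

Lemma factor_trace_cintegrable : cintegrable mu period T.
Proof.
apply: (@cintegrable_ae_le _ _ _ mu period measurable_period _ (fun t => 2 + dphi t * A t)).
- exact: mT.
- by apply: integrable_EFinD => //; exact: (integrable_EFin_cst measurable_period mu_period_lty).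
- by apply: ae_sub pointwise => t + Dt => /(_ Dt) [].
Qed.

Lemma unitary_dist2_integrable : ig D2.
Proof.
apply: (@integrable_EFin_ae_le _ _ _ mu period measurable_period _ (fun=> 8)).
- apply: measurable_funD; apply: measurable_funX; apply: measurable_cabs.
    exact: (cmeasurableB (cmeasurableM mx' (cmeasurableV mg)) (cmeasurableM mx (cmeasurableV mg))).
  exact: (cmeasurableB (cmeasurableM my' (cmeasurableV mg)) (cmeasurableM my (cmeasurableV mg))).
- exact: (integrable_EFin_cst measurable_period mu_period_lty).
- apply: ae_sub pointwise => t + Dt => /(_ Dt) [_ _ D8].
  by rewrite ger0_norm// addr_ge0 ?sqr_ge0.
Qed.

Lemma factor_trace_mean : 4 * pi <= \Int (fun t => Re (T t)).
Proof.
have [il _ [c c1 hE]] := outer_representation oh.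
have hlim := det_limit hx hw hy hz.
have := smirnov_mean il c1 hE mh h_neq0 hlim P_limit factor_trace_cintegrable.
move=> /(congr1 (@complex.Re R)) /= ->.
have z1 : cabs (0 : R[i]) < 1 by rewrite cabs0.
have := h_eq z1; rewrite /h' /P /h y0 y0' !mul0r mulr0 !subr0.
have [X X0 ->] := posC_real x0; have [W W0 ->] := posC_real w0.
have [X' X0' ->] := posC_real x0'; have [W' W0' ->] := posC_real w0'.
rewrite -!rmorphM -rmorphD -fmorphV -!rmorphM /= => /complexI E.
have XW : 0 < X * W by rewrite mulr_gt0.
have -> : 4 * pi = 2 * pi * 2 :> R by ring.
rewrite ler_pM2l ?two_pi_gt0// ler_pdivlMr//.
have s0 : 0 <= W * X' + X * W' by rewrite addr_ge0// mulr_ge0// ltW.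
rewrite -(ler_pXn2r (ltn0Sn 1)) ?nnegrE//; last by rewrite mulr_ge0// ltW.
rewrite -subr_ge0.
(* The inequality of arithmetic and geometric means: the last term vanishes because the determinants
   agree at 0. *)
have -> : (W * X' + X * W') ^+ 2 - (2 * (X * W)) ^+ 2 =
  (W * X' - X * W') ^+ 2 + 4 * (X * W) * (X' * W' - X * W) by ring.
by rewrite -E subrr mulr0 addr0 sqr_ge0.
Qed.

Lemma unitary_dist2_mean : \Int D2 <=
  Num.sqrt (\Int (fun t => dphi t ^+ 2)) * Num.sqrt (\Int (fun t => A t ^+ 2)).
Proof.
apply: le_trans (Cauchy_Schwarz_sqrt measurable_period mdphi mA iphi igh).
have [iT _] := factor_trace_cintegrable.
have i2 : ig (fun t : R => 2 : R) by exact: (integrable_EFin_cst measurable_period mu_period_lty).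
have i3 : ig (fun t => 2 - Re (T t)) by exact: integrable_EFinB.
apply: (@le_trans _ _ (\Int (fun t => 2 - Re (T t) + dphi t * A t))).
  apply: le_Rintegral_ae => //; first exact: unitary_dist2_integrable.
    exact: integrable_EFinD.
  by apply: ae_sub pointwise => t + Dt => /(_ Dt) [].
rewrite RintegralD// RintegralB//.
have -> : \Int (fun=> 2) = 4 * pi.
  rewrite (Rintegral_cst _ measurable_period).
  have /(congr1 fine) /= -> := mu_period R; ring.
rewrite gerDr subr_le0; exact: factor_trace_mean.
Qed.

Lemma factor_entries_bound : {ae mu, forall t, period t ->
  [/\ cabs (x' (cis t) - x (cis t)) <= cabs (g (cis t)) * Num.sqrt (D2 t),
      cabs (y' (cis t) - y (cis t)) <= cabs (g (cis t)) * Num.sqrt (D2 t)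
    & forall m : R, z (cis t) * Num.conj (z (cis t)) + w (cis t) * Num.conj (w (cis t)) = m%:C ->
      cabs (z' (cis t) - z (cis t)) <= dphi t + Num.sqrt m * Num.sqrt (D2 t) /\
      cabs (w' (cis t) - w (cis t)) <= dphi t + Num.sqrt m * Num.sqrt (D2 t)]}.
Proof.
have H1 := ae_sub2 (fun t (pt : period t -> _) (qt : period t -> _) =>
  (fun Dt : period t => conj (pt Dt) (qt Dt))) rows rows'.
apply: ae_sub3 H1 g_neq0 h_boundary => t a b e Dt.
have [[n1 n2] [n1' n2']] := a Dt; have g0 := b Dt; have hE := e Dt.
have [r1 r2] := first_row_bound g0 n1 n2 (erefl _) n1' n2' hE.
split=> // m mE.
exact: (second_row_bound g0 n1 n2 (erefl _) n1' n2' hE mE).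
Qed.

End Distance.

End FactorDistance.

(* The norm estimate for the spectral factors *)
Local Close Scope classical_set_scope.

Theorem theorem1 (R : realType) (a b c : R[i] -> R[i])
  (S := fun z => mx2 (a z) (b z) (Num.conj (b z)) (c z))
  (Delta := fun z => a z * c z - `|b z| ^+ 2)
  (a_L1 : Lp 1 a) (b_L1 : Lp 1 b) (c_L1 : Lp 1 c)
  (S_posdef : ae_circle (fun z => posdefmx (S z)))
  (a_ge0 : ae_circle (fun z => 0 <= a z))
  (Delta_ge0 : ae_circle (fun z => 0 <= Delta z))
  (log_Delta_L1 : (@lebesgue_measure R).-integrable (@period R)
     (fun t => lne (complex.Re (Delta (cis t)))%:E))
  (Sinv_L1 : mxLp 1 (fun z => invmx (S z)))
  (g f : R[i] -> R[i])
  (g_H2 : hardy 2 g) (g_outer : outer g)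
  (g_abs : ae_circle (fun z => `|g z| ^+ 2 = a z)) (g0 : 0 < g 0)
  (f_H2 : hardy 2 f) (f_outer : outer f)
  (f_abs : ae_circle (fun z => `|f z| ^+ 2 = Delta z / a z)) (f0 : 0 < f 0)
  (phi := fun z => Num.conj (b z) / Num.conj (g z))
  (chi : R[i] -> 'M[R[i]]_2) (chi_S : canonical_spectral_factor S chi)
  (phi_ : nat -> R[i] -> R[i])
  (phi_n : forall n, (0 < n)%N -> fourier_tail_sum n phi (phi_ n))
  (S_ := fun n z => mx2 (g z) 0 (phi_ n z) (f z) *m
     mx2 (Num.conj (g z)) (Num.conj (phi_ n z)) 0 (Num.conj (f z)))
  (chi_ : nat -> R[i] -> 'M[R[i]]_2)
  (chi_n : forall n, (0 < n)%N -> canonical_spectral_factor (S_ n) (chi_ n)) :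
  forall n, (0 < n)%N ->
  (mxLpnorm 1 (fun z => (chi_ n z - chi z)%R)
   <= (Num.sqrt 2)%:E * mxLpnorm 1 S `^ 2^-1
        * mxLpnorm 1 (fun z => invmx (S z)) `^ 4^-1
        * Lpnorm 2 (fun z => (phi_ n z - phi z)%R) `^ 2^-1
      + Lpnorm 1 (fun z => (phi_ n z - phi z)%R))%E.
Proof.
move=> n n0; set mu := @lebesgue_measure R.
pose X i j (v : R[i]) := chi v i j; pose Y i j (v : R[i]) := chi_ n v i j.
have [hX oX SX [X01 X00 X11]] := chi_S.
have [hY oY SY [Y01 Y00 Y11]] := chi_n n n0.
have [[mp1 mp2 phiL2] _] := phi_n n n0.
have detX : (fun v => \det (chi v)) = (fun v => X 0 0 v * X 1 1 v - X 0 1 v * X 1 0 v).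
  by apply/funext => v; rewrite det2E.
have detY : (fun v => \det (chi_ n v)) = (fun v => Y 0 0 v * Y 1 1 v - Y 0 1 v * Y 1 0 v).
  by apply/funext => v; rewrite det2E.
rewrite detX in oX; rewrite detY in oY.
have [_ g_neq0 _] := outer_representation g_outer.
have [_ X_neq0 _] := outer_representation oX.
have mX i j : cmeasurable (@period R) (fun t => X i j (cis t)) := hardy_cmeasurable (hX i j).
have mY i j : cmeasurable (@period R) (fun t => Y i j (cis t)) := hardy_cmeasurable (hY i j).
have mg := hardy_cmeasurable g_H2.
have ma := Lp_cmeasurable a_L1; have mb := Lp_cmeasurable b_L1; have mc := Lp_cmeasurable c_L1.
have mphi : cmeasurable (@period R) (fun t => phi (cis t)).
  exact: (cmeasurableM (cmeasurable_conj mb) (cmeasurableV (cmeasurable_conj mg))).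
have mphi' : cmeasurable (@period R) (fun t => phi_ n (cis t)) by split.
have entriesX : {ae mu, forall t, (@period R) t -> let v := cis t in
   [/\ a v = g v * Num.conj (g v),
       a v = X 0 0 v * Num.conj (X 0 0 v) + X 0 1 v * Num.conj (X 0 1 v),
       b v = X 0 0 v * Num.conj (X 1 0 v) + X 0 1 v * Num.conj (X 1 1 v),
       Num.conj (b v) = X 1 0 v * Num.conj (X 0 0 v) + X 1 1 v * Num.conj (X 0 1 v) &
       c v = X 1 0 v * Num.conj (X 1 0 v) + X 1 1 v * Num.conj (X 1 1 v)]}.
  apply: ae_sub2 SX g_abs => t SX gE Dt v.
  have [S00 S01 S10 S11] := mx2E (a v) (b v) (Num.conj (b v)) (c v).
  have := SX Dt => /matrixP SE; split.
  - by rewrite -(gE Dt) normCK.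
  - by rewrite -S00 -/(S v) SE mulmx2E !adjmx2E.
  - by rewrite -S01 -/(S v) SE mulmx2E !adjmx2E.
  - by rewrite -S10 -/(S v) SE mulmx2E !adjmx2E.
  - by rewrite -S11 -/(S v) SE mulmx2E !adjmx2E.
have rowsX : {ae mu, forall t, (@period R) t ->
    factor_rows g phi (X 0 0) (X 0 1) (X 1 0) (X 1 1) (cis t)}.
  apply: ae_sub2 entriesX g_neq0 => t E gn Dt; have [e1 e2 _ e3 _] := E Dt.
  split; first by rewrite -e2.
  by rewrite -e3 /phi divfK// conjC_eq0 gn.
have rowsY : {ae mu, forall t, (@period R) t ->
    factor_rows g (phi_ n) (Y 0 0) (Y 0 1) (Y 1 0) (Y 1 1) (cis t)}.
  apply: ae_sub SY => t SY Dt; have := SY Dt => /matrixP SE.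
  have [s00 s01 s10 s11] := mx2E (g (cis t)) 0 (phi_ n (cis t)) (f (cis t)).
  have [t00 t01 t10 t11] := mx2E (Num.conj (g (cis t))) (Num.conj (phi_ n (cis t))) 0
    (Num.conj (f (cis t))).
  split.
    by have := SE 0 0; rewrite /S_ !mulmx2E !adjmx2E s00 s01 t00 t10 mul0r addr0.
  by have := SE 1 0; rewrite /S_ !mulmx2E !adjmx2E s10 s11 t00 t10 mulr0 addr0.
(* Both squared moduli equal [Delta]: one is [det S = a c - |b|^2], the other [|g|^2 |f|^2]. *)
have XY_abs : {ae mu, forall t, (@period R) t ->
    cabs (X 0 0 (cis t) * X 1 1 (cis t) - X 0 1 (cis t) * X 1 0 (cis t)) =
    cabs (Y 0 0 (cis t) * Y 1 1 (cis t) - Y 0 1 (cis t) * Y 1 0 (cis t))}.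
  have H := ae_sub2 (fun t (pt : (@period R) t -> _) (qt : (@period R) t -> _) =>
    (fun Dt : (@period R) t => conj (pt Dt) (qt Dt))) SY f_abs.
  apply: ae_sub3 entriesX H g_neq0 => t E H gn Dt.
  have [eg e1 e2 e3 e4] := E Dt; have [/(congr1 determinant) dY fE] := H Dt; have gn0 := gn Dt.
  apply/eqP; rewrite -(@eqrXn2 _ 2) ?cabs_ge0// -(inj_eq (@complexI R)) !sqr_cabsC.
  apply/eqP.
  rewrite -!det2E -!det_adjmx2 -!det_mulmx.
  have a0 : a (cis t) != 0 by rewrite eg mulf_neq0// conjC_eq0.
  rewrite -dY /S_ [in RHS]det_mulmx !det2E.
  have [s00 s01 s10 s11] := mx2E (g (cis t)) 0 (phi_ n (cis t)) (f (cis t)).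
  have [t00 t01 t10 t11] := mx2E (Num.conj (g (cis t))) (Num.conj (phi_ n (cis t))) 0
    (Num.conj (f (cis t))).
  rewrite s00 s01 s10 s11 t00 t01 t10 t11 mul0r mulr0 !subr0.
  rewrite mulrACA -eg -normCK fE. rewrite [RHS]mulrC divfK// /Delta.
  rewrite !mulmx2E !adjmx2E -[chi _ 0 0]/(X 0 0 _) -[chi _ 0 1]/(X 0 1 _)
    -[chi _ 1 0]/(X 1 0 _) -[chi _ 1 1]/(X 1 1 _).
  by rewrite -e1 -e2 -e3 -e4 normCK.
have ic := Lpnorm1_integrable mc (let: And3 _ _ k := c_L1 in k).
have ia := Lpnorm1_integrable ma (let: And3 _ _ k := a_L1 in k).
(* The squared length of the second row of the triangular factor is [c], and it dominates [|phi|^2];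
   hence [phi] is square integrable. *)
have c_norm : {ae mu, forall t, (@period R) t ->
    cabs (phi (cis t)) ^+ 2 <= cabs (c (cis t)) /\
    X 1 0 (cis t) * Num.conj (X 1 0 (cis t)) + X 1 1 (cis t) * Num.conj (X 1 1 (cis t)) =
    (cabs (c (cis t)))%:C}.
  apply: ae_sub3 entriesX rowsX g_neq0 => t E F gn Dt.
  have [_ _ _ _ e4] := E Dt; have [n1 n2] := F Dt.
  have := second_row_norm (gn Dt) n1 n2 (erefl _); rewrite -e4 => ->.
  rewrite cabs_real ger0_norm ?addr_ge0 ?sqr_ge0//.
  by split=> //; rewrite lerDl sqr_ge0.
have iphi : lebesgue_measure.-integrable (@period R)
    (EFin \o (fun t => cabs (phi (cis t)) ^+ 2)).
  apply: (@integrable_EFin_ae_le _ _ _ mu (@period R) measurable_period _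
    (fun t => cabs (c (cis t)))) => //.
    by apply: measurable_funX; exact: (measurable_cabs mphi).
  apply: ae_sub c_norm => t H Dt; have [h1 _] := H Dt.
  by rewrite ger0_norm ?sqr_ge0.
have iphi' := Lpnorm2_integrable mphi' phiL2.
have idphi := integrable_EFin_sqr_cabsB mphi' mphi iphi' iphi.
have [ms1 ms2 Sinv_lty] := Sinv_L1 1 1.
have iSinv := Lpnorm1_integrable (conj ms1 ms2) Sinv_lty.
(* The last diagonal entry of [S^-1] is [a / det S = |g|^2 / |det chi|^2], so integrability of
   [S^-1] makes [g / det chi] square integrable. *)
have Sinv_eq : {ae mu, forall t, (@period R) t -> cabs (invmx (S (cis t)) 1 1) =
    (cabs (g (cis t)) / cabs (X 0 0 (cis t) * X 1 1 (cis t) - X 0 1 (cis t) * X 1 0 (cis t))) ^+ 2}.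
  apply: ae_sub3 entriesX X_neq0 SX => t E hn SE Dt.
  have [eg _ _ _ _] := E Dt; have {}hn := hn Dt; have {}SE := SE Dt.
  have dS : \det (S (cis t)) = (cabs (X 0 0 (cis t) * X 1 1 (cis t) -
      X 0 1 (cis t) * X 1 0 (cis t)) ^+ 2)%:C.
    by rewrite SE det_mulmx det_adjmx2 sqr_cabsC det2E.
  rewrite invmx2_11; last first.
    by rewrite dS (inj_eq (@complexI R) _ 0) sqrf_eq0 cabs_eq0.
  rewrite dS; have [-> _ _ _] := mx2E (a (cis t)) (b (cis t)) (Num.conj (b (cis t))) (c (cis t)).
  by rewrite eg -sqr_cabsC cabsM cabsV !cabs_real !ger0_norm ?sqr_ge0// exprMn exprVn.
have mh : cmeasurable (@period R) (fun t =>
    X 0 0 (cis t) * X 1 1 (cis t) - X 0 1 (cis t) * X 1 0 (cis t)).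
  exact: (cmeasurableB (cmeasurableM (mX 0 0) (mX 1 1)) (cmeasurableM (mX 0 1) (mX 1 0))).
have mA : measurable_fun (@period R) (fun t =>
    (cabs (g (cis t)) / cabs (X 0 0 (cis t) * X 1 1 (cis t) - X 0 1 (cis t) * X 1 0 (cis t))) ^+ 2).
  apply: measurable_funX; apply: measurable_funM; first exact: (measurable_cabs mg).
  by apply: measurable_inv; exact: (measurable_cabs mh).
have igh := integrable_EFin_ae_eq measurable_period mA Sinv_eq iSinv.
have Ymean := unitary_dist2_mean (hX 0 0) (hX 0 1) (hX 1 0) (hX 1 1)
  (hY 0 0) (hY 0 1) (hY 1 0) (hY 1 1) oX oY mg mphi mphi' g_neq0 rowsX rowsY XY_abs
  idphi igh X01 Y01 X00 X11 Y00 Y11.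
have iD := unitary_dist2_integrable (hX 0 0) (hX 0 1) (hX 1 0) (hX 1 1)
  (hY 0 0) (hY 0 1) (hY 1 0) (hY 1 1) oX oY mg g_neq0 rowsX rowsY XY_abs
  X01 Y01 X00 X11 Y00 Y11.
have entries := factor_entries_bound (hX 0 0) (hX 0 1) (hX 1 0) (hX 1 1)
  (hY 0 0) (hY 0 1) (hY 1 0) (hY 1 1) oX oY g_neq0 rowsX rowsY XY_abs
  X01 Y01 X00 X11 Y00 Y11.
set D := fun t => unitary_dist2 _ _ _ _ _ in iD entries Ymean.
have D0 t : 0 <= D t by exact: unitary_dist2_ge0.
have sqrtD t : Num.sqrt (D t) ^+ 2 = D t by rewrite sqr_sqrtr.
have mD : measurable_fun (@period R) (fun t => Num.sqrt (D t)).
  have -> : (fun t => Num.sqrt (D t)) = (fun t => D t `^ 2^-1).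
    by apply/funext => t; rewrite powR12_sqrt.
  by apply: (measurableT_comp (measurable_powR 2^-1)); exact: integrable_EFin_measurable iD.
have iD2 : mu.-integrable (@period R) (EFin \o (fun t => Num.sqrt (D t) ^+ 2)).
  by under eq_fun do rewrite sqrtD.
(* On a set of finite measure square integrability implies integrability, through the product with
   1. *)
have ig_sqr (u : R -> R) : measurable_fun (@period R) u ->
    mu.-integrable (@period R) (EFin \o (fun t => u t ^+ 2)) ->
    mu.-integrable (@period R) (EFin \o u).
  move=> mu_ iu.
  have i1 : mu.-integrable (@period R) (EFin \o (fun t : R => (1 : R) ^+ 2)).
    exact: (integrable_EFin_cst measurable_period mu_period_lty).
  have := integrable_EFin_mul_sqr measurable_period mu_ (measurable_cst _) iu i1.
  by under eq_fun do rewrite mulr1.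
have idphi1 := ig_sqr _ (measurable_cabs (cmeasurableB mphi' mphi)) idphi.
have iXY i j : mu.-integrable (@period R) (EFin \o (fun t => cabs (Y i j (cis t) - X i j (cis t)))).
  apply: ig_sqr; first exact: (measurable_cabs (cmeasurableB (mY i j) (mX i j))).
  exact: integrable_EFin_sqr_cabsB (mY i j) (mX i j)
    (hardy2_integrable (hY i j)) (hardy2_integrable (hX i j)).
have ig2 := hardy2_integrable g_H2.
have S_lty i j : (Lpnorm 1 (fun z => S z i j) < +oo)%E.
  have [_ _ La] := a_L1; have [_ _ Lb] := b_L1; have [_ _ Lc] := c_L1.
  elim/ord2_ind: i; elim/ord2_ind: j.
  - by have -> : (fun z => S z 0 0) = a by apply/funext => z; rewrite mxE.
  - by have -> : (fun z => S z 0 1) = b by apply/funext => z; rewrite mxE.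
  - have -> : (fun z => S z 1 0) = (fun z => Num.conj (b z)) by apply/funext => z; rewrite mxE.
    by move: Lb; rewrite /Lpnorm; under [in X in _ -> X]eq_integral do rewrite cabs_conj.
  - by have -> : (fun z => S z 1 1) = c by apply/funext => z; rewrite mxE.
have [NS NSE NS0] := mxLpnorm_fin S_lty.
have [NI NIE NI0] := mxLpnorm_fin (fun i j => let: And3 _ _ k := Sinv_L1 i j in k).
have aNS : Rintegral mu (@period R) (fun t => cabs (a (cis t))) <= NS.
  rewrite -lee_fin -NSE -(Lpnorm1E ia).
  have -> : a = (fun z => S z 0 0) by apply/funext => z; rewrite mxE.
  exact: le_mxLpnorm.
have cNS : Rintegral mu (@period R) (fun t => cabs (c (cis t))) <= NS.
  rewrite -lee_fin -NSE -(Lpnorm1E ic).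
  have -> : c = (fun z => S z 1 1) by apply/funext => z; rewrite mxE.
  exact: le_mxLpnorm.
have iNI : Rintegral mu (@period R) (fun t => cabs (invmx (S (cis t)) 1 1)) <= NI.
  by rewrite -lee_fin -NIE -(@Lpnorm1E _ (fun z => invmx (S z) 1 1) iSinv);
    exact: (le_mxLpnorm 1 (fun z => invmx (S z)) 1 1).
rewrite NSE NIE (Lpnorm2E idphi) (Lpnorm1E idphi1) !poweR_EFin -!EFinM -EFinD.
set d := Rintegral _ _ (fun t => cabs _ ^+ 2) in Ymean *.
set d1 := Rintegral _ _ _.
have d10 : 0 <= d1 by apply: Rintegral_ge0 => t _; exact: cabs_ge0.
have meanD : Rintegral mu (@period R) D <= Num.sqrt d * Num.sqrt NI.
  apply: (le_trans Ymean); apply: ler_wpM2l; first exact: sqrtr_ge0.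
  rewrite ler_sqrt//; apply: le_trans iNI; rewrite le_eqVlt; apply/orP; left; apply/eqP.
  apply: Rintegral_ae_eq => //; first exact: (integrable_EFin_measurable iSinv).
  by apply: ae_sub Sinv_eq => t H Dt; rewrite H.
(* [Num.sqrt d] is the [L_2] norm of [phi_n - phi], so [B] carries the exponents 1/2 for [S], 1/4
   for [S^-1] and 1/2 for [phi_n - phi]. *)
set B := Num.sqrt NS * Num.sqrt (Num.sqrt d * Num.sqrt NI).
have B0 : 0 <= B by rewrite mulr_ge0 ?sqrtr_ge0.
have -> : Num.sqrt 2 * NS `^ 2^-1 * NI `^ 4^-1 * Num.sqrt d `^ 2^-1 = Num.sqrt 2 * B.
  have -> : 4^-1 = 2^-1 * 2^-1 :> R by field.
  rewrite powRrM !powR12_sqrt ?sqrtr_ge0// /B sqrtrM ?sqrtr_ge0//; ring.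
(* The argument yields the factor 1, which [Num.sqrt 2] dominates. *)
have B2 : B <= Num.sqrt 2 * B by rewrite ler_peMl// -{1}sqrtr1 ler_sqrt ?ler1n.
(* It is applied to [|g|] and to the square root of [|c|], the integrals of whose squares are the
   norms of the diagonal entries [a] and [c] of [S]. *)
have CS (v : R -> R) : measurable_fun (@period R) v ->
    mu.-integrable (@period R) (EFin \o (fun t => v t ^+ 2)) ->
    Rintegral mu (@period R) (fun t => v t ^+ 2) <= NS ->
    Rintegral mu (@period R) (fun t => v t * Num.sqrt (D t)) <= B.
  move=> mv iv vNS.
  apply: (le_trans (Cauchy_Schwarz_sqrt measurable_period mv mD iv iD2)).
  under [X in _ * Num.sqrt X]eq_Rintegral do rewrite sqrtD.
  by apply: ler_pM; rewrite ?sqrtr_ge0// ler_sqrt// mulr_ge0 ?sqrtr_ge0.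
have RHS0 : 0 <= Num.sqrt 2 * B + d1 by rewrite addr_ge0// mulr_ge0 ?sqrtr_ge0.
apply: mxLpnorm_le; first by rewrite lee_fin.
have gNS : Rintegral mu (@period R) (fun t => cabs (g (cis t)) ^+ 2) <= NS.
  apply: le_trans aNS; rewrite le_eqVlt; apply/orP; left; apply/eqP.
  apply: Rintegral_ae_eq => //; [exact: integrable_EFin_measurable ig2|exact: integrable_EFin_measurable ia|].
  apply: ae_sub entriesX => t E Dt; have [-> _ _ _ _] := E Dt.
  by rewrite cabsM cabs_conj expr2.
have mcc : measurable_fun (@period R) (fun t => Num.sqrt (cabs (c (cis t)))).
  have -> : (fun t => Num.sqrt (cabs (c (cis t)))) = (fun t => cabs (c (cis t)) `^ 2^-1).
    by apply/funext => t; rewrite powR12_sqrt ?cabs_ge0.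
  by apply: (measurableT_comp (measurable_powR 2^-1)); exact: (measurable_cabs mc).
have icc : mu.-integrable (@period R) (EFin \o (fun t => Num.sqrt (cabs (c (cis t))) ^+ 2)).
  by under eq_fun do rewrite sqr_sqrtr ?cabs_ge0//.
have ccNS : Rintegral mu (@period R) (fun t => Num.sqrt (cabs (c (cis t))) ^+ 2) <= NS.
  by under eq_Rintegral do rewrite sqr_sqrtr ?cabs_ge0//.
have igrD := integrable_EFin_mul_sqr measurable_period (measurable_cabs mg) mD ig2 iD2.
have icD := integrable_EFin_mul_sqr measurable_period mcc mD icc iD2.
have row0 i j : {ae mu, forall t, (@period R) t ->
      cabs (Y i j (cis t) - X i j (cis t)) <= cabs (g (cis t)) * Num.sqrt (D t)} ->
    (Lpnorm 1 (fun z => (chi_ n z - chi z)%R i j) <= (Num.sqrt 2 * B + d1)%:E)%E.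
  move=> H; have -> : (fun z => (chi_ n z - chi z) i j) = (fun z => Y i j z - X i j z).
    by apply/funext => z; rewrite !mxE.
  rewrite (Lpnorm1E (iXY i j)) lee_fin.
  apply: (le_trans (le_Rintegral_ae measurable_period (iXY i j) igrD H)).
  apply: (le_trans (CS _ (measurable_cabs mg) ig2 gNS)).
  by apply: (le_trans B2); rewrite lerDl.
have row1 i j : {ae mu, forall t, (@period R) t ->
      cabs (Y i j (cis t) - X i j (cis t)) <= cabs (phi_ n (cis t) - phi (cis t)) +
         Num.sqrt (cabs (c (cis t))) * Num.sqrt (D t)} ->
    (Lpnorm 1 (fun z => (chi_ n z - chi z)%R i j) <= (Num.sqrt 2 * B + d1)%:E)%E.
  move=> H; have -> : (fun z => (chi_ n z - chi z) i j) = (fun z => Y i j z - X i j z).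
    by apply/funext => z; rewrite !mxE.
  rewrite (Lpnorm1E (iXY i j)) lee_fin.
  apply: (le_trans (le_Rintegral_ae measurable_period (iXY i j)
    (integrable_EFinD measurable_period idphi1 icD) H)).
  rewrite RintegralD//.
  rewrite addrC lerD2r; apply: le_trans B2.
  exact: CS mcc icc ccNS.
elim/ord2_ind => j; elim/ord2_ind: j.
- by apply: row0; apply: ae_sub entries => t E Dt; have [] := E Dt.
- by apply: row0; apply: ae_sub entries => t E Dt; have [] := E Dt.
- apply: row1; apply: ae_sub2 entries c_norm => t E C Dt.
  by have [_ _ H] := E Dt; have [_ cE] := C Dt; have [] := H _ cE.
- apply: row1; apply: ae_sub2 entries c_norm => t E C Dt.
  by have [_ _ H] := E Dt; have [_ cE] := C Dt; have [] := H _ cE.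
Qed.
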